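(* Let $p\ge 2$ be a prime and let $\mathfrak{m}$ be the Haar measure on the field $\mathbb{Q}_p$ of $p$-adic numbers. Assume that $\Omega\subset\mathbb{Q}_p$ is a Borel set with $0<\mathfrak{m}(\Omega)<\infty$. Then $\Omega$ is a spectral set if and only if it is a tile of $\mathbb{Q}_p$ by translation. In this case (i.e. if $\Omega$ is a spectral set, equivalently a tile), $\Omega$ must be an almost compact open set.
   Context: Characters: $\chi(x)=e^{2\pi i\{x\}}$ for $x\in\mathbb{Q}_p$, where $\{x\}=\sum_{n=v}^{-1}a_np^n$ is the fractional part of $x=\sum_{n=v}^\infty a_np^n$ ($a_n\in\{0,\dots,p-1\}$). The dual group $\widehat{\mathbb{Q}}_p$ is identified with $\mathbb{Q}_p$ via $\xi\mapsto\chi_\xi$, $\chi_\xi(x)=\chi(\xi x)$. Spectral set: a Borel set $\Omega$ with $0<\mathfrak{m}(\Omega)<\infty$ is a spectral set if there exists a set $\Lambda\subset\widehat{\mathbb{Q}}_p\simeq\mathbb{Q}_p$ such that the characters $\{\chi_\lambda\}_{\lambda\in\Lambda}$, restricted to $\Omega$, form an orthogonal basis of the Hilbert space $L^2(\Omega)$ (equivalently, an orthonormal basis when $\mathfrak{m}|_\Omega$ is normalized to a probability measure). Tile: $\Omega$ is a tile of $\mathbb{Q}_p$ by translation if there exists a set $T\subset\mathbb{Q}_p$ such that $\sum_{t\in T}1_\Omega(x-t)=1$ for $\mathfrak{m}$-almost every $x\in\mathbb{Q}_p$, where $1_\Omega$ is the indicator function of $\Omega$. Almost compact open: a Borel set $\Omega\subset\mathbb{Q}_p$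 is almost compact open if there exists a compact open set $\Omega'\subset\mathbb{Q}_p$ with $\mathfrak{m}(\Omega\setminus\Omega')=\mathfrak{m}(\Omega'\setminus\Omega)=0$. *)

(* Defs.v *)
From HB Require Import structures.
From mathcomp Require Import all_boot all_order all_algebra.
From mathcomp Require Import all_classical all_reals all_analysis.
From mathcomp Require Import complex zify.

Set Implicit Arguments.
Unset Strict Implicit.
Unset Printing Implicit Defensive.

Import Order.TTheory GRing.Theory Num.Theory.

Local Open Scope classical_set_scope.
Local Open Scope ring_scope.

(** * The ring Z_p, as the inverse limit of the rings Z/p^n

    [z n] is the representative in [0, p^n) of the class of [z] modulo p^n,
    i.e. the truncation [\sum_(k < n) a_k p^k] of [z = \sum_k a_k p^k].
    The primality proof is a parameter of the type because the canonical
    integral domain structure (hence the field Q_p) depends on it. *)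

Record padic_int (p : nat) (p_pr : prime p) := PadicInt {
  zresidue :> nat -> nat ;
  _ : `[< forall n, zresidue n = zresidue n.+1 %% p ^ n >]%N }.

HB.instance Definition _ (p : nat) (p_pr : prime p) :=
  [isSub for @zresidue p p_pr].
HB.instance Definition _ (p : nat) (p_pr : prime p) :=
  [Choice of padic_int p_pr by <:].

Section PadicIntRing.
Variables (p : nat) (p_pr : prime p).
Local Notation Zp := (padic_int p_pr).
Implicit Types x y z : Zp.

Lemma zresidueS x n : x n = (x n.+1 %% p ^ n)%N.
Proof. by case: x => x /= /asboolP. Qed.

Lemma expp_gt0 n : (0 < p ^ n)%N.
Proof. by rewrite expn_gt0 prime_gt0. Qed.

Lemma zresidue_lt x n : (x n < p ^ n)%N.
Proof. by rewrite zresidueS ltn_mod expp_gt0. Qed.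

Lemma zresidue_mod x m n : (m <= n)%N -> (x n %% p ^ m)%N = x m.
Proof.
move=> /subnKC <-; elim: (n - m)%N => [|k IH].
  by rewrite addn0 modn_small ?zresidue_lt.
by rewrite -IH [in RHS]zresidueS modn_dvdm ?dvdn_exp2l ?leq_addr // addnS.
Qed.

Lemma padic_intP x y : (forall n, x n = y n) -> x = y.
Proof. by move=> xy; apply/val_inj/funext. Qed.

Lemma mod_padic_subproof (f : nat -> nat) :
  (forall n, f n.+1 = f n %[mod p ^ n])%N ->
  `[< forall n, (f n %% p ^ n = (f n.+1 %% p ^ n.+1) %% p ^ n)%N >].
Proof.
by move=> fE; apply/asboolP => n; rewrite modn_dvdm ?dvdn_exp2l // fE.
Qed.

Definition mk_padic_int f fE : Zp := PadicInt p_pr (@mod_padic_subproof f fE).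

Lemma zcst_subproof (a : nat) n : a = a %[mod p ^ n].
Proof. by []. Qed.

Lemma zadd_subproof x y n : (x n.+1 + y n.+1 = x n + y n %[mod p ^ n])%N.
Proof. by rewrite -modnDm -!zresidueS. Qed.

Lemma zopp_subproof x n :
  (p ^ n.+1 - x n.+1 = p ^ n - x n %[mod p ^ n])%N.
Proof.
apply/eqP; rewrite -(eqn_modDr (x n)) subnK ?(ltnW (zresidue_lt _ _)) //.
rewrite [in X in (_ + X)%N]zresidueS -modnDmr modn_mod modnDmr.
by rewrite subnK ?(ltnW (zresidue_lt _ _)) // expnS modnMl modnn.
Qed.

Lemma zmul_subproof x y n : (x n.+1 * y n.+1 = x n * y n %[mod p ^ n])%N.
Proof. by rewrite -modnMm -!zresidueS. Qed.

Definition zcst a := mk_padic_int (zcst_subproof a).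
Definition zadd x y := mk_padic_int (zadd_subproof x y).
Definition zopp x := mk_padic_int (zopp_subproof x).
Definition zmul x y := mk_padic_int (zmul_subproof x y).

Lemma zaddA : associative zadd.
Proof. by move=> x y z; apply: padic_intP => n /=; rewrite modnDml modnDmr addnA. Qed.
Lemma zaddC : commutative zadd.
Proof. by move=> x y; apply: padic_intP => n /=; rewrite addnC. Qed.
Lemma zadd0 : left_id (zcst 0) zadd.
Proof.
by move=> x; apply: padic_intP => n /=; rewrite mod0n modn_small ?zresidue_lt.
Qed.
Lemma zaddN : left_inverse (zcst 0) zopp zadd.
Proof.
move=> x; apply: padic_intP => n /=.
by rewrite modnDml subnK ?(ltnW (zresidue_lt _ _)) // modnn mod0n.
Qed.

HB.instance Definition _ := GRing.isZmodule.Build Zp zaddA zaddC zadd0 zaddN.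

Lemma zmulA : associative zmul.
Proof. by move=> x y z; apply: padic_intP => n /=; rewrite modnMml modnMmr mulnA. Qed.
Lemma zmulC : commutative zmul.
Proof. by move=> x y; apply: padic_intP => n /=; rewrite mulnC. Qed.
Lemma zmul1 : left_id (zcst 1) zmul.
Proof.
move=> x; apply: padic_intP => n /=.
by rewrite modnMml mul1n modn_small ?zresidue_lt.
Qed.
Lemma zmulDl : left_distributive zmul zadd.
Proof.
move=> x y z; apply: padic_intP => n /=.
by rewrite modnMml modnDm mulnDl.
Qed.
Lemma zone_neq0 : zcst 1 != zcst 0.
Proof.
apply/eqP => /(congr1 (fun x : Zp => x 1%N)) /=.
by rewrite mod0n expn1 modn_small ?prime_gt1.
Qed.

HB.instance Definition _ := GRing.Zmodule_isComNzRing.Build Zp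
  zmulA zmulC zmul1 zmulDl zone_neq0.

Lemma zresidueM x y n : (x * y) n = (x n * y n %% p ^ n)%N.
Proof. by []. Qed.
Lemma zresidueD x y n : (x + y) n = ((x n + y n) %% p ^ n)%N.
Proof. by []. Qed.
Lemma zresidue0 n : (0 : Zp) n = 0%N.
Proof. exact: mod0n. Qed.
Lemma zresidue1 n : (1 : Zp) n = (1 %% p ^ n)%N.
Proof. by []. Qed.

Definition zunit : {pred Zp} := fun x => `[< exists y, y * x = 1 >].
Definition zinv x : Zp := xget x [set y | y * x = 1].

Lemma zmulV : {in zunit, left_inverse 1 zinv *%R}.
Proof.
move=> x /asboolP [y yx]; rewrite /zinv.
by case: xgetP => [z _ //|/(_ y)].
Qed.
Lemma zunitP x y : y * x = 1 -> zunit x.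
Proof. by move=> yx; apply/asboolP; exists y. Qed.
Lemma zinv_out : {in [predC zunit], zinv =1 id}.
Proof.
move=> x /asboolPn nx; rewrite /zinv.
by case: xgetP => [z _ zx|//]; case: nx; exists z.
Qed.

HB.instance Definition _ := GRing.ComNzRing_hasMulInverse.Build Zp
  zmulV zunitP zinv_out.

(** The p-adic valuation of [z != 0]. *)
Definition zval z : nat := xget 0%N [set n | z n = 0%N /\ z n.+1 <> 0%N].

Lemma zvalP z : z != 0 -> z (zval z) = 0%N /\ z (zval z).+1 <> 0%N.
Proof.
move=> z0; rewrite /zval; case: xgetP => [n _ //|no].
have z_0 n : z n = 0%N.
  elim: n => [|n IH]; last by apply: contrapT => h; exact: (no n).
  by have := zresidue_lt z 0; rewrite expn0 ltnS leqn0 => /eqP.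
by case/eqP: z0; apply: padic_intP => n; rewrite z_0 zresidue0.
Qed.

Lemma zresidue_eq0 z n : z != 0 -> (z n == 0%N) = (n <= zval z)%N.
Proof.
move=> /zvalP [v0 v1]; case: leqP => nv.
  by rewrite -(zresidue_mod z nv) v0 mod0n.
by apply/negP => /eqP zn; apply: v1; rewrite -(zresidue_mod z nv) zn mod0n.
Qed.

Lemma logn_zresidue z n : z != 0 -> (zval z < n)%N -> logn p (z n) = zval z.
Proof.
move=> z0 vn; have zn : (0 < z n)%N by rewrite lt0n zresidue_eq0 // -ltnNge.
have dvd k : (k <= n)%N -> (p ^ k %| z n)%N = (k <= zval z)%N.
  by move=> kn; rewrite /dvdn zresidue_mod // zresidue_eq0.
apply/eqP; rewrite eqn_leq -[X in _ && X]pfactor_dvdn // dvd ?leqnn ?andbT; last exact: ltnW.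
by rewrite leqNgt -pfactor_dvdn // dvd // ltnn.
Qed.

Lemma zmul_neq0 x y : x != 0 -> y != 0 -> (x * y) (zval x + zval y).+1 != 0%N.
Proof.
move=> x0 y0; set n := (_ + _).+1.
have vx : (zval x < n)%N by rewrite ltnS leq_addr.
have vy : (zval y < n)%N by rewrite ltnS leq_addl.
have xn : (0 < x n)%N by rewrite lt0n zresidue_eq0 // -ltnNge.
have yn : (0 < y n)%N by rewrite lt0n zresidue_eq0 // -ltnNge.
rewrite zresidueM -/(dvdn _ _) pfactor_dvdn ?muln_gt0 ?xn //.
by rewrite lognM // !logn_zresidue // ltnn.
Qed.

Lemma zmul_eq0 x y : x * y = 0 -> (x == 0) || (y == 0).
Proof.
move=> xy; have [//|x0] := eqVneq x 0; have [//|y0] := eqVneq y 0.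
by have := zmul_neq0 x0 y0; rewrite xy zresidue0.
Qed.

HB.instance Definition _ := GRing.ComUnitRing_isIntegral.Build Zp zmul_eq0.

Lemma zvalM x y : x != 0 -> y != 0 -> zval (x * y) = (zval x + zval y)%N.
Proof.
move=> x0 y0; have xy0 : x * y != 0 by rewrite mulf_neq0.
apply/eqP; rewrite eqn_leq leqNgt -zresidue_eq0 // zmul_neq0 //=.
rewrite -zresidue_eq0 // zresidueM -/(dvdn _ _) expnD dvdn_mul //.
  by rewrite /dvdn zresidue_mod ?leq_addr // zresidue_eq0.
by rewrite /dvdn zresidue_mod ?leq_addl // zresidue_eq0.
Qed.

Lemma zvalD x y : x + y != 0 -> x != 0 -> y != 0 ->
  (minn (zval x) (zval y) <= zval (x + y)%R)%N.
Proof.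
move=> xy0 x0 y0; rewrite -zresidue_eq0 // zresidueD.
have /eqP -> : x (minn (zval x) (zval y)) == 0%N by rewrite zresidue_eq0 ?geq_minl.
have /eqP -> : y (minn (zval x) (zval y)) == 0%N by rewrite zresidue_eq0 ?geq_minr.
by rewrite mod0n.
Qed.

Definition znorm z : rat := if z == 0 then 0 else p%:R ^- zval z.

Lemma znorm_ge0 z : 0 <= znorm z.
Proof. by rewrite /znorm; case: ifP => // _; rewrite invr_ge0 exprn_ge0. Qed.

Lemma p_neq0 : p%:R != 0 :> rat.
Proof. by rewrite pnatr_eq0 -lt0n prime_gt0. Qed.

Lemma znorm_eq0 z : (znorm z == 0) = (z == 0).
Proof.
rewrite /znorm; have [_ /=|_] := eqVneq z 0; first by rewrite eqxx.
by rewrite invr_eq0 expf_eq0 (negPf p_neq0) andbF.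
Qed.

Lemma znorm0 : znorm 0 = 0. Proof. by rewrite /znorm eqxx. Qed.

Lemma znormM x y : znorm (x * y) = znorm x * znorm y.
Proof.
rewrite /znorm mulf_eq0; have [_|x0] := eqVneq; first by rewrite mul0r.
have [_|y0] := eqVneq; first by rewrite mulr0.
by rewrite /= zvalM // exprD invfM.
Qed.

Lemma znormN x : znorm (- x) = znorm x.
Proof.
have N1 : znorm (-1) = 1.
  have : znorm (-1) ^+ 2 == 1.
    rewrite expr2 -znormM mulrNN mulr1 /znorm oner_eq0.
    suff -> : zval 1 = 0%N by rewrite expr0 invr1.
    apply/eqP; rewrite -leqn0 leqNgt -zresidue_eq0 ?oner_eq0 //.
    by rewrite zresidue1 modn_small // expn1 prime_gt1.
  by rewrite sqrp_eq1 ?znorm_ge0 // => /eqP.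
by rewrite -mulN1r znormM N1 mul1r.
Qed.

Lemma znormD x y : znorm (x + y) <= Num.max (znorm x) (znorm y).
Proof.
have [->|x0] := eqVneq x 0; first by rewrite add0r le_max lexx orbT.
have [->|y0] := eqVneq y 0; first by rewrite addr0 le_max lexx.
have [->|xy0] := eqVneq (x + y) 0; first by rewrite znorm0 le_max znorm_ge0.
have := zvalD xy0 x0 y0; rewrite /znorm (negPf x0) (negPf y0) (negPf xy0).
have le m n : (m <= n)%N -> p%:R ^- n <= p%:R ^- m :> rat.
  move=> mn; rewrite lef_pV2 ?posrE ?exprn_gt0 ?ltr0n ?prime_gt0 //.
  by rewrite ler_weXn2l // ler1n prime_gt0.
by rewrite geq_min le_max => /orP [] /le ->; rewrite ?orbT.
Qed.

End PadicIntRing.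

(** * The field Q_p *)

Definition padic (p : nat) (p_pr : prime p) := {fraction (padic_int p_pr)}.

HB.instance Definition _ (p : nat) (p_pr : prime p) :=
  GRing.Field.on (padic p_pr).
HB.instance Definition _ (p : nat) (p_pr : prime p) :=
  isPointed.Build (padic p_pr) 0.

Section PadicField.
Variables (p : nat) (p_pr : prime p).
Local Notation Zp := (padic_int p_pr).
Local Notation Qp := (padic p_pr).
Implicit Types x y z : Qp.

(** The p-adic absolute value [|a / b|_p = |a|_p / |b|_p]; it takes rational
    values. *)
Definition padic_norm x : rat :=
  znorm ((repr x).1) / znorm ((repr x).2).

Local Notation "a %:F" := (@FracField.tofrac Zp a : {fraction Zp}).

Lemma frac_piE (f : {ratio Zp}) : \pi_{fraction Zp}%qT f = (f.1)%:F / (f.2)%:F.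
Proof.
rewrite -[_ / _]/(FracField.mul _ (FracField.inv _)) !piE.
apply/eqmodP; rewrite /= FracField.equivfE /FracField.mulf /FracField.invf /=.
by rewrite !numden_Ratio ?oner_neq0 ?mulr1 ?mul1r ?denom_ratioP // mulrC.
Qed.

Lemma padic_fracE x : exists a b : Zp, b != 0 /\ x = a%:F / b%:F.
Proof.
exists ((repr x).1), ((repr x).2); split; first exact: denom_ratioP.
by rewrite -frac_piE reprK.
Qed.

Lemma padic_normE (a b : Zp) : b != 0 ->
  padic_norm (a%:F / b%:F) = znorm a / znorm b.
Proof.
move=> b0; rewrite /padic_norm; set f := repr _.
have d0 : f.2 != 0 by exact: denom_ratioP.
have : a%:F / b%:F = (f.1)%:F / (f.2)%:F by rewrite -frac_piE reprK.
move/eqP; rewrite eqr_div ?tofrac_eq0 // -!tofracM tofrac_eq => /eqP.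
move/(congr1 (@znorm _ _)); rewrite !znormM => e.
by apply/eqP; rewrite eqr_div ?znorm_eq0 // -e mulrC.
Qed.

Lemma padic_norm_ge0 x : 0 <= padic_norm x.
Proof. by rewrite /padic_norm divr_ge0 ?znorm_ge0. Qed.

Lemma padic_norm0_eq0 x : padic_norm x = 0 -> x = 0.
Proof.
have [a [b [b0 ->]]] := padic_fracE x.
rewrite padic_normE // => /eqP; rewrite mulf_eq0 invr_eq0 !znorm_eq0 (negPf b0).
by rewrite orbF => /eqP ->; rewrite tofrac0 mul0r.
Qed.

Lemma padic_norm_int a : padic_norm (a%:F) = znorm a.
Proof.
have zn1 : znorm (1 : Zp) = 1.
  have : znorm (1 : Zp) * znorm (1 : Zp) = znorm (1 : Zp) * 1.
    by rewrite -znormM !mulr1.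
  by apply: mulfI; rewrite znorm_eq0 oner_eq0.
have := @padic_normE a 1 (oner_neq0 _).
by rewrite tofrac1 zn1 !divr1.
Qed.

Lemma padic_norm0 : padic_norm 0 = 0.
Proof. by rewrite -(tofrac0 Zp) padic_norm_int znorm0. Qed.

Lemma padic_normM x y : padic_norm (x * y) = padic_norm x * padic_norm y.
Proof.
have [a [b [b0 ->]]] := padic_fracE x; have [c [d [d0 ->]]] := padic_fracE y.
rewrite mulf_div -!tofracM !padic_normE ?mulf_neq0 // !znormM.
by rewrite mulf_div.
Qed.

Lemma padic_normN x : padic_norm (- x) = padic_norm x.
Proof.
have [a [b [b0 ->]]] := padic_fracE x.
by rewrite -mulNr -tofracN !padic_normE // znormN.
Qed.

Lemma padic_normD x y :
  padic_norm (x + y) <= Num.max (padic_norm x) (padic_norm y).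
Proof.
have [a [b [b0 ->]]] := padic_fracE x; have [c [d [d0 ->]]] := padic_fracE y.
rewrite addf_div ?tofrac_eq0 // -!tofracM -tofracD !padic_normE ?mulf_neq0 //.
have e (t u : Zp) : znorm u != 0 -> znorm t / znorm b = znorm (t * u) / (znorm b * znorm u).
  by move=> u0; rewrite znormM -mulf_div divff // mulr1.
rewrite (e a d) ?znorm_eq0 // (znormM b d).
have -> : znorm c / znorm d = znorm (c * b) / (znorm b * znorm d).
  by rewrite znormM [znorm b * _]mulrC -mulf_div divff ?mulr1 ?znorm_eq0.
rewrite -maxr_pMl ?invr_ge0 ?mulr_ge0 ?znorm_ge0 //.
by rewrite ler_wpM2r ?invr_ge0 ?mulr_ge0 ?znorm_ge0 // znormD.
Qed.

Definition padic_dist x y : rat := padic_norm (x - y).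

Lemma padic_distxx x : padic_dist x x = 0.
Proof. by rewrite /padic_dist subrr padic_norm0. Qed.

Lemma padic_dist_eq0 x y : padic_dist x y = 0 -> x = y.
Proof. by move/padic_norm0_eq0/eqP; rewrite subr_eq0 => /eqP. Qed.

Lemma padic_dist_sym x y : padic_dist x y = padic_dist y x.
Proof. by rewrite /padic_dist -padic_normN opprB. Qed.

Lemma padic_dist_triangle y x z :
  padic_dist x z <= padic_dist x y + padic_dist y z.
Proof.
rewrite /padic_dist (_ : x - z = (x - y) + (y - z)); last by rewrite addrA subrK.
apply: le_trans (padic_normD _ _) _.
by rewrite ge_max lerDl lerDr !padic_norm_ge0.
Qed.

HB.instance Definition _ := isMetric.Build rat Qp
  padic_distxx padic_dist_eq0 padic_dist_sym padic_dist_triangle.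

(** The measurable sets of Q_p are its Borel sets. *)
HB.instance Definition _ := @isMeasurable.Build (sigma_display (@open Qp)) Qp
  <<s @open Qp >> (@sigma_algebra0 _ setT (@open Qp))
  (@sigma_algebraC _ (@open Qp)) (@sigma_algebra_bigcup _ setT (@open Qp)).

(** [x = \sum_(n >= v) a_n p^n] with digits [a_n] in {0, ..., p - 1}. *)
Definition padic_expansion x (v : int) (a : int -> nat) : Prop :=
  (forall n, (a n < p)%N) /\
  series (fun k : nat => (a (v + k%:Z))%:R * p%:R ^ (v + k%:Z) : Qp) @ \oo --> x.

(** [\sum_(v <= n < 0) a_n p^n], as a rational number; it is 0 if [0 <= v]. *)
Definition expansion_frac (v : int) (a : int -> nat) : rat :=
  \sum_(k < `|Num.min v 0|%N) (a (v + k%:Z))%:R * p%:R ^ (v + k%:Z).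

(** The fractional part {x}. It is well defined: every [x] has an expansion
    ([padic_expansion_ex]) and the value does not depend on the expansion
    ([padic_fracP]). *)
Definition padic_frac x : rat :=
  xget 0 [set r | exists v a, padic_expansion x v a /\ r = expansion_frac v a].

End PadicField.


Section PadicExpansion.
Variables (p : nat) (p_pr : prime p).
Local Notation Zp := (padic_int p_pr).
Local Notation Qp := (padic p_pr).
Local Notation "a %:F" := (@FracField.tofrac Zp a : {fraction Zp}).
Implicit Types (x : Qp) (z : Zp).

Lemma zresidue_nat (a n : nat) : (a%:R : Zp) n = (a %% p ^ n)%N.
Proof.
elim: a => [|a IH]; first by rewrite zresidue0 mod0n.
by rewrite -natr1 zresidueD IH zresidue1 modnDm addn1.
Qed.

Lemma znorm_le z n : (znorm z <= p%:R ^- n) = (z n == 0%N).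
Proof.
have [->|z0] := eqVneq z 0.
  by rewrite znorm0 zresidue0 eqxx invr_ge0 exprn_ge0.
rewrite zresidue_eq0 // /znorm (negPf z0).
rewrite lef_pV2 ?posrE ?exprn_gt0 ?ltr0n ?prime_gt0 //.
by rewrite ler_eXn2l // ltr1n prime_gt1.
Qed.

Lemma znorm_le1 z : znorm z <= 1.
Proof.
have := znorm_le z 0; rewrite expr0 invr1 => ->.
by have := zresidue_lt z 0; rewrite expn0 ltnS leqn0.
Qed.

Lemma znorm_p n : znorm (p%:R ^+ n : Zp) = p%:R ^- n.
Proof.
apply/eqP; rewrite eq_le znorm_le -natrX zresidue_nat modnn eqxx /=.
have pn0 : (p ^ n)%:R != 0 :> Zp.
  apply/eqP => /(congr1 (fun z : Zp => z n.+1)).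
  rewrite zresidue_nat zresidue0 modn_small ?ltn_exp2l ?prime_gt1 // => /eqP.
  by rewrite expn_eq0 -[p == 0%N]negbK -lt0n prime_gt0.
rewrite /znorm (negPf pn0) lef_pV2 ?posrE ?exprn_gt0 ?ltr0n ?prime_gt0 //.
rewrite ler_weXn2l ?ler1n ?prime_gt0 //.
rewrite leqNgt -zresidue_eq0 // zresidue_nat modn_small ?ltn_exp2l ?prime_gt1 //.
by rewrite expn_eq0 -[p == 0%N]negbK -lt0n prime_gt0.
Qed.

Lemma padic_p_neq0 : p%:R != 0 :> Qp.
Proof.
rewrite -(rmorph_nat (@FracField.tofrac Zp)) tofrac_eq0 -znorm_eq0.
by rewrite -[p%:R]expr1 znorm_p expr1 invr_eq0 p_neq0.
Qed.

Lemma padic_norm_pX (n : int) : padic_norm (p%:R ^ n : Qp) = p%:R ^ (- n).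
Proof.
have pos k : padic_norm (p%:R ^+ k : Qp) = p%:R ^- k.
  rewrite -(rmorph_nat (@FracField.tofrac Zp)) -tofracXn.
  by rewrite padic_norm_int znorm_p.
case: n => n; first by rewrite -exprnP pos -exprnN.
rewrite NegzE opprK -exprnN -exprnP.
have : padic_norm (p%:R ^+ n.+1 * p%:R ^- n.+1 : Qp) = 1.
  by rewrite divff ?expf_neq0 ?padic_p_neq0 //; have := pos 0%N; rewrite !expr0 invr1.
rewrite padic_normM pos => e.
apply: (mulfI (invr_neq0 (expf_neq0 n.+1 (p_neq0 p_pr)))).
by rewrite e mulVf // expf_neq0 // p_neq0.
Qed.

Lemma zdvd_pX z : z != 0 -> exists y : Zp, z * y = p%:R ^+ zval z.
Proof.
move=> z0; set v := zval z.
pose u n := (z (n + v) %/ p ^ v)%N.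
have zu (n : nat) : z (n + v)%N = (p ^ v * u n)%N.
  rewrite mulnC divnK // /dvdn zresidue_mod ?leq_addl //.
  by rewrite zresidue_eq0 // /v leqnn.
have vn (n : nat) : (0 < n)%N -> (v < n + v)%N.
  by rewrite -[X in _ -> (X < _)%N]add0n ltn_add2r.
have u_gt0 (n : nat) : (0 < n)%N -> (0 < u n)%N.
  move=> n0; have : (0 < z (n + v))%N.
    by rewrite lt0n zresidue_eq0 // -ltnNge vn.
  by rewrite zu muln_gt0 => /andP [].
have u_co (n : nat) : (0 < n)%N -> coprime (u n) (p ^ n).
  move=> n0; apply: coprimeXr; rewrite coprime_sym (prime_coprime _ p_pr).
  have := logn_zresidue z0 (vn _ n0).
  rewrite zu lognM ?u_gt0 ?expn_gt0 ?(prime_gt0 p_pr) //.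
  rewrite pfactorK // -/v -[RHS]addn0 => /addnI l0.
  by apply/negP => pu; have := pfactor_dvdn 1 p_pr (u_gt0 _ n0); rewrite expn1 pu l0.
have uS : forall n : nat, (u n.+1 = u n %[mod p ^ n])%N.
  move=> n; apply/eqP; have pv0 : (0 < p ^ v)%N by rewrite expp_gt0.
  rewrite -(eqn_pmul2l pv0) !muln_modr -expnD addnC -!zu addSn.
  by rewrite -zresidueS modn_small // zresidue_lt.
pose y n := if n is 0%N then 0%N else (egcdn (u n) (p ^ n)).1.
have uy : forall n : nat, (u n * y n = 1 %[mod p ^ n])%N.
  case => [|n]; first by rewrite expn0 !modn1.
  rewrite /y; case: egcdnP => [|a b e _]; first exact: u_gt0.
  by rewrite /= mulnC e (eqP (u_co _ _)) // modnMDl.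
have yS : forall n : nat, (y n.+1 = y n %[mod p ^ n])%N.
  move=> n; have e : (u n.+1 * y n.+1 = 1 %[mod p ^ n])%N.
    have := congr1 (modn^~ (p ^ n)%N) (uy n.+1).
    by rewrite !modn_dvdm ?dvdn_exp2l.
  have e' : (u n * y n.+1 = 1 %[mod p ^ n])%N by rewrite -modnMml -uS modnMml.
  have -> : (y n.+1 = (u n * y n) * y n.+1 %[mod p ^ n])%N.
    by rewrite -modnMml uy modnMml mul1n.
  by rewrite mulnAC -modnMml e' modnMml mul1n.
exists (mk_padic_int p_pr yS); apply: padic_intP => n.
rewrite -natrX zresidue_nat zresidueM /= modnMmr.
rewrite -(zresidue_mod z (leq_addr v n)) modnMml zu -mulnA -modnMmr.
have -> : (p ^ v * (u n * y n %% p ^ n) = p ^ v * (1 %% p ^ n))%N by rewrite uy.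
by rewrite modnMmr muln1.
Qed.

Lemma padic_scaleE x : exists z m, x = z%:F / p%:R ^+ m.
Proof.
have [a [b [b0 ->]]] := padic_fracE x; have [y by_] := zdvd_pX b0.
exists (a * y), (zval b).
have y0 : y != 0.
  by apply: contra_eq_neq by_ => ->; rewrite mulr0 eq_sym -znorm_eq0 znorm_p invr_eq0 expf_neq0 ?p_neq0.
rewrite -(rmorph_nat (@FracField.tofrac Zp)) -tofracXn -by_ !tofracM.
by rewrite -mulf_div divff ?mulr1 ?tofrac_eq0.
Qed.


Definition zdigit z (k : nat) : nat := (z k.+1 %/ p ^ k)%N.

Lemma zdigit_lt z k : (zdigit z k < p)%N.
Proof. by rewrite /zdigit ltn_divLR ?expp_gt0 // -expnS zresidue_lt. Qed.

Lemma zdigit_sum z n : z n = (\sum_(k < n) zdigit z k * p ^ k)%N.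
Proof.
elim: n => [|n IH]; first by rewrite big_ord0; have := zresidue_lt z 0; case: (z 0).
by rewrite big_ord_recr /= -IH (zresidueS z n) addnC -divn_eq.
Qed.

Lemma zresidue_approx z n : znorm (z - (z n)%:R) <= p%:R ^- n.
Proof.
rewrite znorm_le zresidueD.
have := congr1 (fun w : Zp => w n) (subrr ((z n)%:R : Zp)).
by rewrite zresidueD zresidue0 zresidue_nat (modn_small (zresidue_lt z n)) => ->.
Qed.

Lemma padic_cvgP (f : nat -> Qp) x m :
  (forall n, padic_norm (x - f n) <= p%:R ^+ m * p%:R ^- n) -> f @ \oo --> x.
Proof.
move=> fx; apply/cvg_ballP => e e0.
pose N := Num.truncn (p%:R ^+ m / e); exists N.+1 => // n /= Nn.
rewrite ballEmdist /= /mdist /=; apply: le_lt_trans (fx n) _.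
rewrite ltr_pdivrMr ?exprn_gt0 ?ltr0n ?prime_gt0 // mulrC -ltr_pdivrMr //.
apply: lt_le_trans (truncnS_gt _) _; rewrite -/N -natrX ler_nat.
by apply: (leq_trans Nn); rewrite ltnW // ltn_expl // prime_gt1.
Qed.

Lemma padic_cvg_near (f : nat -> Qp) x (N : nat) : f @ \oo --> x ->
  exists2 n, (N <= n)%N & padic_norm (x - f n) <= 1.
Proof.
move/cvg_ballP => /(_ _ ltr01) [K _ fK]; exists (maxn N K); first exact: leq_maxl.
have /= := fK _ (leq_maxr N K : [set _ | _] _).
by rewrite ballEmdist /= => /ltW.
Qed.

Lemma padic_expansion_scale z m :
  padic_expansion (z%:F / p%:R ^+ m) (- m%:Z) (fun n => zdigit z `|(n + m%:Z)%R|%N).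
Proof.
split => [n|]; first exact: zdigit_lt.
have sE n : series (fun k : nat => (zdigit z `|((- m%:Z + k%:Z) + m%:Z)%R|%N)%:R *
    p%:R ^ (- m%:Z + k%:Z) : Qp) n = ((z n)%:R : Zp)%:F / p%:R ^+ m.
  rewrite /series /= big_mkord (zdigit_sum z n) rmorph_nat natr_sum mulr_suml.
  apply: eq_bigr => k _; rewrite addrAC addNr add0r absz_nat.
  by rewrite expfzDr ?padic_p_neq0 // -exprnN -exprnP natrM natrX mulrCA mulrC.
apply: (@padic_cvgP _ _ m) => n; rewrite [X in _ - X]sE -mulrBl -tofracB.
rewrite padic_normM padic_norm_int exprnN padic_norm_pX opprK -exprnP mulrC.
by rewrite ler_wpM2l ?exprn_ge0 // zresidue_approx.
Qed.

Lemma padic_expansion_ex x : exists v a, padic_expansion x v a.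
Proof.
have [z [m ->]] := padic_scaleE x; do 2 eexists; exact: padic_expansion_scale.
Qed.

(** The truncation at exponent 0, scaled to a natural number below [p ^ M]. *)
Lemma expansion_frac_nat v a : (forall n, (a n < p)%N) ->
  exists N M : nat, [/\ (N < p ^ M)%N, expansion_frac p v a = N%:R / p%:R ^+ M &
    \sum_(k < `|Num.min v 0|%N) (a (v + k%:Z))%:R * p%:R ^ (v + k%:Z) =
      N%:R / p%:R ^+ M :> Qp].
Proof.
move=> ap; set M := `|Num.min v 0|%N.
have vM k : (k < M)%N -> v + k%:Z = k%:Z - M%:Z.
  by rewrite /M minEle; case: ifP => [v0 _|_]; lia.
have sumE (K : fieldType) : p%:R != 0 :> K ->
    \sum_(k < M) (a (v + k%:Z))%:R * p%:R ^ (v + k%:Z) =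
    (\sum_(k < M) a (v + k%:Z)%R * p ^ k)%N%:R / p%:R ^+ M :> K.
  move=> p0; rewrite natr_sum mulr_suml; apply: eq_bigr => k _.
  by rewrite vM // expfzDr // -exprnN -exprnP natrM natrX mulrA.
exists (\sum_(k < M) a (v + k%:Z)%R * p ^ k)%N, M; split.
- elim: M {vM sumE} => [|M IH]; first by rewrite big_ord0.
  rewrite big_ord_recr /=; apply: (@leq_trans (p ^ M + a (v + M%:Z)%R * p ^ M)).
    by rewrite -addSn leq_add2r.
  by rewrite -mulSn expnS leq_mul2r ap orbT.
- by rewrite /expansion_frac -/M sumE // p_neq0.
- by rewrite sumE // padic_p_neq0.
Qed.

Lemma padic_norm_sum_le1 (n : nat) (F : nat -> Qp) :
  (forall k, padic_norm (F k) <= 1) -> padic_norm (\sum_(k < n) F k) <= 1.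
Proof.
move=> F1; elim: n => [|n IH]; first by rewrite big_ord0 padic_norm0.
by rewrite big_ord_recr; apply: le_trans (padic_normD _ _) _; rewrite ge_max IH F1.
Qed.

Lemma expansion_frac_approx x v a : padic_expansion x v a ->
  padic_norm (x - \sum_(k < `|Num.min v 0|%N) (a (v + k%:Z))%:R * p%:R ^ (v + k%:Z)) <= 1.
Proof.
set M := `|_|%N => -[ap cv].
have [n Mn xn] := @padic_cvg_near _ _ M cv.
set t := (fun k : nat => _) in cv xn.
have -> : x - \sum_(k < M) t k = (x - series t n) + \sum_(k < n - M) t (M + k)%N.
  have -> : series t n = \sum_(k < M) t k + \sum_(k < n - M) t (M + k)%N.
    by rewrite -[in LHS](subnKC Mn) /series /= big_mkord big_split_ord.
  by rewrite opprD addrA subrK.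
apply: le_trans (padic_normD _ _) _; rewrite ge_max xn /=.
apply: (@padic_norm_sum_le1 _ (fun k => t (M + k)%N)) => k; rewrite /t padic_normM padic_norm_pX.
have : 0 <= v + (M + k)%N%:Z by rewrite /M minEle; case: ifP => v0; lia.
case: (v + _) => // j _.
rewrite -(rmorph_nat (@FracField.tofrac Zp)) padic_norm_int -exprnN.
by rewrite mulr_ile1 ?znorm_ge0 ?znorm_le1 // ?invr_ge0 ?exprn_ge0 // invf_le1 ?exprn_gt0 ?ltr0n ?prime_gt0 // exprn_ege1 // ler1n prime_gt0.
Qed.

Lemma expansion_frac_uniq x v a v' a' :
  padic_expansion x v a -> padic_expansion x v' a' ->
  expansion_frac p v a = expansion_frac p v' a'.
Proof.
move=> xa xa'.
have := expansion_frac_approx xa; have := expansion_frac_approx xa'.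
have [N [M [NM -> ->]]] := @expansion_frac_nat v a xa.1.
have [N' [M' [NM' -> ->]]] := @expansion_frac_nat v' a' xa'.1.
set q := N%:R / _; set q' := N'%:R / _ => d' d.
have {d d'} : padic_norm (q - q') <= 1.
  rewrite (_ : q - q' = (x - q') - (x - q)); last by rewrite opprB [RHS]addrC addrA subrK.
  by apply: le_trans (padic_normD _ _) _; rewrite padic_normN ge_max d d'.
have pX0 k : p%:R ^+ k != 0 :> Qp by rewrite expf_neq0 ?padic_p_neq0.
rewrite /q /q' -mulNr addf_div // mulNr -exprD padic_normM.
rewrite (exprnN (p%:R : Qp)) padic_norm_pX opprK -exprnP -ler_pdivlMr ?exprn_gt0 ?ltr0n ?prime_gt0 // div1r => le1.
suff e : (N * p ^ M' = N' * p ^ M)%N.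
  apply/eqP; rewrite eqr_div ?expf_neq0 ?p_neq0 //.
  by rewrite -!natrX -!natrM e.
have lt1 : (N * p ^ M' < p ^ (M + M'))%N by rewrite expnD ltn_pmul2r ?expp_gt0.
have lt2 : (N' * p ^ M < p ^ (M + M'))%N.
  by rewrite addnC expnD ltn_pmul2r ?expp_gt0.
move: le1; rewrite -!natrX -!natrM.
wlog le : N M N' M' {NM NM' q q'} lt1 lt2 / (N' * p ^ M <= N * p ^ M')%N.
  move=> H; case: (leqP (N' * p ^ M) (N * p ^ M')) => [|/ltnW] le; first exact: H.
  rewrite -padic_normN opprB addnC => h; apply/esym; apply: H => //.
  - by rewrite addnC.
  - by rewrite addnC.
rewrite -natrB // -(rmorph_nat (@FracField.tofrac Zp)) padic_norm_int.
rewrite natrX znorm_le zresidue_nat modn_small => [e|].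
  by apply/eqP; rewrite eqn_leq le -subn_eq0 e.
by rewrite (leq_ltn_trans (leq_subr _ _)).
Qed.

Lemma padic_fracP x v a : padic_expansion x v a ->
  padic_frac x = expansion_frac p v a.
Proof.
move=> xa; rewrite /padic_frac; case: xgetP => [r _ [v' [a' [xa' ->]]]|].
  exact: expansion_frac_uniq xa' xa.
by move/(_ (expansion_frac p v a)) => []; exists v, a.
Qed.

End PadicExpansion.

(** * Characters of Q_p and Haar measures *)

(** [e^(2 i pi t)] *)
Definition expi2pi (R : realType) (t : R) : R[i] :=
  Complex (cos (2 * pi * t)) (sin (2 * pi * t)).

Definition padic_char (p : nat) (p_pr : prime p) (R : realType)
    (xi x : padic p_pr) : R[i] :=
  expi2pi (ratr (padic_frac (xi * x)) : R).

(** Haar measures, i.e. the nonzero translation-invariant Borel measures that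
    are finite on compact sets.  Such a measure is unique up to a positive
    factor, and regular because Q_p is locally compact and second countable. *)
Record is_haar (p : nat) (p_pr : prime p) (R : realType)
    (m : {measure set (padic p_pr) -> \bar R}) : Prop := IsHaar {
  haar_neq0 : m [set: padic p_pr] != 0%E ;
  haar_compact : forall K, compact K -> (m K < +oo)%E ;
  haar_translation : forall (t : padic p_pr) A, measurable A ->
    m [set t + x | x in A] = m A }.

(** * Complex-valued L^2 spaces *)

Section ComplexL2.
Context d (T : measurableType d) (R : realType).
Variables (m : {measure set T -> \bar R}) (D : set T).
Local Notation C := (R[i]).
Implicit Types f g : T -> C.

Definition L2_fun f : Prop :=
  [/\ measurable_fun D (fun x => complex.Re (f x)),
      measurable_fun D (fun x => complex.Im (f x)) &
      (\int[m]_(x in D) (ComplexField.Normc.normc (f x) ^+ 2)%:E < +oo)%E].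

Definition Cintegral f : C :=
  Complex (\int[m]_(x in D) complex.Re (f x)) (\int[m]_(x in D) complex.Im (f x)).

Definition L2_dot f g : C := Cintegral (fun x => f x * conjc (g x)).

(** The squared L^2 distance. *)
Definition L2_sqdist f g : \bar R :=
  \int[m]_(x in D) (ComplexField.Normc.normc (f x - g x) ^+ 2)%:E.

(** [(e i)_(i in J)] is an orthogonal basis of L^2(D): nonzero pairwise
    orthogonal elements whose finite linear combinations are dense. *)
Record orthogonal_basis (I : choiceType) (J : set I) (e : I -> T -> C) : Prop :=
  OrthogonalBasis {
    basis_L2 : forall i, J i -> L2_fun (e i) ;
    basis_neq0 : forall i, J i -> L2_dot (e i) (e i) != 0 ;
    basis_orthogonal : forall i j, J i -> J j -> i != j ->
      L2_dot (e i) (e j) = 0 ;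
    basis_dense : forall f (eps : R), L2_fun f -> 0 < eps ->
      exists (s : seq I) (c : I -> C), (forall i, i \in s -> J i) /\
        (L2_sqdist f (fun x => \sum_(i <- s) c i * e i x)%R < eps%:E)%E }.

End ComplexL2.

(** * Spectral sets, tiles, almost compact open sets *)

Section SpectralTile.
Context (p : nat) (p_pr : prime p) (R : realType).
Local Notation Qp := (padic p_pr).
Variable m : {measure set Qp -> \bar R}.
Implicit Types Omega T Lambda : set Qp.

Definition spectral_set Omega : Prop := exists Lambda,
  orthogonal_basis m Omega Lambda (@padic_char p p_pr R).

Definition translational_tile Omega : Prop := exists T,
  {ae m, forall x, \esum_(t in T) (\1_Omega (x - t))%:E = 1%E :> \bar R}.

Definition almost_compact_open Omega : Prop := exists Omega',
  [/\ compact Omega', open Omega',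
      m (Omega `\` Omega') = 0%E & m (Omega' `\` Omega) = 0%E].

End SpectralTile.

(* Main.v *)
From HB Require Import structures.
Require Import Defs.
From mathcomp Require Import all_boot all_order all_algebra.
From mathcomp Require Import all_classical all_reals all_analysis.
From mathcomp Require Import complex zify ring lra.
From mathcomp Require Import algC cyclotomic measurable_realfun.

(** Up to null sets, the tiles, the spectral sets and the homogeneous sets are the
    same. A set is homogeneous ([homogeneous]) if it is a finite union of balls of
    equal radius and if, in the tree of all balls, the subtree of the balls that
    meet it either branches completely at all vertices of a given level or does
    not branch at that level. In particular homogeneous sets are compact and open.

    Homogeneous sets are tiles and spectral sets for elementary reasons. The
    numbers with arbitrary digits at the levels where [H] does not branch and
    zero digits elsewhere form a complement of [H] ([homogeneous_tiling]). Dually,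
    the numbers with arbitrary digits at the levels dual to the branching levels
    form a spectrum ([Cintegral_branches], [locally_constant_trigonometric]).

    The converse rests on an equation [nu * a = 0] on the discrete quotient of Q_p
    by a ball of level [k], where [nu] counts the points of a discrete set in balls
    and [a] is summable with mean zero on the balls of level [k + 1]. If [a] is not
    0, its Fourier transform does not vanish at some frequency that is nontrivial
    on these balls, and then the transform of [nu] over large balls vanishes
    there. As [nu] has integral values, this is a vanishing sum of roots of unity of
    order [p ^ N] with integral coefficients, and irreducibility of the cyclotomic
    polynomial forces [nu] to be constant on the balls of level [k + 1]
    ([convolution_dichotomy]).

    For a tile [Omega] with translation set [T], this shows that at each level
    either [Omega] or [T] is equidistributed ([tile_dichotomy]). For a spectral set
    with spectrum [Lambda], take for [a] the product of the Fourier transform of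
    the part of [Omega] in a ball with the conjugate of the one for a sibling of
    this ball: Parseval's identity says that [nu * a = 0], whence [Lambda] is
    equidistributed at the dual of every level at which [Omega] branches
    ([branching_balanced]). Equidistribution of the discrete set at many levels
    makes it dense; on the other hand its density is bounded in terms of the
    measure of [Omega], by disjointness of the translates for a tile and by
    Bessel's inequality for a spectral set. Counting shows that there is equality,
    and the equality case is the homogeneity of [Omega] ([tile_homogeneous],
    [spectral_homogeneous]).
    Density points, [density_ball], provide the smallest level that matters. *)

Set Implicit Arguments.
Unset Strict Implicit.
Unset Printing Implicit Defensive.

Import Order.TTheory GRing.Theory Num.Theory.

Local Open Scope classical_set_scope.
Local Open Scope ring_scope.

(** * Balls of Q_p *)

Section Balls.
Variables (p : nat) (p_pr : prime p).
Local Notation Zp := (padic_int p_pr).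
Local Notation Qp := (padic p_pr).
Implicit Types (x y z w : Qp) (k l s : int) (n : nat).

Lemma prat_gt0 : 0 < p%:R :> rat.
Proof. by rewrite ltr0n prime_gt0. Qed.

Lemma prat_gt1 : 1 < p%:R :> rat.
Proof. by rewrite ltr1n prime_gt1. Qed.

Lemma ler_prat k l : (p%:R ^ k <= p%:R ^ l :> rat) = (k <= l).
Proof. exact/ler_eXz2l/prat_gt1. Qed.

(** The index [k] is the logarithm of the radius: the balls of level [k] are the
    cosets of [p ^ (- k) Z_p], and each of them consists of [p] balls of level
    [k - 1]. The balls of all levels form a tree. *)
Definition pball k x : bool := padic_norm x <= p%:R ^ k.

(** The sign makes [k] the logarithm of the norm of [ppow k], so that the
    multiples of [ppow k] by integers fill the ball of level [k] densely. *)
Definition ppow k : Qp := p%:R ^ (- k).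

Lemma pball0 k : pball k 0.
Proof. by rewrite /pball padic_norm0 exprz_ge0 // ltW // prat_gt0. Qed.

Lemma pballN k x : pball k (- x) = pball k x.
Proof. by rewrite /pball padic_normN. Qed.

Lemma pballD k x y : pball k x -> pball k y -> pball k (x + y).
Proof.
move=> hx hy; apply: le_trans (padic_normD _ _) _.
by rewrite ge_max; apply/andP.
Qed.

Lemma pballB k x y : pball k x -> pball k y -> pball k (x - y).
Proof. by move=> hx hy; apply: pballD; rewrite ?pballN. Qed.

Lemma pball_sym k x y : pball k (x - y) = pball k (y - x).
Proof. by rewrite -pballN opprB. Qed.

Lemma pball_trans k y x z : pball k (x - y) -> pball k (y - z) -> pball k (x - z).
Proof. by move=> xy /(pballD xy); rewrite addrA subrK. Qed.

Lemma pballDr k x y : pball k y -> pball k (x + y) = pball k x.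
Proof.
move=> hy; apply/idP/idP => [h|h]; last exact: pballD.
by have := pballB h hy; rewrite addrK.
Qed.

Lemma pball_le k l x : k <= l -> pball k x -> pball l x.
Proof. by move=> kl /le_trans; apply; rewrite ler_prat. Qed.

Lemma ppowM k l : ppow k * ppow l = ppow (k + l).
Proof. by rewrite /ppow -expfzDr ?padic_p_neq0 // opprD. Qed.

Lemma ppow0 : ppow 0 = 1.
Proof. by rewrite /ppow oppr0 expr0z. Qed.

Lemma ppow_natr n : ppow (- n%:Z) = (p ^ n)%:R.
Proof. by rewrite /ppow opprK -exprnP natrX. Qed.

Lemma pballM k l x : pball k (x * ppow l) = pball (k - l) x.
Proof.
rewrite /pball padic_normM padic_norm_pX opprK.
rewrite -ler_pdivlMr ?exprz_gt0 ?prat_gt0 // invr_expz.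
by rewrite expfzDr ?p_neq0.
Qed.

Lemma pball_nat n : pball 0 n%:R.
Proof.
rewrite /pball -(rmorph_nat (@FracField.tofrac Zp)) padic_norm_int expr0z.
exact: znorm_le1.
Qed.

Lemma pball_dvdn (j n : nat) : pball (- n%:Z) (j%:R : Qp) = (p ^ n %| j)%N.
Proof.
rewrite /pball -(rmorph_nat (@FracField.tofrac Zp)) padic_norm_int.
by rewrite -invr_expz -exprnP znorm_le zresidue_nat.
Qed.

Lemma pball_natM j k l : k <= l -> pball l (j%:R * ppow k).
Proof. by move=> kl; rewrite pballM; apply: pball_le (pball_nat j); lia. Qed.

Lemma pball_ppow k l : pball l (ppow k) = (k <= l).
Proof.
have n1 : padic_norm (1 : Qp) = p%:R ^ 0.
  by have := padic_norm_pX p_pr 0; rewrite !expr0z.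
by rewrite -[ppow k]mul1r pballM /pball n1 ler_prat subr_ge0.
Qed.

Lemma pball_natu j k n : pball k (j%:R * ppow (k + n%:Z)) = (p ^ n %| j)%N.
Proof. by rewrite pballM -pball_dvdn; congr pball; lia. Qed.

Lemma padic_norm_int_pow x : x != 0 -> exists k, padic_norm x = p%:R ^ k.
Proof.
move=> x0; have [z [m xE]] := padic_scaleE x.
have z0 : z != 0 by apply: contraNneq x0 => z0; rewrite xE z0 tofrac0 mul0r.
exists (m%:Z - (zval z)%:Z).
have e : padic_norm (p%:R ^- m : Qp) = p%:R ^ m%:Z by rewrite exprnN padic_norm_pX opprK.
rewrite xE padic_normM padic_norm_int /znorm (negPf z0) e.
by rewrite mulrC expfzDr ?p_neq0 // exprnN.
Qed.

Lemma pball_ex x : exists n : nat, forall k, n%:Z <= k -> pball k x.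
Proof.
have [->|x0] := eqVneq x 0; first by exists 0%N => *; exact: pball0.
have [k xk] := padic_norm_int_pow x0; exists `|k|%N => l kl.
by rewrite /pball xk ler_prat; lia.
Qed.

(** When [psphere k (x - y)] holds, [x] and [y] lie in one ball of level [k + 1]
    but in different balls of level [k]: this is the level at which the paths to
    [x] and [y] in the tree of balls separate. *)
Definition psphere k x : bool := pball (k + 1) x && ~~ pball k x.

Lemma psphereN k x : psphere k (- x) = psphere k x.
Proof. by rewrite /psphere !pballN. Qed.

Lemma psphereDr k x y : pball k y -> psphere k (x + y) = psphere k x.
Proof.
move=> h; rewrite /psphere !pballDr //; apply: pball_le h; lia.
Qed.

(** The centre is given by the first [n] digits of [x], read as a natural
    number. *)
Lemma pball_rep k n x : pball (k + n%:Z) x ->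
  exists2 j, (j < p ^ n)%N & pball k (x - j%:R * ppow (k + n%:Z)).
Proof.
wlog -> : k x / k = - n%:Z => [H xk|].
  have := H (- n%:Z) (x * ppow (- (k + n%:Z))) erefl.
  rewrite pballM opprK addNr add0r xk => /(_ isT) [j jn hj].
  exists j => //; move: hj; rewrite ppow0 mulr1.
  have -> : x - j%:R * ppow (k + n%:Z) =
    (x * ppow (- (k + n%:Z)) - j%:R) * ppow (k + n%:Z).
    by rewrite mulrBl -mulrA ppowM addNr ppow0 mulr1.
  by rewrite pballM => h; apply: pball_le h; lia.
rewrite addNr => x1; rewrite ppow0.
have [z [m xE]] := padic_scaleE x.
have xE' : x = @FracField.tofrac Zp z * ppow m%:Z.
  by rewrite xE /ppow -exprnN.
have zm : z m = 0%N.
  by apply/eqP; rewrite -znorm_le -padic_norm_int; move: x1; rewrite xE' pballM sub0r /pball -invr_expz.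
have pm : (p ^ m %| z (n + m))%N by rewrite /dvdn zresidue_mod ?leq_addl // zm.
exists (z (n + m) %/ p ^ m)%N.
  by rewrite ltn_divLR ?expp_gt0 // -expnD zresidue_lt.
have -> : x - (z (n + m) %/ p ^ m)%N%:R * 1 =
    @FracField.tofrac Zp (z - (z (n + m)%N)%:R) * ppow m%:Z.
  rewrite tofracB mulrBl -xE' rmorph_nat; congr (_ - _).
  rewrite -{2}(divnK pm) natrM mulr1 -mulrA -ppow_natr ppowM addNr ppow0 mulr1 //.
rewrite pballM /pball padic_norm_int.
have -> : - n%:Z - m%:Z = - (n + m)%N%:Z by lia.
by rewrite -invr_expz -exprnP zresidue_approx.
Qed.

Lemma pball_rep_uniq k n (i j : nat) : (i < p ^ n)%N -> (j < p ^ n)%N ->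
  pball k (i%:R * ppow (k + n%:Z) - j%:R * ppow (k + n%:Z)) -> i = j.
Proof.
wlog ij : i j / (j <= i)%N => [H hi hj|hi hj].
  case: (leqP j i) => [|/ltnW] le; first exact: H.
  by rewrite pball_sym => h; apply/esym; apply: H h.
rewrite -mulrBl -natrB // pball_natu => /dvdnP [q e].
by case: q e => [|q] e; lia.
Qed.

End Balls.

(** Functions on the quotient of Q_p by the ball of level [k] around 0. For a set,
    i.e. a function to [Prop], this says that it is a union of balls of level
    [k]. *)
Definition ball_inv (p : nat) (p_pr : prime p) (T : Type) (k : int)
  (f : padic p_pr -> T) := forall z w, pball k w -> f (z + w) = f z.

(** * Sums over a ball modulo a smaller ball *)

Section BallSum.
Variables (p : nat) (p_pr : prime p).
Local Notation Qp := (padic p_pr).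
Local Notation ppow := (@ppow p p_pr).
Local Notation ball_inv := (@ball_inv p p_pr _).
Implicit Types (x y z w : Qp) (k l s : int) (n : nat).

Lemma ball_inv_le (T : Type) k l (f : Qp -> T) : l <= k ->
  ball_inv k f -> ball_inv l f.
Proof. by move=> lk h z w hw; apply: h; apply: pball_le hw. Qed.

Lemma ball_invE (T : Type) k (f : Qp -> T) x y :
  ball_inv k f -> pball k (x - y) -> f x = f y.
Proof. by move=> h xy; rewrite -(h y _ xy) subrKC. Qed.

Section Nmod.
Variable V : nmodType.
Implicit Types (f g : Qp -> V).

(** If [f] is constant on the balls of level [s], this is its sum over the balls
    of level [s] in the ball of level [s + n] around [z]. *)
Definition bsum s n f z : V := \sum_(j < p ^ n) f (z + j%:R * ppow (s + n%:Z)).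

Lemma periodic_sum (psi : nat -> V) (P : nat) :
  (forall j, psi (j + P)%N = psi j) ->
  forall i, \sum_(j < P) psi (j + i)%N = \sum_(j < P) psi j.
Proof.
case: P => [|P] h; first by move=> i; rewrite !big_ord0.
elim=> [|i <-]; first by apply: eq_bigr => j _; rewrite addn0.
rewrite big_ord_recr /= [RHS]big_ord_recl addrC; congr (_ + _).
  by rewrite add0n -(h i) addnC addSnnS.
by apply: eq_bigr => j _; rewrite lift0 addSnnS.
Qed.

(** Moving the centre within the ball permutes the representatives cyclically. *)
Lemma bsum_inv s n f : ball_inv s f -> ball_inv (s + n%:Z) (bsum s n f).
Proof.
move=> fi z w /pball_rep [i _ wi]; rewrite /bsum.
rewrite -[RHS](@periodic_sum (fun j => f (z + j%:R * ppow (s + n%:Z))) (p ^ n) _ i).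
  apply: eq_bigr => j _; apply: (ball_invE fi).
  by rewrite (_ : _ - _ = w - i%:R * ppow (s + n%:Z)) // natrD; ring.
move=> j; apply: (ball_invE fi).
rewrite (_ : _ - _ = (p ^ n)%:R * ppow (s + n%:Z)); last by rewrite natrD; ring.
by rewrite pball_natu dvdnn.
Qed.

Lemma eq_bsum s n f g z : f =1 g -> bsum s n f z = bsum s n g z.
Proof. by move=> fg; apply: eq_bigr => j _; rewrite fg. Qed.

Lemma bsum0 s f z : bsum s 0 f z = f z.
Proof. by rewrite /bsum expn0 big_ord1 mul0r addr0. Qed.

Lemma bsumD s n f g z : bsum s n (fun x => f x + g x) z = bsum s n f z + bsum s n g z.
Proof. exact: big_split. Qed.

Lemma bsum_sum s n (I : Type) (r : seq I) (P : pred I) (F : I -> Qp -> V) z :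
  bsum s n (fun x => \sum_(i <- r | P i) F i x) z =
  \sum_(i <- r | P i) bsum s n (F i) z.
Proof. exact: exchange_big. Qed.

Lemma bsum_shift s n f x z : bsum s n (fun y => f (y + x)) z = bsum s n f (z + x).
Proof. by apply: eq_bigr => j _; rewrite addrAC. Qed.

Lemma sum_ord_mul (a b : nat) (F : nat -> V) :
  \sum_(j < a * b) F j = \sum_(l < b) \sum_(j < a) F (l + j * b)%N.
Proof.
elim: a => [|a IH].
  by rewrite mul0n big_ord0 big1 // => l _; rewrite big_ord0.
under [RHS]eq_bigr => l _ do rewrite big_ord_recr /=.
rewrite big_split /= -IH mulSn addnC big_split_ord /=; congr (_ + _).
by apply: eq_bigr => l _; rewrite addnC.
Qed.

Lemma bsum_comp s n m f z :
  bsum s (n + m) f z = bsum (s + n%:Z) m (bsum s n f) z.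
Proof.
rewrite /bsum expnD (sum_ord_mul _ _ (fun j => f (z + j%:R * ppow (s + (n + m)%N%:Z)))).
apply: eq_bigr => l _; apply: eq_bigr => j _; congr f.
rewrite -addrA; congr (_ + _).
rewrite natrD mulrDl PoszD addrA natrM -mulrA; congr (_ + _ * _).
rewrite -[LHS]/(_) -ppow_natr ppowM; congr ppow; lia.
Qed.

Lemma bsum_const s n f z c : (forall w, pball (s + n%:Z) w -> f (z + w) = c) ->
  bsum s n f z = c *+ (p ^ n).
Proof.
move=> h; rewrite /bsum (eq_bigr (fun=> c)) ?sumr_const ?card_ord // => j _.
by apply: h; rewrite pball_natM.
Qed.

Lemma bsum_center s n f z : ball_inv s f -> pball (s + n%:Z) z ->
  bsum s n f z = bsum s n f 0.
Proof. by move=> fi zn; rewrite -[z]add0r (bsum_inv fi). Qed.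

End Nmod.

Lemma bsum_mull (V : pzSemiRingType) s n (f g : Qp -> V) z :
  ball_inv (s + n%:Z) g ->
  bsum s n (fun x => g x * f x) z = g z * bsum s n f z.
Proof.
move=> gi; rewrite /bsum mulr_sumr; apply: eq_bigr => j _; congr (_ * _).
by apply: gi; rewrite pball_natM.
Qed.

Lemma bsum_scal (V : pzSemiRingType) s n (f : Qp -> V) c z :
  bsum s n (fun x => c * f x) z = c * bsum s n f z.
Proof. by rewrite /bsum mulr_sumr. Qed.

Lemma bsum_ge0 (V : numDomainType) s n (f : Qp -> V) z :
  (forall x, 0 <= f x) -> 0 <= bsum s n f z.
Proof. by move=> h; apply: sumr_ge0. Qed.

Lemma ler_bsum (V : numDomainType) s n (f g : Qp -> V) z :
  (forall x, f x <= g x) -> bsum s n f z <= bsum s n g z.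
Proof. by move=> h; apply: ler_sum. Qed.

Lemma bsum_nat_eq (V : pzSemiRingType) s n (f : Qp -> nat) z :
  (bsum s n f z)%:R = bsum s n (fun x => (f x)%:R : V) z.
Proof. by rewrite /bsum natr_sum. Qed.

End BallSum.

(** * The character of Q_p *)

Section Character.
Variables (p : nat) (p_pr : prime p) (R : realType).
Local Notation Qp := (padic p_pr).
Local Notation ppow := (@ppow p p_pr).
Local Notation C := (R[i]).
Local Notation normc := (@ComplexField.Normc.normc R).
Implicit Types (x y z w : Qp) (k l s : int) (n : nat).

Lemma expi2piD (s t : R) : expi2pi (s + t) = expi2pi s * expi2pi t.
Proof.
rewrite /expi2pi mulrDr cosD sinD; apply/eqP; rewrite eq_complex /=.
by rewrite eqxx addrC eqxx.
Qed.

Lemma expi2pi0 : expi2pi (0 : R) = 1.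
Proof. by rewrite /expi2pi mulr0 cos0 sin0. Qed.

Lemma expi2piX (t : R) n : expi2pi (t *+ n) = expi2pi t ^+ n.
Proof.
elim: n => [|n IH]; first by rewrite mulr0n expi2pi0.
by rewrite mulrS expi2piD IH exprS.
Qed.

Lemma expi2pi1 : expi2pi (1 : R) = 1.
Proof. by rewrite /expi2pi mulr1 mulr_natl cos2pi sin2pi. Qed.

Lemma normc_expi2pi (t : R) : normc (expi2pi t) = 1.
Proof. by rewrite /= cos2Dsin2 sqrtr1. Qed.

Lemma expi2pi_eq1 (t : R) : 0 <= t < 1 -> expi2pi t = 1 -> t = 0.
Proof.
move=> /andP [t0 t1] [ce _]; apply/eqP; rewrite eq_le t0 andbT leNgt.
apply/negP => tgt0.
have spos : 0 < sin (pi * t) :> R.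
  apply: sin_gt0_pi; rewrite mulr_gt0 ?pi_gt0 //=.
  by rewrite -[X in _ < X]mulr1 ltr_pM2l ?pi_gt0.
have : cos (2 * pi * t) = 1 - 2 * sin (pi * t) ^+ 2 :> R.
  have -> : 2 * pi * t = pi * t + pi * t :> R by ring.
  by rewrite cosD -!expr2 cos2sin2; ring.
rewrite ce => e; have : 0 < sin (pi * t) ^+ 2 :> R by rewrite exprn_gt0.
by lra.
Qed.

Definition rootp n : C := expi2pi (p%:R ^- n).

Lemma pR_neq0 : p%:R != 0 :> R.
Proof. by rewrite pnatr_eq0 -lt0n prime_gt0. Qed.

Lemma rootpX n : rootp n ^+ (p ^ n) = 1.
Proof.
rewrite /rootp -expi2piX (_ : p%:R ^- n *+ (p ^ n)%N = 1) ?expi2pi1 //.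
by rewrite -[_ *+ (p ^ n)%N]mulr_natr natrX mulVf // expf_neq0 // pR_neq0.
Qed.

Lemma rootp_mod n (a b : nat) : (a = b %[mod p ^ n])%N -> rootp n ^+ a = rootp n ^+ b.
Proof. by move=> ab; rewrite -(expr_mod a (rootpX n)) ab expr_mod ?rootpX. Qed.

Lemma rootp_eq1 n (a : nat) : rootp n ^+ a = 1 -> (p ^ n %| a)%N.
Proof.
rewrite -(expr_mod _ (rootpX n)) -expi2piX => h.
have P0 : 0 < p%:R ^+ n :> R by rewrite exprn_gt0 // ltr0n prime_gt0.
have := expi2pi_eq1 _ h; rewrite -[_ *+ (a %% _)]mulr_natl ltr_pdivrMr // mul1r.
rewrite divr_ge0 ?ler0n ?(ltW P0) // -natrX ltr_nat ltn_mod expp_gt0 // => /(_ isT) /eqP.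
by rewrite mulf_eq0 invr_eq0 !pnatr_eq0 expn_eq0 -[p == 0%N]negbK -lt0n prime_gt0 //= orbF.
Qed.

(** Any sufficiently large power of [p] can serve as denominator, which gives
    common denominators for several numbers. *)
Lemma padic_frac_approx x : exists m : nat, forall n, (m <= n)%N -> exists a : nat,
  padic_frac x = a%:R / p%:R ^+ n /\ pball 0 (x - a%:R * ppow n%:Z).
Proof.
have [v [d xd]] := padic_expansion_ex x.
have [a [m [am e1 e2]]] := @expansion_frac_nat p p_pr v d xd.1.
exists m => n mn; exists (a * p ^ (n - m))%N.
have := expansion_frac_approx xd; rewrite e2 (padic_fracP xd) e1 => h.
have nE : n%:Z = m%:Z + (n - m)%N%:Z by lia.
split.
  rewrite natrM natrX -{2}(subnKC mn) exprD invfM mulrACA.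
  by rewrite divff ?mulr1 // expf_neq0 // p_neq0.
rewrite natrM -mulrA -ppow_natr ppowM nE addrCA addNr addr0.
by rewrite /pball expr0z /ppow -exprnN.
Qed.

(** The standard character; [padic_char R xi x] unfolds to [ch (xi * x)]. *)
Definition ch x : C := expi2pi (ratr (padic_frac x)).

(** The character is trivial on Z_p: approximating [x] up to Z_p by a fraction
    with denominator [p ^ n] gives its value as a root of unity. *)
Lemma ch_val x n (a : nat) : pball 0 (x - a%:R * ppow n%:Z) -> ch x = rootp n ^+ a.
Proof.
move=> xa; have [m hm] := padic_frac_approx x.
have [b [e xb]] := hm (maxn m n) (leq_maxl _ _).
set N := maxn m n in e xb.
have nN : (n <= N)%N by exact: leq_maxr.
have -> : ch x = rootp N ^+ b.
  by rewrite /ch e -expi2piX fmorph_div rmorphXn /= !rmorph_nat mulr_natl.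
have -> : rootp n = rootp N ^+ (p ^ (N - n)).
  rewrite /rootp -expi2piX; congr expi2pi.
  rewrite -[_ *+ (p ^ _)%N]mulr_natl natrX -{2}(subnK nN) exprD invfM mulrA.
  by rewrite divff ?expf_neq0 ?pR_neq0 // mul1r.
rewrite -exprM; apply: rootp_mod.
have NE : n%:Z = N%:Z + - (N - n)%N%:Z by lia.
have {xa} xa : pball 0 (x - (p ^ (N - n) * a)%N%:R * ppow N%:Z).
  by move: xa; rewrite NE -ppowM ppow_natr natrM; congr (pball _ (_ - _)); ring.
have h : pball 0 (b%:R * ppow N%:Z - (p ^ (N - n) * a)%N%:R * ppow N%:Z).
  by apply: (pball_trans _ xa); rewrite pball_sym.
set c := (p ^ (N - n) * a)%N in h *.
wlog cb : b c h {e xb xa} / (c <= b)%N => [H|].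
  case: (leqP c b) => [|/ltnW] cb; first exact: H.
  by apply/esym/H => //; rewrite pball_sym.
apply/eqP; rewrite eqn_mod_dvd //.
by move: h; rewrite -mulrBl -natrB // -[N%:Z]add0r pball_natu.
Qed.

Lemma ch_rep x : exists n a, pball 0 (x - a%:R * ppow n%:Z).
Proof. by have [n /(_ n (leqnn n)) [a [_ ?]]] := padic_frac_approx x; exists n, a. Qed.

Lemma ch_common x y : exists n a b,
  pball 0 (x - a%:R * ppow n%:Z) /\ pball 0 (y - b%:R * ppow n%:Z).
Proof.
have [n hn] := padic_frac_approx x; have [m hm] := padic_frac_approx y.
have [a [_ xa]] := hn (maxn n m) (leq_maxl _ _).
have [b [_ yb]] := hm (maxn n m) (leq_maxr _ _).
by exists (maxn n m), a, b.
Qed.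

Lemma chD x y : ch (x + y) = ch x * ch y.
Proof.
have [n [a [b [xa yb]]]] := ch_common x y.
rewrite (ch_val xa) (ch_val yb) -exprD; apply: ch_val.
have := pballD xa yb; congr (pball _ _); rewrite natrD; ring.
Qed.

Lemma ch_int x : pball 0 x -> ch x = 1.
Proof. by move=> h; rewrite (@ch_val x 0 0) // mul0r subr0. Qed.

Lemma ch0 : ch 0 = 1. Proof. by rewrite ch_int // pball0. Qed.

Lemma ch_eq1 x : ch x = 1 -> pball 0 x.
Proof.
have [n [a xa]] := ch_rep x; rewrite (ch_val xa) => /rootp_eq1 pa.
rewrite -[x](subrK (a%:R * ppow n%:Z)); apply: pballD => //.
by rewrite -[n%:Z]add0r pball_natu.
Qed.

Lemma normc_ch x : normc (ch x) = 1. Proof. exact: normc_expi2pi. Qed.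

Lemma chN x : ch (- x) = conjc (ch x).
Proof.
have n1 : ch x * conjc (ch x) = 1.
  by rewrite -sqr_normc normc_def; have := normc_ch x; rewrite /normc; case: (ch x) => a b /= ->; rewrite expr1n.
have := chD x (- x); rewrite subrr ch0 -n1.
by move/mulfI => -> //; apply: contra_eq_neq n1 => ->; rewrite mul0r eq_sym oner_eq0.
Qed.

Lemma chXn x n : ch (n%:R * x) = ch x ^+ n.
Proof.
elim: n => [|n IH]; first by rewrite mul0r ch0.
by rewrite exprS -IH -chD -natr1 mulrDl mul1r addrC.
Qed.

Lemma ch_inv k xi : pball (- k) xi -> ball_inv k (fun x => ch (xi * x)).
Proof.
move=> hx z w hw; rewrite mulrDr chD [X in _ * X]ch_int ?mulr1 //.
have : padic_norm (xi * w) <= p%:R ^ (- k) * p%:R ^ k.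
  by rewrite padic_normM ler_pM ?padic_norm_ge0.
by rewrite -expfzDr ?p_neq0 // addNr.
Qed.

Lemma sum_root1 (z : C) (n : nat) : z ^+ n = 1 -> z != 1 -> \sum_(j < n) z ^+ j = 0.
Proof.
move=> zn z1; apply/(mulfI (x := z - 1)); first by rewrite subr_eq0.
by rewrite mulr0 -subrX1 zn subrr.
Qed.

(** A geometric sum over [p ^ n]-th roots of unity. *)
Lemma sum_ch n x : pball n%:Z x ->
  \sum_(j < p ^ n) ch (j%:R * x) = if pball 0 x then (p ^ n)%:R else 0.
Proof.
move=> xn; case: ifP => [x0|x0].
  rewrite (eq_bigr (fun=> 1)) ?sumr_const ?card_ord // => j _.
  by rewrite chXn ch_int // expr1n.
rewrite (eq_bigr (fun j : 'I__ => ch x ^+ j)) => [|j _]; last exact: chXn.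
apply: sum_root1; last by apply: contraFneq x0 => /ch_eq1.
rewrite -chXn ch_int // mulrC -ppow_natr pballM; apply: pball_le xn; lia.
Qed.

End Character.

(** * Vanishing sums of roots of unity of order a power of p *)

Section VanishingSums.
Variables (p : nat) (p_pr : prime p).

(** The cyclotomic polynomial of order [p ^ n.+1]. *)
Definition cyclo (n : nat) : {poly rat} := \sum_(i < p) 'X^(i * p ^ n).

Lemma cyclo_root (F : numFieldType) (n : nat) (z : F) :
  z ^+ (p ^ n.+1) = 1 -> z ^+ (p ^ n) != 1 -> root (map_poly ratr (cyclo n)) z.
Proof.
move=> z1 zn; rewrite /root rmorph_sum horner_sum.
under eq_bigr => i _ do rewrite /= map_polyXn hornerXn mulnC exprM.
apply/eqP/(mulfI (x := z ^+ (p ^ n) - 1)); first by rewrite subr_eq0.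
by rewrite mulr0 -subrX1 -exprM -expnSr z1 subrr.
Qed.

Lemma size_cyclo n : size (cyclo n) = (p.-1 * p ^ n).+1.
Proof.
rewrite /cyclo; case: p p_pr => [|q] // q_pr; rewrite big_ord_recr /= addrC.
rewrite size_polyDl size_polyXn // ltnS (leq_trans (size_sum _ _ _)) //.
apply/bigmax_leqP => i _; rewrite size_polyXn ltn_mul2r expn_gt0 //=.
Qed.

(** [cyclo n] is irreducible over the rationals: it has the degree of the minimal
    polynomial of a primitive root of unity of order [p ^ n.+1]. *)
Lemma cyclo_dvdp n (q : {poly rat}) : cyclo n %| q \/ coprimep (cyclo n) q.
Proof.
have P0 : (0 < p ^ n.+1)%N by rewrite expn_gt0 prime_gt0.
have [z zP] := C_prim_root_exists P0.
have [f [fz fm fq]] := minCpolyP z.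
have fc : f %= cyclo n.
  have fd : f %| cyclo n.
    rewrite -fq; apply: cyclo_root; first exact: prim_expr_order.
    by rewrite -(prim_order_dvd zP) dvdn_Pexp2l ?prime_gt1 // ltnn.
  rewrite -dvdp_size_eqp // size_cyclo -(size_map_poly (ratr : rat -> algC) f) -fz.
  by rewrite (minCpoly_cyclotomic zP) size_cyclotomic totient_pfactor.
rewrite -(eqp_dvdl _ fc) -(eqp_coprimepl _ fc).
have fd : gcdp f q %| f by exact: dvdp_gcdl.
have /orP [h|h] : (f %| f %/ gcdp f q) || (f %| gcdp f q).
  by rewrite -!fq -rootM -rmorphM /= divpK // fq.
  right; rewrite /coprimep; have f0 : f != 0 by exact: monic_neq0.
  have g0 : gcdp f q != 0 by rewrite gcdp_eq0 (negPf f0).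
  have := dvdp_leq _ h; rewrite divp_eq0 (negPf f0) (negPf g0) ltnNge dvdp_leq //=.
  rewrite size_divp //  => /(_ isT).
  have : (0 < size f)%N by rewrite size_poly_gt0.
  have : (0 < size (gcdp f q))%N by rewrite size_poly_gt0.
  case: (size (gcdp f q)) => [|[|k]] //= _; case: (size f) => //= s _.
  by rewrite subSS ltnNge (leq_trans (leq_subr _ _)).
by left; apply: dvdp_trans h (dvdp_gcdr _ _).
Qed.

(** The polynomial with coefficients [c j] is a multiple of [cyclo n] by a
    polynomial of size at most [p ^ n]. Hence its coefficients repeat with period
    [p ^ n]; those at 0 and at [p ^ n] are both the constant coefficient of the
    cofactor. *)
Lemma vanishing_root_sum (F : numFieldType) (n : nat) (z : F) (c : nat -> nat) :
  z ^+ (p ^ n.+1) = 1 -> z ^+ (p ^ n) != 1 ->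
  \sum_(j < p ^ n.+1) (c j)%:R * z ^+ j = 0 -> c 0%N = c (p ^ n)%N.
Proof.
move=> z1 zn s0; set q : {poly rat} := \poly_(j < p ^ n.+1) (c j)%:R.
have qz : root (map_poly ratr q) z.
  rewrite /root /q poly_def rmorph_sum horner_sum -[X in _ == X]s0; apply/eqP.
  apply: eq_bigr => j _; rewrite /= map_polyZ /= map_polyXn hornerZ hornerXn.
  by rewrite ratr_nat.
have P0 : (0 < p ^ n)%N by rewrite expn_gt0 prime_gt0.
have [/dvdpP [h qh]|co] := cyclo_dvdp n q; last first.
  have := co; rewrite -(coprimep_map (ratr : {rmorphism rat -> F})) => /coprimep_root.
  move=> /(_ z (cyclo_root z1 zn)); by rewrite -[_ == 0]/(root _ z) qz.
have qc j : (j < p ^ n.+1)%N -> q`_j = (c j)%:R by move=> jn; rewrite coef_poly jn.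
have sh : (size h <= p ^ n)%N.
  have [->|h0] := eqVneq h 0; first by rewrite size_poly0.
  have : (size q <= p ^ n.+1)%N by exact: size_poly.
  have c0 : cyclo n != 0 by rewrite -size_poly_gt0 size_cyclo.
  rewrite qh size_mul // size_cyclo addnS /= expnS.
  have -> : (p * p ^ n = p ^ n + p.-1 * p ^ n)%N by rewrite -mulSn prednK ?prime_gt0.
  by rewrite leq_add2r.
have qE j : q`_j = \sum_(i < p) (if (j < i * p ^ n)%N then 0 else h`_(j - i * p ^ n)).
  rewrite qh mulrC /cyclo mulr_suml coef_sum; apply: eq_bigr => i _.
  by rewrite coefXnM.
have p1 := prime_gt1 p_pr.
have c0 : (c 0%N)%:R = h`_0.
  rewrite -qc ?expn_gt0 ?prime_gt0 // qE.
  rewrite (bigD1 (Ordinal (prime_gt0 p_pr))) //= subnn big1 ?addr0 // => i i0.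
  by rewrite muln_gt0 P0 andbT lt0n -(inj_eq val_inj) /= in i0 *; rewrite i0.
have cn : (c (p ^ n)%N)%:R = h`_0.
  rewrite -qc ?ltn_exp2l // qE.
  rewrite (bigD1 (Ordinal p1)) //= mul1n ltnn subnn big1 ?addr0 // => i.
  rewrite -(inj_eq val_inj) /=; case: (val i) => [|[|k]] // _.
    by rewrite mul0n ltn0 subn0 nth_default.
  by rewrite !mulSn -[X in (X < _)%N]addn0 !ltn_add2l addn_gt0 P0.
by apply/eqP; rewrite -(eqr_nat rat) c0 cn.
Qed.

End VanishingSums.

(** * The dichotomy for convolution equations *)

Section Dichotomy.
Variables (p : nat) (p_pr : prime p) (R : realType).
Local Notation Qp := (padic p_pr).
Local Notation ppow := (@ppow p p_pr).
Local Notation C := (R[i]).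
Local Notation cabs := (@ComplexField.Normc.normc R).
Local Notation ch := (@ch p p_pr R).
Implicit Types (x y z w : Qp) (k l s : int) (n : nat).

Lemma cabsD (u v : C) : cabs (u + v) <= cabs u + cabs v.
Proof. exact: le_normcD. Qed.

Lemma cabsM (u v : C) : cabs (u * v) = cabs u * cabs v.
Proof. exact: ComplexField.Normc.normcM. Qed.

Lemma cabs0 : cabs 0 = 0. Proof. exact: ComplexField.Normc.normc0. Qed.

Lemma cabs_eq0 (u : C) : cabs u = 0 -> u = 0.
Proof. exact: ComplexField.Normc.eq0_normc. Qed.

Lemma cabs_ge0 (u : C) : 0 <= cabs u.
Proof. by case: u => a b; rewrite /= sqrtr_ge0. Qed.

Lemma cabsN (u : C) : cabs (- u) = cabs u. Proof. exact: normcN. Qed.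

Lemma cabs_nat n : cabs n%:R = n%:R.
Proof. by rewrite -[n%:R : C](rmorph_nat (@real_complex R)) /= expr0n addr0 sqrtr_sqr ger0_norm. Qed.

Lemma cabs_sum (I : Type) (r : seq I) (P : pred I) (F : I -> C) :
  cabs (\sum_(i <- r | P i) F i) <= \sum_(i <- r | P i) cabs (F i).
Proof.
elim/big_ind2: _ => [|u a v b ua vb|//]; first by rewrite cabs0.
by apply: le_trans (cabsD _ _) _; rewrite lerD.
Qed.

Lemma cabs_bsum s n (f : Qp -> C) z :
  cabs (bsum s n f z) <= bsum s n (fun x => cabs (f x)) z.
Proof. exact: cabs_sum. Qed.

Lemma bsum_split (V : zmodType) s n m (f : Qp -> V) z :
  bsum s (n + m) f z - bsum s n f z =
  \sum_(l < p ^ m | (0 < l)%N) bsum s n f (z + l%:R * ppow (s + n%:Z + m%:Z)).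
Proof.
rewrite bsum_comp {1}/bsum (bigD1 (Ordinal (expp_gt0 p_pr m))) //=.
rewrite mul0r addr0 addrAC subrr add0r; apply: eq_bigl => l.
by rewrite -(inj_eq val_inj) /= lt0n.
Qed.

Lemma bsum_le_mono s n m (f : Qp -> R) z : (forall x, 0 <= f x) ->
  bsum s n f z <= bsum s (n + m) f z.
Proof.
move=> f0; rewrite -subr_ge0 bsum_split; apply: sumr_ge0 => l _.
exact: bsum_ge0.
Qed.

(** The sums over larger and larger balls are monotone and bounded. *)
Lemma bsum_tail s (f : Qp -> R) z (K e : R) : (forall x, 0 <= f x) ->
  (forall n, bsum s n f z <= K) -> 0 < e ->
  exists2 n, (0 < n)%N & forall m, bsum s (n + m) f z - bsum s n f z <= e.
Proof.
move=> f0 fK e0; pose E := [set r : R | exists n, r = bsum s n f z].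
have supE : has_sup E by split; [exists (bsum s 0 f z), 0%N|exists K => r [n ->]].
have [r [n ->] h] := sup_adherent e0 supE.
exists n.+1 => // m; rewrite lerBlDr.
apply: (@le_trans _ _ (sup E)).
  by apply: sup_upper_bound => //; exists (n.+1 + m)%N.
rewrite -lerBlDl; apply: (le_trans (ltW h)); rewrite -addn1; exact: bsum_le_mono.
Qed.

Section Convolution.
Variables (k : int) (nu : Qp -> nat) (a : Qp -> C) (B : nat) (K : R).
Hypothesis nu_inv : ball_inv k nu.
Hypothesis nu_le : forall z, (nu z <= B)%N.
Hypothesis a_inv : ball_inv k a.
Hypothesis a_mean0 : forall z, bsum k 1 a z = 0.
Hypothesis a_l1 : forall n z, bsum k n (fun x => cabs (a x)) z <= K.
Hypothesis conv0 : forall x (e : R), 0 < e -> exists n0, forall n, (n0 <= n)%N ->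
  cabs (bsum k n (fun z => (nu z)%:R * a (z - x)) 0) <= e.

Let xi (i : nat) : Qp := i%:R * ppow (- k).

Let xi_inv i : ball_inv k (fun x => ch (xi i * x)).
Proof. by apply: ch_inv; rewrite pball_natM. Qed.

(** The mean over all frequencies of the Fourier transform of [a] over the ball of
    level [k + N] is [a 0], so it is at least as large as [a 0] at one of them. At
    the frequencies [xi i] with [i] divisible by [p] the character is constant on
    the balls of level [k + 1], and the transform vanishes with the means of
    [a]. *)
Lemma frequency_ex N : (0 < N)%N -> a 0 != 0 -> exists2 i : nat, ~~ (p %| i)%N &
  cabs (a 0) <= cabs (bsum k N (fun x => a x * ch (xi i * x)) 0).
Proof.
move=> N0 a0; pose S i := bsum k N (fun x => a x * ch (xi i * x)) 0.
have sumS : \sum_(i < p ^ N) S i = (p ^ N)%:R * a 0.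
  rewrite /S /bsum exchange_big /= (bigD1 (Ordinal (expp_gt0 p_pr N))) //=.
  rewrite [X in _ + X]big1 ?addr0 => [|j]; last first.
    rewrite -(inj_eq val_inj) /= => j0; rewrite -mulr_sumr.
    rewrite (eq_bigr (fun i : 'I__ => ch (i%:R * (j%:R * ppow N%:Z)))) => [|i _].
      rewrite sum_ch; last by rewrite pball_natM.
      have -> : pball 0 ((j : nat)%:R * ppow N%:Z) = (p ^ N %| j)%N.
        by rewrite -(pball_natu p_pr _ 0) add0r.
      by rewrite gtnNdvd ?mulr0 ?lt0n // ltn_ord.
    congr ch; rewrite /xi add0r mulrACA ppowM -mulrA.
    by rewrite (_ : - k + (k + N%:Z) = N%:Z) //; lia.
  rewrite (eq_bigr (fun=> a 0)) => [|i _]; last by rewrite mul0r addr0 mulr0 ch0 mulr1.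
  by rewrite sumr_const card_ord mulr_natl.
have [i hi] : exists i, cabs (a 0) <= cabs (S i).
  apply: contrapT => /forallNP h.
  have : cabs (\sum_(i < p ^ N) S i) < \sum_(i < p ^ N) cabs (a 0).
    apply: le_lt_trans (cabs_sum _ _ _) _; apply: ltr_sum.
      by apply/hasP; exists (Ordinal (expp_gt0 p_pr N)); rewrite ?mem_index_enum.
    by move=> i _; rewrite ltNge; apply/negP/h.
  by rewrite sumS cabsM cabs_nat sumr_const card_ord mulr_natl ltxx.
exists i => //; apply/negP => pi; have : S i = 0; last first.
  move=> e; move: hi; rewrite e cabs0 le_eqVlt ltNge cabs_ge0 orbF => /eqP /cabs_eq0.
  exact/eqP.
rewrite /S -(prednK N0) -add1n bsum_comp.
rewrite (@bsum_const _ _ _ _ _ _ _ 0) ?mul0rn // => w _.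
rewrite (@eq_bsum _ _ _ _ _ _ (fun x => ch (xi i * x) * a x)) => [|x]; last exact: mulrC.
rewrite bsum_mull ?a_mean0 ?mulr0 //; apply: ch_inv.
have -> : xi i = i%:R * ppow (- (k + 1) + 1%N%:Z) by congr (_ * ppow _); lia.
by rewrite pball_natu expn1.
Qed.

(** Let [A] and [Bs] be the sums over balls of level [k + N] of [a] and [nu],
    multiplied by a character and its conjugate. The convolution equation gives
    that the sum of [A (z - y) * Bs z] over all these balls is 0. If [N] is such
    that [a] has mass at most [cabs (a 0) / 2] outside the ball of level [k + N],
    and the character is the one of [frequency_ex], then the term of [z = y] has
    size at least [cabs (a 0) * cabs (Bs y)], while the other ones add up to at most
    half of [cabs (a 0)] times the supremum of [cabs Bs]. So every bound for [Bs]
    can be halved, and [Bs] is 0. *)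
Lemma twisted_sums_vanish : a 0 != 0 -> exists N i, [/\ (0 < N)%N, ~~ (p %| i)%N &
  forall y, bsum k N (fun z => (nu z)%:R * ch (- (xi i * z))) y = 0].
Proof.
move=> a0; set al := cabs (a 0).
have al0 : 0 < al.
  by rewrite lt_def cabs_ge0 andbT; apply: contra_neq a0 => /cabs_eq0.
have [N N0 tail] : exists2 N, (0 < N)%N & forall m,
    bsum k (N + m) (fun x => cabs (a x)) 0 - bsum k N (fun x => cabs (a x)) 0 <= al / 2.
  by apply: bsum_tail (fun n => a_l1 n 0) _ => [x|]; [exact: cabs_ge0|lra].
have [i pi hi] := frequency_ex N0 a0; exists N, i; split => //.
pose ah x := a x * ch (xi i * x); pose nh z := (nu z)%:R * ch (- (xi i * z)).
pose A := bsum k N ah; pose Bs := bsum k N nh.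
have ahi : ball_inv k ah by move=> x w hw; rewrite /ah a_inv // xi_inv.
have nhi : ball_inv k nh.
  by move=> x w hw; rewrite /nh nu_inv // !chN xi_inv.
have cnh z : cabs (nh z) <= B%:R.
  by rewrite /nh cabsM cabs_nat normc_ch mulr1 ler_nat.
have cah x : cabs (ah x) = cabs (a x) by rewrite /ah cabsM normc_ch mulr1.
have AE z : cabs (A z) <= bsum k N (fun x => cabs (a x)) z.
  apply: le_trans (cabs_bsum _ _ _ _) _; rewrite le_eqVlt; apply/orP; left; apply/eqP.
  exact: eq_bsum.
(* the twisted convolution equation, summed over a ball of level k + N *)
have W y e : 0 < e -> exists n0, forall n, (n0 <= n)%N ->
    cabs (bsum k n (fun z => A (z - y) * nh z) 0) <= e.
  move=> e0; have P0 : 0 < (p ^ N)%:R :> R by rewrite ltr0n expp_gt0.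
  pose xl (l : nat) := y - l%:R * ppow (k + N%:Z).
  have [n0 hn0] : exists n0 : nat -> nat, forall l n : nat, (n0 l <= n)%N ->
      cabs (bsum k n (fun z => (nu z)%:R * a (z - xl l)) 0) <= e / (p ^ N)%:R.
    suff /choice [n0 h] : forall l : nat, exists n0, forall n, (n0 <= n)%N ->
        cabs (bsum k n (fun z => (nu z)%:R * a (z - xl l)) 0) <= e / (p ^ N)%:R.
      by exists n0.
    by move=> l; apply: conv0; rewrite divr_gt0.
  exists (\max_(l < p ^ N) n0 l) => n hn.
  have -> : bsum k n (fun z => A (z - y) * nh z) 0 =
    \sum_(l < p ^ N) ch (- (xi i * xl l)) * bsum k n (fun z => (nu z)%:R * a (z - xl l)) 0.
    under [RHS]eq_bigr => l _ do rewrite -bsum_scal.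
    rewrite -bsum_sum; apply: eq_bsum => z; rewrite /A /bsum mulr_suml.
    apply: eq_bigr => l _; rewrite /ah /nh.
    have -> : z - y + l%:R * ppow (k + N%:Z) = z - xl l by rewrite /xl; ring.
    have -> : ch (- (xi i * xl l)) = ch (xi i * (z - xl l)) * ch (- (xi i * z)).
      by rewrite -chD; congr ch; ring.
    by ring.
  apply: le_trans (cabs_sum _ _ _) _.
  have -> : e = \sum_(l < p ^ N) e / (p ^ N)%:R.
    by rewrite sumr_const card_ord -[_ *+ (p ^ N)%N]mulr_natr divfK // gt_eqF.
  apply: ler_sum => l _; rewrite cabsM normc_ch mul1r; apply: hn0.
  by apply: leq_trans hn; exact: (leq_bigmax l).
have step (M : R) : (forall y, cabs (Bs y) <= M) -> forall y, cabs (Bs y) <= M / 2.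
  move=> BM y; apply/ler_addgt0Pr => e e0.
  have [n0 hn0] := W y (al * e) (mulr_gt0 al0 e0).
  have [m0 ym0] := pball_ex y.
  pose m := (n0 + m0 + `|k|)%N.
  have := hn0 (N + m)%N; rewrite /m => /(_ ltac:(lia)); rewrite -/m.
  have Ai : ball_inv (k + N%:Z) (fun z => A (z - y)).
    by move=> z w hw; rewrite addrAC; exact: (bsum_inv ahi).
  rewrite bsum_comp.
  rewrite (@eq_bsum _ _ _ _ _ _ (fun z => A (z - y) * Bs z)); last first.
    by move=> z; rewrite bsum_mull.
  rewrite -(@bsum_center _ _ _ _ _ _ y); last 2 first.
  - by move=> z w hw; rewrite Ai // /Bs (bsum_inv nhi).
  - apply: ym0; rewrite /m; lia.
  rewrite /bsum (bigD1 (Ordinal (expp_gt0 p_pr m))) //= mul0r addr0 subrr.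
  set T := \sum_(_ | _) _ => hT.
  have hT2 : cabs T <= M * (al / 2).
    have M0 : 0 <= M := le_trans (cabs_ge0 _) (BM 0).
    apply: le_trans (cabs_sum _ _ _) _; apply: le_trans (ler_wpM2l M0 (tail m)).
    rewrite bsum_split mulr_sumr [leLHS](eq_bigl (fun l : 'I__ => (0 < l)%N)); last first.
      by move=> l; rewrite -(inj_eq val_inj) /= lt0n.
    apply: ler_sum => l _; rewrite cabsM mulrC ler_pM ?cabs_ge0 //.
    by rewrite addrC addKr add0r.
  have hA : al * cabs (Bs y) <= cabs (A 0 * Bs y).
    by rewrite cabsM ler_wpM2r ?cabs_ge0.
  have : cabs (A 0 * Bs y) <= al * e + M * (al / 2).
    have -> : A 0 * Bs y = (A 0 * Bs y + T) - T by rewrite addrK.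
    by apply: le_trans (cabsD _ _) _; rewrite cabsN lerD.
  move/(le_trans hA) => h; rewrite -(ler_pM2l al0); apply: le_trans h _.
  by rewrite le_eqVlt; apply/orP; left; apply/eqP; field.
have Bsle r y : cabs (Bs y) <= (B%:R * (p ^ N)%:R) / 2 ^+ r.
  elim: r y => [|r IH] y; last first.
    by have := step _ IH y; rewrite exprS invfM [2^-1 * _]mulrC mulrA.
  rewrite expr0 divr1; apply: le_trans (cabs_bsum _ _ _ _) _.
  rewrite mulr_natr -[X in _ <= _ *+ X]card_ord -sumr_const.
  by apply: ler_sum => j _.
move=> y; apply: cabs_eq0; apply/eqP; rewrite eq_le cabs_ge0 andbT leNgt.
apply/negP => c0; set D := B%:R * (p ^ N)%:R in Bsle.
pose r := (Num.truncn (D / cabs (Bs y))).+1.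
have : D / cabs (Bs y) < r%:R by exact: truncnS_gt.
rewrite ltr_pdivrMr // => Dr; have := Bsle r y.
rewrite ler_pdivlMr ?exprn_gt0 // leNgt mulrC; apply/negP/negPn.
by apply: lt_le_trans Dr _; rewrite ler_pM2r // -natrX ler_nat ltnW // ltn_expl.
Qed.

(** The sums of [nu] against a character of exact order [p ^ N] over balls of level
    [k + N] are vanishing sums of roots of unity with natural coefficients, and
    [vanishing_root_sum] compares the values of [nu] at [y] and
    [y + ppow (k + 1)]. *)
Lemma dichotomy_at_origin : a 0 != 0 -> ball_inv (k + 1) nu.
Proof.
move=> /twisted_sums_vanish [N [i [N0 pi v]]].
have step y : nu y = nu (y + ppow (k + 1)).
  pose z := ch (- (i%:R * ppow N%:Z)).
  have zX n : z ^+ n = ch (- (i%:R * (n%:R * ppow N%:Z))).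
    by rewrite -chXn; congr ch; ring.
  have zN : z ^+ (p ^ N.-1.+1) = 1.
    rewrite zX prednK // -ppow_natr ppowM addNr ppow0 ch_int // pballN mulr1.
    exact: pball_nat.
  have zN1 : z ^+ (p ^ N.-1) != 1.
    apply: contra pi => /eqP; rewrite zX => /ch_eq1.
    rewrite pballN -ppow_natr ppowM (_ : - _ + _ = 0 + 1%N%:Z); last by lia.
    by rewrite pball_natu expn1.
  have := vanishing_root_sum p_pr (c := fun j => nu (y + j%:R * ppow (k + N%:Z))) zN zN1.
  rewrite mul0r addr0 -ppow_natr ppowM (_ : - _ + _ = k + 1); last by lia.
  apply; rewrite prednK //.
  have : ch (- (xi i * y)) != 0.
    by apply/eqP => e; have := normc_ch R (- (xi i * y)); rewrite e cabs0 => /eqP; rewrite eq_sym oner_eq0.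
  move=> c0; have vy := v y; rewrite /bsum in vy.
  apply: (mulfI c0); rewrite mulr0 -[RHS]vy mulr_sumr; apply: eq_bigr => j _.
  rewrite zX mulrCA -chD; congr (_ * ch _).
  rewrite -opprD mulrDr; congr (- (_ + _)); rewrite /xi.
  by rewrite mulrACA ppowM mulrA (_ : - k + _ = N%:Z) //; lia.
move=> z w; rewrite -[1]/(1%N%:Z) => /pball_rep [j _ hj].
rewrite (ball_invE nu_inv (y := z + j%:R * ppow (k + 1%N%:Z))); last first.
  by rewrite (_ : _ - _ = w - j%:R * ppow (k + 1%N%:Z)) //; ring.
elim: j {hj} => [|j IH]; first by rewrite mul0r addr0.
by rewrite -natr1 mulrDl mul1r addrA -step.
Qed.

End Convolution.

(** A solution of [nu * a = 0] on the quotient of Q_p by the ball of level [k],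
    where [a] is summable, not 0, and has mean zero on the balls of level [k + 1];
    the convolution is a limit of sums over balls around 0. As [nu] takes
    natural values, its Fourier transform cannot vanish at one frequency of a
    given order without vanishing at all frequencies of this order, because they
    are conjugate. A translation moves a point where [a] does not vanish to 0. *)
Theorem convolution_dichotomy k (nu : Qp -> nat) (a : Qp -> C) (B : nat) (K : R) :
  ball_inv k nu -> (forall z, (nu z <= B)%N) ->
  ball_inv k a -> (forall z, bsum k 1 a z = 0) ->
  (forall n z, bsum k n (fun x => cabs (a x)) z <= K) ->
  (forall x (e : R), 0 < e -> exists n0, forall n, (n0 <= n)%N ->
    cabs (bsum k n (fun z => (nu z)%:R * a (z - x)) 0) <= e) ->
  (exists x, a x != 0) -> ball_inv (k + 1) nu.
Proof.
move=> nui nuB ai am al c [x0 ax0]; pose a' x := a (x + x0).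
apply: (@dichotomy_at_origin k nu a' B K) => //.
- move=> z w hw; rewrite /a' addrAC.
  exact: ai.
- by move=> z; rewrite bsum_shift.
- by move=> n z; rewrite (bsum_shift _ _ (fun x => cabs (a x))).
- move=> x e e0; have [n0 h] := c (x - x0) e e0; exists n0 => n hn.
  have := h n hn; congr (cabs _ <= _); apply: eq_bsum => z.
  by rewrite /a' opprB addrA addrAC.
- by rewrite /a' add0r.
Qed.

End Dichotomy.

(** * Borel sets and Haar measure *)

Section Borel.
Variables (p : nat) (p_pr : prime p).
Local Notation Qp := (padic p_pr).
Local Notation ppow := (@ppow p p_pr).
Implicit Types (x y z w : Qp) (k l s : int) (n : nat) (A B : set Qp).

Definition bset k z : set Qp := [set x | pball k (x - z)].

Lemma bsetE k z x : bset k z x = pball k (x - z) :> Prop.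
Proof. by []. Qed.

Lemma nbhs_bset z A : nbhs z A <-> exists k, bset k z `<=` A.
Proof.
split => [/nbhs_ballP [e /= e0]|[k kA]].
  rewrite ballEmdist => eA; pose n := (Num.truncn (e^-1)).+1.
  exists (- n%:Z) => x hx; apply: eA => /=; rewrite /mdist /= /padic_dist.
  rewrite -padic_normN opprB; apply: le_lt_trans hx _; rewrite -invr_expz -exprnP.
  rewrite invf_plt ?posrE ?exprn_gt0 ?prat_gt0 //.
  apply: lt_trans (truncnS_gt _) _; rewrite -natrX ltr_nat.
  by rewrite ltn_expl // prime_gt1.
apply/nbhs_ballP; exists (p%:R ^ k); first by rewrite /= exprz_gt0 // prat_gt0.
rewrite ballEmdist => x hx; apply: kA; rewrite /bset /= pball_sym.
by apply: ltW; move: hx; rewrite /= /mdist.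
Qed.

Lemma open_ball_inv k A : ball_inv k A -> open A.
Proof.
move=> Ai; rewrite openE => z Az; apply/nbhs_bset; exists k => x /= hx.
by rewrite (ball_invE Ai hx).
Qed.

Lemma measurable_ball_inv k A : ball_inv k A -> measurable A.
Proof. by move=> /open_ball_inv oA; apply: sub_sigma_algebra. Qed.

Lemma bset_inv k z : ball_inv k (bset k z).
Proof. by move=> x w hw; rewrite /bset /= addrAC pballDr. Qed.

Lemma measurable_bset k z : measurable (bset k z).
Proof. exact: measurable_ball_inv (@bset_inv k z). Qed.

Lemma ball_inv_set_le k l A : l <= k -> ball_inv k A -> ball_inv l A.
Proof. exact: ball_inv_le. Qed.

Lemma measurable_fun_ball_inv d (T : measurableType d) k (f : Qp -> T) D :
  ball_inv k f -> measurable D -> measurable_fun D f.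
Proof.
move=> fi mD _ Y mY; apply: measurableI => //.
by apply: (@measurable_ball_inv k) => z w hw; rewrite /preimage /= fi.
Qed.

(** The Borel sets satisfying [P] form a sigma-algebra that contains the open
    sets. *)
Lemma borel_ind (P : set Qp -> Prop) : (forall A, open A -> P A) ->
  (forall A, measurable A -> P A -> P (~` A)) ->
  (forall F : nat -> set Qp, (forall n, measurable (F n)) -> (forall n, P (F n)) ->
    P (\bigcup_n F n)) ->
  forall A, measurable A -> P A.
Proof.
move=> Po Pc Pu A mA.
suff : (measurable `&` P) A by case.
have := @smallest_sub _ (@sigma_algebra Qp setT) (@open Qp) (measurable `&` P).
apply => //; last first.
  by move=> U oU; split; [exact: sub_sigma_algebra|exact: Po].
split => [|B [mB PB]|F FP].
- by split => //; apply: Po; exact: open0.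
- by rewrite setTD; split; [exact: measurableC|exact: Pc].
- split; first by apply: bigcup_measurable => n _; case: (FP n).
  by apply: Pu => n; case: (FP n).
Qed.

Lemma open_shift t A : open A -> open [set x | A (x - t)].
Proof.
rewrite !openE => oA z /= /oA /nbhs_bset [k kA].
apply/nbhs_bset; exists k => x /= hx; apply: kA.
by rewrite /bset /= opprB addrA subrK.
Qed.

Lemma measurable_shift t A : measurable A -> measurable [set x | A (x - t)].
Proof.
move: A; apply: borel_ind => [A oA|A _ h|F _ h].
- by apply: sub_sigma_algebra; exact: open_shift.
- exact: measurableC h.
- have -> : [set x | (\bigcup_n F n) (x - t)] = \bigcup_n [set x | F n (x - t)] by [].
  exact: bigcup_measurable.
Qed.

Lemma image_shift t A : [set t + x | x in A] = [set x | A (x - t)].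
Proof.
apply/seteqP; split => [y [x Ax <-]|x Ax] /=; first by rewrite addrAC subrr add0r.
by exists (x - t) => //; rewrite subrKC.
Qed.

Lemma bset_shift k z : bset k z = [set x | bset k 0 (x - z)].
Proof. by apply/seteqP; split => x; rewrite /bset /= subr0. Qed.

Lemma bset_sub k z t x : bset k (z - t) (x - t) = bset k z x.
Proof. by rewrite /bset /= opprB addrA subrK. Qed.

Lemma bset_eq k z z' : pball k (z - z') -> bset k z = bset k z'.
Proof.
move=> h; apply/seteqP; split => x /= hx; apply: pball_trans hx _ => //.
by rewrite pball_sym.
Qed.

Lemma bset_disj k z z' : ~~ pball k (z - z') -> bset k z `&` bset k z' = set0.
Proof.
move=> /negP h; apply/seteqP; split => x //= [hx hx']; apply: h.
by apply: pball_trans hx'; rewrite pball_sym.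
Qed.

Lemma sub_bset k l z : k <= l -> bset k z `<=` bset l z.
Proof. by move=> kl x; exact: pball_le. Qed.

Lemma bset_cover k n z :
  bset (k + n%:Z) z = \big[setU/set0]_(j < p ^ n) bset k (z + j%:R * ppow (k + n%:Z)).
Proof.
rewrite -(bigcup_mkord _ (fun j : nat => bset k (z + j%:R * ppow (k + n%:Z)))).
apply/seteqP; split => [x /pball_rep [j jn hj]|x [j /= jn hj]].
  by exists j => //=; rewrite /bset /= opprD addrA.
rewrite /bset /=; apply: pball_trans (pball_le _ hj) _; first by lia.
by rewrite addrAC subrr add0r pball_natM.
Qed.

Lemma bset_cover_triv k n z :
  trivIset [set: 'I_(p ^ n)] (fun j => bset k (z + j%:R * ppow (k + n%:Z))).
Proof.
apply/trivIsetP => i j _ _ ij; apply: bset_disj; apply: contra ij.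
rewrite opprD addrACA subrr add0r => h; apply/eqP/val_inj.
exact: pball_rep_uniq h.
Qed.

(** An ultrafilter that contains the ball contains for every [n] one of its balls
    of level [k - n]. These choices are compatible, so that they are the residues
    of a p-adic integer, from which the limit is obtained. *)
Lemma compact_bset k z : compact (bset k z).
Proof.
rewrite compact_ultra => F UF Fk.
have [c hc] : exists c : nat -> nat, forall n, (c n < p ^ n)%N /\
    F (bset (k - n%:Z) (z + (c n)%:R * ppow k)).
  suff /choice [c hc] : forall n : nat, exists c, (c < p ^ n)%N /\
    F (bset (k - n%:Z) (z + c%:R * ppow k)) by exists c.
  move=> n; apply: contrapT => /forallNP h.
  have hF P : (P <= p ^ n)%N ->
      F [set x | forall j, (j < P)%N -> ~ bset (k - n%:Z) (z + j%:R * ppow k) x].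
    elim: P => [_|P IH Pn]; first by apply: filterS filterT.
    have [FP|FP] := in_ultra_setVsetC (bset (k - n%:Z) (z + P%:R * ppow k)) UF.
      by exfalso; apply: (h P).
    apply: filterS2 FP (IH (ltnW Pn)) => x h1 h2 j.
    by rewrite ltnS leq_eqVlt => /orP [/eqP -> //|/h2].
  have [x [hx hxn]] := filter_ex (filterI Fk (hF _ (leqnn _))); have := @bset_cover (k - n%:Z) n z.
  rewrite subrK => e; move: hx; rewrite e -(bigcup_mkord _ (fun j : nat => bset (k - n%:Z) (z + j%:R * ppow k))) => -[j jn hj].
  exact: hxn hj.
have cS : forall n : nat, (c n.+1 = c n %[mod p ^ n])%N.
  move=> n; have [_ F1] := hc n; have [_ F2] := hc n.+1.
  have [x [x1 x2]] := filter_ex (filterI F1 F2).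
  have h : pball (k - n%:Z) ((c n)%:R * ppow k - (c n.+1)%:R * ppow k).
    have : pball (k - n%:Z) ((z + (c n)%:R * ppow k) - (z + (c n.+1)%:R * ppow k)).
      apply: (@pball_trans _ _ _ x); first by rewrite pball_sym.
      by apply: pball_le x2; lia.
    by rewrite opprD addrACA subrr add0r.
  move: h; rewrite -mulrBl pballM (_ : k - n%:Z - k = - n%:Z); last by lia.
  case: (leqP (c n) (c n.+1)) => [le|/ltnW le].
    by rewrite pball_sym -natrB // pball_dvdn => h; apply/eqP; rewrite eqn_mod_dvd.
  by rewrite -natrB // pball_dvdn => h; apply/esym/eqP; rewrite eqn_mod_dvd.
pose zeta := mk_padic_int p_pr cS.
have ze n : pball (- n%:Z) (@FracField.tofrac _ zeta - (c n)%:R : Qp).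
  have := zresidue_approx zeta n; rewrite /pball -(rmorph_nat (@FracField.tofrac _)) -tofracB.
  by rewrite padic_norm_int /= modn_small -?invr_expz -?exprnP //; case: (hc n).
pose ell : Qp := z + @FracField.tofrac _ zeta * ppow k.
have ellc n : pball (k - n%:Z) (ell - (z + (c n)%:R * ppow k)).
  rewrite /ell opprD addrACA subrr add0r -mulrBl pballM.
  by rewrite (_ : k - n%:Z - k = - n%:Z) //; lia.
exists ell; split.
  rewrite /bset /=; have [c0 _] := hc 0%N; have := ellc 0%N.
  have -> : z + (c 0%N)%:R * ppow k = z.
    by move: c0; rewrite expn0 ltnS leqn0 => /eqP ->; rewrite mul0r addr0.
  by apply: pball_le; lia.
move=> A /= /nbhs_bset [l lA]; pose n := `|k - l|%N.
have [_] := hc n; apply: filterS => x hx; apply: lA.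
rewrite /bset /=; apply: (@pball_trans _ _ _ (z + (c n)%:R * ppow k)).
  by apply: pball_le hx; rewrite /n; lia.
by rewrite pball_sym; apply: pball_le (ellc n); rewrite /n; lia.
Qed.

End Borel.

Section Haar.
Variables (R : realType) (p : nat) (p_pr : prime p).
Local Notation Qp := (padic p_pr).
Variables (m : {measure set Qp -> \bar R}) (m_haar : is_haar m).
Local Notation ppow := (@ppow p p_pr).
Local Notation bset := (@bset p p_pr).
Implicit Types (x y z w : Qp) (k l s : int) (n : nat) (A B : set Qp).

Lemma measure_shift t A : measurable A -> m [set x | A (x - t)] = m A.
Proof. by move=> mA; rewrite -image_shift; exact: haar_translation. Qed.

Lemma bset_fin k z : (m (bset k z) < +oo)%E.
Proof. by apply: (haar_compact m_haar); exact: compact_bset. Qed.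

Definition mu k : R := fine (m (bset k 0)).

Lemma m_bset k z : m (bset k z) = (mu k)%:E.
Proof.
rewrite bset_shift measure_shift; last exact: measurable_bset.
by rewrite /mu fineK // ge0_fin_numE // bset_fin.
Qed.

Lemma mu_ge0 k : 0 <= mu k.
Proof. exact: fine_ge0. Qed.

Definition mball A k z : R := fine (m (A `&` bset k z)).

Lemma mballE A k z : measurable A -> m (A `&` bset k z) = (mball A k z)%:E.
Proof.
move=> mA; rewrite /mball fineK // ge0_fin_numE //.
apply: le_lt_trans (bset_fin k z); apply: le_measure; rewrite ?inE.
- by apply: measurableI => //; exact: measurable_bset.
- exact: measurable_bset.
- exact: subIsetr.
Qed.

Lemma mball_ge0 A k z : 0 <= mball A k z.
Proof. exact: fine_ge0. Qed.

Lemma mball_inv A k : ball_inv k (mball A k).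
Proof.
move=> z w hw; rewrite /mball (@bset_eq _ _ _ (z + w) z) //.
by rewrite addrAC subrr add0r.
Qed.

Lemma mball_le A B k z : measurable A -> measurable B -> A `<=` B ->
  mball A k z <= mball B k z.
Proof.
move=> mA mB AB; rewrite -lee_fin -!mballE //; apply: le_measure; rewrite ?inE.
- by apply: measurableI => //; exact: measurable_bset.
- by apply: measurableI => //; exact: measurable_bset.
- exact: setSI.
Qed.

Lemma mball_mu A k z : measurable A -> mball A k z <= mu k.
Proof.
move=> mA; rewrite -lee_fin -mballE // -(m_bset k z).
apply: le_measure; rewrite ?inE; [|exact: measurable_bset|exact: subIsetr].
by apply: measurableI => //; exact: measurable_bset.
Qed.

Lemma mballT k z : mball setT k z = mu k.
Proof. by rewrite /mball setTI m_bset. Qed.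

Lemma mballU A B k z : measurable A -> measurable B -> A `&` B = set0 ->
  mball (A `|` B) k z = mball A k z + mball B k z.
Proof.
move=> mA mB AB; have mb := @measurable_bset p p_pr k z.
have e : (m ((A `|` B) `&` bset k z) = m (A `&` bset k z) + m (B `&` bset k z))%E.
  rewrite setIUl measureU //; [exact: measurableI|exact: measurableI|].
  by rewrite setIACA AB set0I.
by move: e; rewrite !mballE //; [case|exact: measurableU].
Qed.

Lemma mball_bsum A k n z : measurable A ->
  mball A (k + n%:Z) z = bsum k n (mball A k) z.
Proof.
move=> mA; have mb j := @measurable_bset p p_pr k (z + j%:R * ppow (k + n%:Z)).
have : m (A `&` bset (k + n%:Z)%R z) =
    (\sum_(j < p ^ n) m (A `&` bset k (z + j%:R * ppow (k + n%:Z))%R))%E.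
  rewrite bset_cover big_distrr /= measure_semi_additive_ord //.
  - by move=> j; apply: measurableI.
  - apply/trivIsetP => i j _ _ ij; rewrite setIACA.
    by have /trivIsetP -> := @bset_cover_triv p p_pr k n z; rewrite // setI0.
  - by apply: bigsetU_measurable => j _; apply: measurableI.
rewrite mballE // (eq_bigr (fun j : 'I__ => (mball A k (z + j%:R * ppow (k + n%:Z)))%:E)); last first.
  by move=> j _; rewrite mballE.
by rewrite sumEFin => -[].
Qed.

Lemma muX k n : mu (k + n%:Z) = (p ^ n)%:R * mu k.
Proof.
rewrite -(mballT _ 0) mball_bsum // (bsum_const (c := mu k)) ?mulr_natl // => w _.
exact: mballT.
Qed.

Lemma bset_bigcup k z : \bigcup_n bset (k + n%:Z) z = [set: Qp].
Proof.
apply/seteqP; split => // x _; have [n hn] := pball_ex (x - z).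
by exists (n + `|k|)%N => //; apply: hn; lia.
Qed.

(** Otherwise all larger balls would be null too, and so would be Q_p. *)
Lemma mu_gt0 k : 0 < mu k.
Proof.
rewrite lt_def mu_ge0 andbT; apply/negP => /eqP k0.
have /eqP := haar_neq0 m_haar; apply; rewrite -(bset_bigcup k 0).
apply/eqP; rewrite eq_le measure_ge0 andbT.
have hn n : m (bset (k + n%:Z) 0) = 0%E by rewrite m_bset muX k0 mulr0.
have := @nondecreasing_cvg_mu _ _ _ m (fun n : nat => bset (k + n%:Z) 0).
move=> /(_ (fun n => @measurable_bset _ _ _ _)).
rewrite bset_bigcup => /(_ measurableT) h.
have hm : {homo (fun n : nat => bset (k + n%:Z) 0) : a b / (a <= b)%N >-> (a <= b)%O}.
  by move=> a b ab; apply/subsetPset; apply: sub_bset; lia.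
have := h hm; have -> : m \o (fun n : nat => bset (k + n%:Z) 0) = cst 0%E.
  by apply/funext => n; rewrite /= hn.
by move/cvg_lim => <- //; rewrite lim_cst.
Qed.

(** Continuity of the measure along the increasing balls around [z]. *)
Lemma mball_lim A (e : R) z : measurable A -> (m A < +oo)%E -> 0 < e ->
  exists n0 : nat, forall k, n0%:Z <= k -> fine (m A) - e <= mball A k z.
Proof.
move=> mA Afin e0.
have mn n : measurable (A `&` bset n%:Z z).
  by apply: measurableI => //; exact: measurable_bset.
have hm : {homo (fun n : nat => A `&` bset n%:Z z) : a b / (a <= b)%N >-> (a <= b)%O}.
  by move=> a b ab; apply/subsetPset; apply: setIS; apply: sub_bset; lia.
have AE : \bigcup_n (A `&` bset n%:Z z) = A.
  rewrite -setI_bigcupr (_ : \bigcup_n bset n%:Z z = setT) ?setIT //.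
  by rewrite -(bset_bigcup 0 z); apply: eq_bigcupr => n _; rewrite add0r.
have := @nondecreasing_cvg_mu _ _ _ m (fun n : nat => A `&` bset n%:Z z) mn.
rewrite AE => /(_ mA hm).
have Ar : m A = (fine (m A))%:E by rewrite fineK // ge0_fin_numE.
rewrite Ar => /fine_cvgP [_ /cvgrPdist_le /(_ _ e0) [n0 _ h]].
exists n0 => k nk; pose n := `|k|%N; have kn : k = n%:Z by rewrite /n; lia.
have := h n; rewrite /= -/(mball A n%:Z z) kn => /(_ ltac:(lia)).
by rewrite lerBlDl addrC -lerBlDl => /(le_trans (ler_norm _)); rewrite lerBlDr addrC lerBlDl addrC.
Qed.

Lemma mball_leM A k z : measurable A -> (m A < +oo)%E -> mball A k z <= fine (m A).
Proof.
move=> mA Afin; rewrite -lee_fin -mballE // fineK ?ge0_fin_numE //.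
by apply: measureIl => //; exact: measurable_bset.
Qed.

End Haar.

(** * Regularity and density points *)

Section Regularity.
Variables (R : realType) (p : nat) (p_pr : prime p).
Local Notation Qp := (padic p_pr).
Variables (m : {measure set Qp -> \bar R}).
Local Notation ppow := (@ppow p p_pr).
Local Notation bset := (@bset p p_pr).
Local Notation mball := (mball m).
Local Notation mu := (mu m).
Implicit Types (x y z w : Qp) (k l s : int) (n : nat) (A B C D : set Qp).

Lemma measure_union_tail D (F : nat -> set Qp) (e : R) : measurable D ->
  (m D < +oo)%E -> (forall n, measurable (F n)) -> nondecreasing_seq F -> 0 < e ->
  exists n, (m (D `&` (\bigcup_i F i `\` F n)) < e%:E)%E.
Proof.
move=> mD Dfin mF ndF e0; pose G n := D `&` (\bigcup_i F i `\` F n).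
have mU : measurable (\bigcup_i F i) by exact: bigcup_measurable.
have mG n : measurable (G n) by apply: measurableI => //; exact: measurableD.
have GE : \bigcap_n G n = set0.
  apply/seteqP; split => // x Gx; have [_ [[i _ Fx] _]] := Gx 0%N I.
  by have [_ [_]] := Gx i I; apply.
have Gfin n : (m (G n) < +oo)%E.
  by apply: le_lt_trans Dfin; apply: le_measure; rewrite ?inE //; exact: subIsetl.
have niG : nonincreasing_seq G.
  move=> a b ab; apply/subsetPset => x [Dx [Ux nF]]; split => //; split => // Fa.
  by apply: nF; have /subsetPset := ndF _ _ ab; apply.
have := nonincreasing_cvg_mu (Gfin 0%N) mG _ niG.
rewrite GE measure0 => /(_ measurable0) /fine_cvgP [_ /cvgrPdist_lt /(_ _ e0) [n0 _ h]].
exists n0; have := h n0 (leqnn _); rewrite /= sub0r normrN => hn.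
rewrite -/(G n0) -[m _]fineK ?ge0_fin_numE // lte_fin.
exact: le_lt_trans (ler_norm _) hn.
Qed.

Definition symdiff A C := (A `\` C) `|` (C `\` A).

Lemma measurable_symdiff A C : measurable A -> measurable C -> measurable (symdiff A C).
Proof. by move=> mA mC; apply: measurableU; exact: measurableD. Qed.

(** The Borel sets that are, up to a set of arbitrarily small measure, unions
    of balls of a fixed radius form a sigma-algebra containing the open sets. *)
Lemma ball_approx D A : measurable D -> (m D < +oo)%E -> measurable A ->
  forall e : R, 0 < e -> exists k C, ball_inv k C /\
    (m (D `&` symdiff A C) < e%:E)%E.
Proof.
move=> mD Dfin; have mC k C : ball_inv k C -> measurable C by exact: measurable_ball_inv.
have sub1 X Y (e : R) : measurable X -> measurable Y -> X `<=` Y -> (m Y < e%:E)%E -> (m X < e%:E)%E.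
  by move=> mX mY XY; apply: le_lt_trans; apply: le_measure; rewrite ?inE.
have sub2 X Y Z (e : R) : measurable X -> measurable Y -> measurable Z -> X `<=` Y `|` Z ->
    (m Y < (e / 2)%:E)%E -> (m Z < (e / 2)%:E)%E -> (m X < e%:E)%E.
  move=> mX mY mZ XYZ hY hZ; apply: le_lt_trans (_ : (m Y + m Z < e%:E)%E).
    apply: le_trans (measureU2 _ mY mZ); apply: le_measure; rewrite ?inE //.
    exact: measurableU.
  by rewrite (splitr e) EFinD; exact: lteD.
move: A; apply: borel_ind => [U oU|A mA IH|F mF IH] e e0.
- pose V (n : nat) := [set x | bset (- n%:Z) x `<=` U].
  have Vi n : ball_inv (- n%:Z) (V n).
    move=> z w hw; rewrite /V /= (@bset_eq _ _ _ (z + w) z) //.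
    by rewrite addrAC subrr add0r.
  have UE : U = \bigcup_n V n.
    apply/seteqP; split => [x Ux|x [n _ Vx]]; last by apply: Vx; rewrite /bset /= subrr pball0.
    move: (oU); rewrite openE => /(_ _ Ux) /nbhs_bset [k kU].
    by exists `|k|%N => // y hy; apply: kU; apply: sub_bset hy; lia.
  have [||n hn] := @measure_union_tail D V e mD Dfin _ _ e0.
  + by move=> n; exact: mC (Vi n).
  + move=> a b ab; apply/subsetPset => x Vx y hy; apply: Vx; apply: sub_bset hy; lia.
  exists (- n%:Z), (V n); split => //; move: hn; rewrite -UE; apply: sub1.
  + apply: measurableI => //; apply: measurable_symdiff; last exact: mC (Vi n).
    exact: sub_sigma_algebra.
  + apply: measurableI => //; apply: measurableD; last exact: mC (Vi n).
    exact: sub_sigma_algebra.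
  + move=> x [Dx [//|[Vx nU]]]; exfalso; apply: nU; rewrite UE; by exists n.
- have [k [C [Ci hC]]] := IH e e0; exists k, (~` C); split.
    by move=> z w hw; rewrite /setC /= Ci.
  move: hC; congr (m (D `&` _) < _)%E; rewrite /symdiff !setDE !setCK.
  by rewrite setUC [C `&` _]setIC [A `&` _]setIC.
pose P A := forall e : R, 0 < e -> exists k C, ball_inv k C /\ (m (D `&` symdiff A C) < e%:E)%E.
have PU A B : measurable A -> measurable B -> P A -> P B -> P (A `|` B).
  move=> mA mB PA PB d d0; have d2 : 0 < d / 2 by lra.
  have [k [C [Ci hC]]] := PA _ d2; have [l [E [Ei hE]]] := PB _ d2.
  exists (Num.min k l), (C `|` E).
  have mCC := mC _ _ Ci; have mE := mC _ _ Ei; split.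
    move=> z w hw; rewrite /setU /= Ci ?Ei //; apply: pball_le hw; lia.
  apply: sub2 hC hE.
  - by apply: measurableI => //; apply: measurable_symdiff; apply: measurableU.
  - by apply: measurableI => //; apply: measurable_symdiff.
  - by apply: measurableI => //; apply: measurable_symdiff.
  - move=> x [Dx [[[Ax|Bx] nx]|[[Cx|Ex] nx]]].
    + by left; split => //; left; split => // Cx; apply: nx; left.
    + by right; split => //; left; split => // Ex; apply: nx; right.
    + by left; split => //; right; split => // Ax; apply: nx; left.
    + by right; split => //; right; split => // Bx; apply: nx; right.
pose G n := \big[setU/set0]_(i < n) F i.
have mG n : measurable (G n) by apply: bigsetU_measurable.
have PG n : P (G n).
  elim: n => [|n IHn]; rewrite /G ?big_ord0 ?big_ord_recr /=; last exact: (PU _ _ (mG n) (mF n) IHn (IH n)).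
  move=> d d0; exists 0, set0; split => //; rewrite /symdiff !set0D setU0 setI0.
  by rewrite measure0 lte_fin.
have GE : \bigcup_n G n = \bigcup_n F n.
  apply/seteqP; split => [x [n _]|x [n _ Fx]].
    by rewrite /G -bigcup_mkord => -[i _ Fi]; exists i.
  by exists n.+1 => //; rewrite /G -bigcup_mkord; exists n => /=.
have e2 : 0 < e / 2 by lra.
have [|n hn] := @measure_union_tail D G (e / 2) mD Dfin mG _ e2.
  by move=> a b ab; apply/subsetPset; exact: subset_bigsetU.
have [k [C [Ci hC]]] := PG n _ e2; exists k, C; split => //.
have mUF : measurable (\bigcup_n F n) by exact: bigcup_measurable.
rewrite GE in hn; apply: sub2 hn hC.
- by apply: measurableI => //; apply: measurable_symdiff => //; exact: mC Ci.
- by apply: measurableI => //; apply: measurableD.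
- by apply: measurableI => //; apply: measurable_symdiff => //; exact: mC Ci.
move=> x [Dx [[Ux nC]|[Cx nU]]].
  have [Gx|nG] := pselect (G n x); last by left.
  by right; split => //; left.
right; split => //; right; split => // Gx; apply: nU; rewrite -GE; by exists n.
Qed.

Hypothesis m_haar : is_haar m.

Lemma mball_ball_inv A C k z : ball_inv k C ->
  mball (A `&` C) k z = if `[< C z >] then mball A k z else 0.
Proof.
move=> Ci; rewrite /mball; case: asboolP => [Cz|nCz].
  congr (fine (m _)); rewrite -setIA; congr (_ `&` _); apply/seteqP; split => [x []|x hx] //.
  by split => //; rewrite (ball_invE Ci hx).
have -> : A `&` C `&` bset k z = set0 by apply/seteqP; split => x //= [[_ Cx] hx]; apply: nCz; rewrite -(ball_invE Ci hx).
by rewrite measure0.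
Qed.

(** Otherwise [m (A `&` C) <= t * m C] for all unions [C] of small balls. Within a
    large ball [A] is a limit of such unions by [ball_approx], and
    [m A <= t * m A] would follow. *)
Lemma density_ball A (t : R) k0 : measurable A -> (0 < m A)%E -> (m A < +oo)%E ->
  t < 1 -> exists k z, k <= k0 /\ t * mu k < mball A k z.
Proof.
move=> mA A0 Afin t1; apply: contrapT => /forallNP h0.
have h k z : k <= k0 -> mball A k z <= t * mu k.
  by move=> kk; rewrite leNgt; apply/negP => hlt; apply: (h0 k); exists z.
have t0 : 0 <= t.
  have := le_trans (mball_ge0 m A k0 0) (h k0 0 (lexx _)).
  by rewrite pmulr_lge0 // mu_gt0.
set M := fine (m A); have M0 : 0 < M by apply: fine_gt0; rewrite A0.
pose e := (1 - t) * M / 4; have e0 : 0 < e by rewrite divr_gt0 // mulr_gt0 // subr_gt0.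
have [n0 hn0] := mball_lim 0 mA Afin e0.
have mD := @measurable_bset p p_pr n0%:Z 0.
have [k1 [C [Ci1 hC]]] := ball_approx mD (bset_fin m_haar n0%:Z 0) mA e0.
pose k := Num.min k1 (Num.min k0 n0%:Z).
have Ci : ball_inv k C by apply: ball_inv_set_le Ci1; rewrite /k; lia.
have mC := measurable_ball_inv Ci.
have kk0 : k <= k0 by rewrite /k; lia.
have [n nE] : exists n : nat, n0%:Z = k + n%:Z by exists `|n0%:Z - k|%N; rewrite /k; lia.
have mAC : measurable (A `&` C) by exact: measurableI.
have step1 : mball (A `&` C) n0%:Z 0 <= t * mball C n0%:Z 0.
  rewrite nE !mball_bsum // -bsum_scal; apply: ler_bsum => z.
  rewrite -[X in mball X k z <= _ * _]setIid setIAC setIA -[C in _ * mball C _ _]setTI.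
  rewrite setIid !mball_ball_inv //; case: asboolP => _; last by rewrite mulr0.
  by rewrite mballT // h.
have sd X Y : measurable X -> measurable Y -> X `<=` Y `|` symdiff A C ->
    mball X n0%:Z 0 <= mball Y n0%:Z 0 + e.
  move=> mX mY XY; have mS := measurable_symdiff mA mC.
  have hS : mball (symdiff A C) n0%:Z 0 <= e.
    by rewrite -lee_fin -mballE // setIC ltW.
  apply: le_trans (lerD (lexx _) hS).
  rewrite -lee_fin EFinD -!mballE //.
  have mb := @measurable_bset p p_pr n0%:Z 0.
  apply: le_trans (measureU2 _ _ _); [|exact: measurableI|exact: measurableI].
  rewrite -setIUl; apply: le_measure; rewrite ?inE; [exact: measurableI| |exact: setSI].
  by apply: measurableI => //; exact: measurableU.
have hA : mball A n0%:Z 0 <= mball (A `&` C) n0%:Z 0 + e.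
  apply: sd => // x Ax; have [Cx|nC] := pselect (C x); first by left.
  by right; left.
have hC' : mball C n0%:Z 0 <= mball A n0%:Z 0 + e.
  apply: sd => // x Cx; have [Ax|nA] := pselect (A x); first by left.
  by right; right.
have h1 := hn0 n0%:Z (lexx _); have h2 := mball_leM m_haar n0%:Z 0 mA Afin.
rewrite -/M in h1 h2.
have h3 : t * mball C n0%:Z 0 <= t * (M + e).
  by apply: ler_wpM2l => //; apply: le_trans hC' _; rewrite lerD2r.
have h4 : t * e <= e by rewrite ler_piMl ?ltW.
have eE : 4 * e = M - t * M by rewrite /e; field.
have : M - e <= t * M + t * e + e.
  apply: le_trans h1 _; apply: le_trans hA _; rewrite lerD2r.
  by apply: le_trans step1 _; apply: le_trans h3 _; rewrite mulrDr.
by lra.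
Qed.

Lemma mball_equidist A s n : measurable A ->
  (forall k, k < s -> ball_inv (k + 1) (mball A k)) ->
  ball_inv s (mball A (s - n%:Z)).
Proof.
move=> mA h; elim: n => [|n IH]; first by rewrite subr0; exact: mball_inv.
have h1 := h (s - n.+1%:Z) ltac:(lia).
have e : s - n.+1%:Z + 1 = s - n%:Z by lia.
have e1 z : mball A (s - n%:Z) z = p%:R * mball A (s - n.+1%:Z) z.
  rewrite -e -[1]/(1%N%:Z) mball_bsum // (bsum_const (c := mball A (s - n.+1%:Z) z)).
    by rewrite expn1 mulr_natl.
  by move=> w hw; rewrite h1.
move=> z w hw; apply: (mulfI (pR_neq0 p_pr R)).
by rewrite -!e1 IH.
Qed.

(** Equidistribution gives all balls of a given small level in the ball around [z]
    the same density, the one of that ball; [density_ball] finds one in which [A]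
    is denser if this density is neither 0 nor 1. *)
Lemma null_or_full A s z : measurable A ->
  (forall k, k < s -> ball_inv (k + 1) (mball A k)) ->
  mball A s z = 0 \/ mball A s z = mu s.
Proof.
move=> mA h; have [->|nz] := eqVneq (mball A s z) 0; first by left.
right; apply/eqP; rewrite eq_le mball_mu //= leNgt; apply/negP => lt.
have A0 : 0 < mball A s z by rewrite lt_def nz mball_ge0.
have mb := @measurable_bset p p_pr s z; have mAb := measurableI _ _ mA mb.
have [|||k [y [ks hy]]] := @density_ball (A `&` bset s z) (mball A s z / mu s) s mAb.
- by rewrite mballE // lte_fin.
- by rewrite mballE // ltry.
- by rewrite ltr_pdivrMr ?mul1r // mu_gt0.
move: hy; rewrite mball_ball_inv; last by apply: ball_inv_set_le ks _; exact: bset_inv.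
have t0 : 0 <= mball A s z / mu s * mu k.
  by rewrite mulr_ge0 ?mu_ge0 // divr_ge0 ?mu_ge0 // ltW.
case: asboolP => [yz|_]; last by rewrite ltNge t0.
have [n nE] : exists n : nat, k = s - n%:Z by exists `|s - k|%N; lia.
have hi := mball_equidist n mA h; rewrite nE (ball_invE hi yz).
have e : s = k + n%:Z by lia.
rewrite -nE {1 2}e mball_bsum // (bsum_const (c := mball A k z)); last first.
  by move=> w hw; rewrite nE hi // e.
have p0 : (p ^ n)%:R != 0 :> R by rewrite pnatr_eq0 -lt0n expp_gt0.
have mu0 : mu k != 0 by rewrite gt_eqF // mu_gt0.
rewrite muX // -[_ *+ (p ^ n)%N]mulr_natl (_ : _ * _ = mball A k z) ?ltxx //.
by field; rewrite p0 mu0.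
Qed.

End Regularity.

(** * Homogeneous sets and counting *)

Section Homogeneous.
Variables (p : nat) (p_pr : prime p).
Local Notation Qp := (padic p_pr).
Local Notation ppow := (@ppow p p_pr).
Local Notation bset := (@bset p p_pr).
Implicit Types (x y z w t : Qp) (k l s e : int) (n i : nat) (A H T : set Qp).

(** Finite unions of balls of equal radius whose tree of balls branches level by
    level: if some ball of level [k + 1] has two children that meet [H], then all
    the children of all the balls of level [k + 1] that meet [H] do so. *)
Definition homogeneous H : Prop :=
  [/\ H !=set0, exists s, ball_inv s H,
      exists e, forall x y, H x -> H y -> pball e (x - y) &
      forall k x y, H x -> H y -> psphere k (x - y) ->
        forall z w, H z -> pball (k + 1) w -> exists2 t, H t & pball k (z + w - t)].

Definition separated s T : Prop :=
  forall t t', T t -> T t' -> pball s (t - t') -> t = t'.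

Lemma separated_le k s T : k <= s -> separated s T -> separated k T.
Proof. by move=> ks h t t' Tt Tt' tt'; apply: h => //; apply: pball_le tt'. Qed.

(** [cnt T s n z] counts the balls of level [s] in the ball of level [s + n] around
    [z] that meet [T]; for a [T] that is separated at level [s], these are its
    points in this ball. *)
Definition meets T s z : nat := nat_of_bool `[< exists2 t, T t & pball s (t - z) >].
Definition cnt T s n z : nat := bsum s n (meets T s) z.

Lemma meets_inv T s : ball_inv s (meets T s).
Proof.
move=> z w hw; rewrite /meets; congr (nat_of_bool (asbool _)); apply/propext.
have e t : pball s (t - (z + w)) = pball s (t - z).
  by rewrite opprD addrA (@pballDr _ _ s (t - z) (- w)) // pballN.
by split => -[t Tt ht]; exists t => //; rewrite ?e // -e.
Qed.

Lemma meets_le1 T s z : (meets T s z <= 1)%N.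
Proof. exact: leq_b1. Qed.

Lemma meetsT T s t : T t -> meets T s t = 1%N.
Proof.
move=> Tt; rewrite /meets asboolT //; exists t => //.
by rewrite subrr pball0.
Qed.

Lemma cnt_inv T s n : ball_inv (s + n%:Z) (cnt T s n).
Proof. exact/bsum_inv/meets_inv. Qed.

Lemma cnt_le T s n z : (cnt T s n z <= p ^ n)%N.
Proof.
rewrite /cnt /bsum (@leq_trans (\sum_(j < p ^ n) 1)) //.
  by apply: leq_sum => j _; exact: meets_le1.
by rewrite sum1_card card_ord.
Qed.

Lemma cnt0 T s z : cnt T s 0 z = meets T s z.
Proof. exact: bsum0. Qed.

Lemma cntD T s n i z : cnt T s (n + i) z = bsum (s + n%:Z) i (cnt T s n) z.
Proof. exact: bsum_comp. Qed.

Lemma bsum1_const (V : nmodType) s (f : Qp -> V) z : ball_inv (s + 1) f ->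
  bsum s 1 f z = f z *+ p.
Proof. by move=> fi; rewrite (bsum_const (c := f z)) ?expn1 // => w /fi. Qed.

Lemma cntS_inv T s n z : ball_inv (s + n%:Z + 1) (cnt T s n) ->
  cnt T s n.+1 z = (p * cnt T s n z)%N.
Proof.
by move=> h; rewrite -addn1 cntD bsum1_const // -mulr_natl natn.
Qed.

Lemma cntS_ge T s n z : (cnt T s n z <= cnt T s n.+1 z)%N.
Proof.
rewrite -addn1 cntD /bsum (bigD1 (Ordinal (expp_gt0 p_pr 1))) //=.
by rewrite mul0r addr0 leq_addr.
Qed.

(** The count at level [s + n + i] is then [p ^ i] times the one at level [s + n],
    so that the latter is invariant under balls of every level. *)
Lemma cnt_const T s n : (forall i, (n <= i)%N -> ball_inv (s + i%:Z + 1) (cnt T s i)) ->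
  forall z z', cnt T s n z = cnt T s n z'.
Proof.
move=> h z z'.
have key i : ball_inv (s + (n + i)%N%:Z) (cnt T s n) /\
    forall z, cnt T s (n + i) z = (p ^ i * cnt T s n z)%N.
  elim: i => [|i [IH1 IH2]].
    by rewrite addn0; split => [|y]; [exact: cnt_inv|rewrite expn0 mul1n].
  split => [y w hw|y]; last first.
    by rewrite addnS cntS_inv ?IH2 ?expnS ?mulnA //; apply: h; exact: leq_addr.
  have := h (n + i)%N (leq_addr _ _) y w.
  rewrite !IH2 (_ : s + (n + i)%N%:Z + 1 = s + (n + i.+1)%N%:Z); last by lia.
  by move=> /(_ hw) /eqP; rewrite eqn_pmul2l ?expp_gt0 // => /eqP.
have [m hm] := pball_ex (z - z').
rewrite -(subrK z' z) addrC; have [+ _] := key (m + `|s|)%N; apply.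
by apply: hm; lia.
Qed.

(** The number of leaves of a tree of height [n] that branches [p]-fold at the
    levels in [J] only. *)
Definition wgt (J : nat -> bool) n : nat := (\prod_(i < n) (if J i then p else 1))%N.

Lemma wgt_gt0 J n : (0 < wgt J n)%N.
Proof. by apply: prodn_gt0 => i; case: ifP => // _; exact: prime_gt0. Qed.

Lemma wgtS J n : wgt J n.+1 = (wgt J n * (if J n then p else 1))%N.
Proof. by rewrite /wgt big_ord_recr. Qed.

Lemma wgt_compl J n : (wgt J n * wgt (fun i => ~~ J i) n = p ^ n)%N.
Proof.
elim: n => [|n IH]; first by rewrite /wgt !big_ord0.
by rewrite !wgtS mulnACA IH expnS mulnC; case: (J n); rewrite ?muln1 ?mul1n.
Qed.

(** Passing to the next level multiplies the count by [p] at the levels in [J], and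
    does not decrease it at the other ones. *)
Lemma cnt_wgt T s (J : nat -> bool) n t :
  (forall i, (i < n)%N -> J i -> ball_inv (s + i%:Z + 1) (cnt T s i)) ->
  T t -> (wgt J n <= cnt T s n t)%N.
Proof.
move=> h Tt; elim: n h => [|n IH] h.
  by rewrite cnt0 meetsT // /wgt big_ord0.
have {}IH : (wgt J n <= cnt T s n t)%N by apply: IH => i hi; apply: h; exact: ltnW.
rewrite wgtS; case: ifP => Jn.
  by rewrite cntS_inv ?[(p * _)%N]mulnC ?leq_mul2r ?IH ?orbT //; apply: h.
by rewrite muln1; apply: leq_trans IH _; exact: cntS_ge.
Qed.

(** Equidistribution would put a point of [T] in each of the [p] children of the
    ball of level [k + 1] around [t]; as [k + 1 <= s], the points of [T] in this ball
    are all equal to [t]. *)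
Lemma separated_unbalanced T s k t : separated s T -> T t -> k < s ->
  ~ ball_inv (k + 1) (meets T k).
Proof.
move=> sT Tt ks h; have := h t (ppow (k + 1)).
rewrite pball_ppow lexx (meetsT k Tt) => /(_ isT).
rewrite /meets; case: asboolP => // -[t' Tt' ht'] _.
have tt' : t' = t.
  apply: sT => //; rewrite (_ : t' - t = (t' - (t + ppow (k + 1))) + ppow (k + 1)); last by ring.
  by apply: pballD; [apply: pball_le ht'|rewrite pball_ppow]; lia.
move: ht'; rewrite tt' opprD addrA subrr add0r pballN pball_ppow; lia.
Qed.

Lemma bsum_opp (V : nmodType) s n (f : Qp -> V) z : ball_inv s f ->
  bsum s n (fun x => f (- x)) z = bsum s n f (- z).
Proof.
move=> fi; rewrite /bsum; set u := ppow (s + n%:Z).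
rewrite -(@periodic_sum _ (fun j => f (- z + j%:R * u)) (p ^ n) _ 1); last first.
  move=> j; apply: (ball_invE fi).
  rewrite (_ : _ - _ = (p ^ n)%:R * u); last by rewrite natrD; ring.
  by rewrite pball_natu dvdnn.
rewrite (reindex_inj rev_ord_inj) /=; apply: eq_bigr => j _.
rewrite (_ : - (z + (p ^ n - j.+1)%N%:R * u) = (- z + (j + 1)%N%:R * u) - (p ^ n)%:R * u).
  by rewrite fi // pballN pball_natu dvdnn.
by rewrite natrB ?ltn_ord // addn1; ring.
Qed.

End Homogeneous.

Section HomogeneousMeasure.
Variables (R : realType) (p : nat) (p_pr : prime p).
Local Notation Qp := (padic p_pr).
Variables (m : {measure set Qp -> \bar R}) (m_haar : is_haar m).
Local Notation ppow := (@ppow p p_pr).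
Local Notation bset := (@bset p p_pr).
Local Notation mball := (mball m).
Local Notation mu := (mu m).
Implicit Types (x y z w t : Qp) (k l s e : int) (n i : nat) (A B H T : set Qp).

Definition aeq A B : Prop := m (A `\` B) = 0%E /\ m (B `\` A) = 0%E.

Lemma null_of_balls A s : measurable A -> (forall z, mball A s z = 0) -> m A = 0%E.
Proof.
move=> mA h; apply/negligibleP => //.
have -> : A = \bigcup_n (A `&` bset (s + n%:Z) 0).
  by rewrite -setI_bigcupr bset_bigcup setIT.
apply: negligible_bigcup => n; apply/negligibleP.
  by apply: measurableI => //; exact: measurable_bset.
apply: (etrans (mballE m_haar (s + n%:Z) 0 mA)); rewrite mball_bsum //.
by rewrite (bsum_const (c := 0)) ?mul0rn // => w _; exact: h.
Qed.

Lemma mball_disj A k x y : measurable A -> (m A < +oo)%E -> ~~ pball k (x - y) ->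
  mball A k x + mball A k y <= fine (m A).
Proof.
move=> mA Afin xy; rewrite -lee_fin EFinD -!mballE // fineK ?ge0_fin_numE //.
have mb z := measurableI _ _ mA (@measurable_bset p p_pr k z).
rewrite -measureU //; last by rewrite setIACA bset_disj // setI0.
by apply: le_measure; rewrite ?inE //; [exact: measurableU|move=> z [] []].
Qed.

Lemma mball_le_level A k n z : measurable A -> mball A k z <= mball A (k + n%:Z) z.
Proof.
move=> mA; rewrite -lee_fin -!mballE //; apply: le_measure; rewrite ?inE.
- by apply: measurableI => //; exact: measurable_bset.
- by apply: measurableI => //; exact: measurable_bset.
- by apply: setIS; apply: sub_bset; lia.
Qed.

Lemma mball_shift A k z t : measurable A -> mball [set x | A (x - t)] k z = mball A k (z - t).
Proof.
move=> mA; rewrite /mball; congr fine.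
rewrite (_ : _ `&` _ = [set x | (A `&` bset k (z - t)) (x - t)]).
  by rewrite measure_shift //; apply: measurableI => //; exact: measurable_bset.
by apply/seteqP; split => x [Ax hx]; split => //; move: hx; rewrite bset_sub.
Qed.

(** Both differences are null in each ball of level [s]. *)
Lemma aeq_full A s : measurable A ->
  (forall z, mball A s z = 0 \/ mball A s z = mu s) ->
  aeq A [set z | mball A s z != 0].
Proof.
move=> mA h; set H := [set z | _].
have Hi : ball_inv s H by move=> z w hw; rewrite /H /= mball_inv.
have mH := measurable_ball_inv Hi; split.
  apply: (@null_of_balls _ s) => [|z]; first exact: measurableD.
  rewrite setDE mball_ball_inv; last by move=> y w hw; rewrite /setC /= Hi.
  by case: asboolP => //; rewrite /setC /H /= => /negP; rewrite negbK => /eqP.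
apply: (@null_of_balls _ s) => [|z]; first exact: measurableD.
rewrite setDE setIC mball_ball_inv //; case: asboolP => // Hz.
have := mballU m_haar s z mA (measurableC mA) (setICr A).
rewrite setUCr mballT //; case: (h z) => [e|->]; first by rewrite /H /= e eqxx in Hz.
by move/eqP; rewrite -subr_eq0 opprD addrA subrr sub0r oppr_eq0 => /eqP.
Qed.

End HomogeneousMeasure.

(** * Tiles are homogeneous *)

Section Tile.
Variables (R : realType) (p : nat) (p_pr : prime p).
Local Notation Qp := (padic p_pr).
Variables (m : {measure set Qp -> \bar R}) (m_haar : is_haar m).
Local Notation ppow := (@ppow p p_pr).
Local Notation bset := (@bset p p_pr).
Local Notation mball := (mball m).
Local Notation mu := (mu m).
Local Notation C := (R[i]).
Local Notation RtoC := (real_complex R).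
Local Notation cabs := (@ComplexField.Normc.normc R).
Implicit Types (x y z w t : Qp) (k l s e : int) (n i : nat) (A B H : set Qp).
Variables (Omega T : set Qp).
Hypothesis mOmega : measurable Omega.
Hypothesis Omega_gt0 : (0 < m Omega)%E.
Hypothesis Omega_fin : (m Omega < +oo)%E.
Hypothesis tile :
  {ae m, forall x, (\esum_(t in T) (\1_Omega (x - t))%:E = 1 :> \bar R)%E}.

Let M := fine (m Omega).

Let tile_gt0 : 0 < M.
Proof. by rewrite fine_gt0 // Omega_gt0. Qed.

(** A sum of zeros and ones has the value 1 only if exactly one term is 1. *)
Lemma tile_points : exists N, [/\ measurable N, m N = 0%E &
  forall x, ~ N x -> (exists2 t, T t & Omega (x - t)) /\
    forall t t', T t -> T t' -> Omega (x - t) -> Omega (x - t') -> t = t'].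
Proof.
have [N [mN N0 hN]] := tile; exists N; split => // x nNx.
have {hN} e1 : (\esum_(t in T) (\1_Omega (x - t))%:E = 1 :> \bar R)%E.
  by apply: contrapT => h; apply: nNx; apply: hN.
split.
  apply: contrapT => h; have e0 : (\esum_(t in T) (\1_Omega (x - t))%:E = 0 :> \bar R)%E.
    apply: esum1 => t Tt; rewrite indicE memNset // => Ot.
    by apply: h; exists t.
  by have /eqP := e1; rewrite e0 eq_sym onee_eq0.
move=> t t' Tt Tt' Ot Ot'; apply: contrapT => tt'.
have : (2%:E <= \esum_(t in T) (\1_Omega (x - t))%:E :> \bar R)%E.
  apply: esum_ge; exists ([set t] `|` [set t']).
    split; first by rewrite finite_setU; split; exact: finite_set1.
    by move=> y [->|->].
  rewrite fsbigU0 /=; [|exact: finite_set1|exact: finite_set1|]; last first.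
    by move=> y [-> e]; apply: tt'.
  by rewrite !fsbig_set1 !indicE !mem_set //= -EFinD lee_fin.
by rewrite e1 -[1%E]/(1%:E) lee_fin; lra.
Qed.

Lemma mball_diff_null A N k z : measurable A -> measurable N -> m N = 0%E ->
  mball (A `\` N) k z = mball A k z.
Proof.
move=> mA mN N0; have mb := @measurable_bset p p_pr k z.
have -> : mball A k z = fine (m (A `&` bset k z `\` N) + m (A `&` bset k z `&` N))%E.
  by congr fine; apply: measureDI => //; exact: measurableI.
have -> : m (A `&` bset k z `&` N) = 0%E.
  apply/eqP; rewrite eq_le measure_ge0 andbT -N0; apply: le_measure; rewrite ?inE //.
  by apply: measurableI => //; exact: measurableI.
by rewrite adde0 /mball !setDE setIAC.
Qed.

(** Take for [s] the level of a ball that the tile fills to more than one half: if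
    two points of [T] were in the same ball of level [s], their translates of the
    tile would overlap in a set of positive measure. *)
Lemma tile_separated : exists s, separated s T.
Proof.
have [N [mN N0 hN]] := tile_points.
have [|s [z [_ hz]]] := density_ball m_haar (t := 1 / 2) 0 mOmega Omega_gt0 Omega_fin; first by lra.
exists s => t t' Tt Tt' tt'; apply: contrapT => ntt'.
pose O t := [set x | Omega (x - t)] `\` N.
have mO u : measurable (O u) by apply: measurableD => //; exact: measurable_shift.
have hO u : mball (O u) s (z + u) = mball Omega s z.
  rewrite mball_diff_null //; last exact: measurable_shift.
  by rewrite (mball_shift m_haar) // addrK.
have e : mball (O t') s (z + t) = mball Omega s z.
  rewrite -(hO t'); apply: (ball_invE (@mball_inv _ _ _ m (O t') s)).
  by rewrite opprD addrACA subrr add0r.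
have := mball_mu m_haar s (z + t) (measurableU _ _ (mO t) (mO t')).
rewrite mballU //; last first.
  by apply/seteqP; split => x //= -[[Ot nN] [Ot' _]]; apply: ntt'; apply: (hN x nN).2.
by rewrite hO e; move: hz; set a := mball _ _ _; set b := mu s; lra.
Qed.

Section Level.
Variables (s : int) (N : set Qp).
Hypothesis sepT : separated s T.
Hypothesis mN : measurable N.
Hypothesis N0 : m N = 0%E.
Hypothesis cover : forall x, ~ N x -> exists2 t, T t & Omega (x - t).
Hypothesis packing : forall x, ~ N x -> forall t t', T t -> T t' ->
  Omega (x - t) -> Omega (x - t') -> t = t'.

(* without the null set N, the translates are disjoint *)
Let O t := [set x | Omega (x - t)] `\` N.

Let mO t : measurable (O t).
Proof. by apply: measurableD => //; exact: measurable_shift. Qed.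

(* the union of the translates by the points of T in the ball of level s + n *)
Let cell n j := if meets T s (j%:R * ppow (s + n%:Z)) == 1%N then
  O (xget 0 [set t | T t /\ pball s (t - j%:R * ppow (s + n%:Z))]) else set0.
Let part n := \big[setU/set0]_(j < p ^ n) cell n j.

Let mcell n j : measurable (cell n j).
Proof. by rewrite /cell; case: ifP. Qed.

Let mpart n : measurable (part n).
Proof. by apply: bigsetU_measurable => j _. Qed.

Let cellP n j x : cell n j x ->
  exists t, [/\ T t, pball s (t - j%:R * ppow (s + n%:Z)) & O t x].
Proof.
rewrite /cell /meets; case: asboolP => //= -[t Tt ht].
by case: xgetP => [y _ [Ty hy] Oy|/(_ t)]; [exists y|case; split].
Qed.

Let partP n x : part n x <-> exists t, [/\ T t, pball (s + n%:Z) t & O t x].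
Proof.
rewrite /part -(bigcup_mkord _ (cell n)); split.
  move=> [j _ /cellP [t [Tt ht Ox]]]; exists t; split => //.
  rewrite -(subrK (j%:R * ppow (s + n%:Z)) t); apply: pballD; last by rewrite pball_natM.
  by apply: pball_le ht; lia.
move=> [t [Tt ht Ox]]; have [j jn hj] := pball_rep ht.
exists j => //; rewrite /cell /meets asboolT /=; last by exists t.
case: xgetP => [y _ [Ty hy]|/(_ t)]; last by case; split.
suff -> : y = t by [].
by apply: sepT => //; apply: pball_trans hy _; rewrite pball_sym.
Qed.

Lemma partial_tilingE k n x : s <= k ->
  bsum s n (fun z => (meets T s z)%:R * mball Omega k (x - z)) 0 = mball (part n) k x.
Proof.
move=> sk; have mb := @measurable_bset p p_pr k x.
have cE j : m (cell n j `&` bset k x) =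
  ((meets T s (0 + j%:R * ppow (s + n%:Z)))%:R * mball Omega k (x - (0 + j%:R * ppow (s + n%:Z))))%:E.
  rewrite add0r /cell; case: eqP => [e|ne]; last first.
    rewrite set0I measure0; suff -> : meets T s (j%:R * ppow (s + n%:Z)) = 0%N by rewrite mul0r.
    by move: ne; rewrite /meets; case: asboolP.
  rewrite e mul1r; case: xgetP => [y _ [Ty hy]|no]; last first.
    move: e; rewrite /meets; case: asboolP => //= -[t Tt ht] _.
    by case: (no t).
  rewrite mballE // mball_diff_null // ?(mball_shift m_haar) //; last exact: measurable_shift.
  congr (_%:E); apply: (ball_invE (@mball_inv _ _ _ m Omega k)).
  rewrite opprD opprK addrACA subrr add0r addrC pball_sym; apply: pball_le hy.
  exact: sk.
have : m (part n `&` bset k x) = (\sum_(j < p ^ n) m (cell n j `&` bset k x))%E.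
  rewrite /part big_distrl /= measure_semi_additive_ord //.
  - by move=> j; exact: measurableI.
  - apply/trivIsetP => i j _ _ ij; apply/seteqP; split => y //= -[[ci _] [cj _]].
    have [t [Tt ht [Ot nN]]] := cellP ci; have [t' [Tt' ht' [Ot' _]]] := cellP cj.
    have tt' := packing nN Tt Tt' Ot Ot'; subst t'.
    move/negP: ij; apply; apply/eqP/val_inj; apply: (@pball_rep_uniq p p_pr s n _ _ (ltn_ord i) (ltn_ord j)).
    by apply: (@pball_trans _ _ _ t) => //; rewrite pball_sym.
  - by apply: bigsetU_measurable => j _; exact: measurableI.
rewrite mballE // (eq_bigr _ (fun (j : 'I_(p ^ n)) _ => cE j)) sumEFin.
by move=> -[->].
Qed.

(** The translates by the points of [T] in larger and larger balls exhaust the ball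
    of level [k] around [x]. This is the tiling property as a convolution
    equation: the counting function of [T] convolved with the local measure of
    the tile is the constant [mu k]. *)
Lemma partial_tiling k x (e : R) : s <= k -> 0 < e ->
  exists n0, forall n, (n0 <= n)%N ->
    mu k - e <= bsum s n (fun z => (meets T s z)%:R * mball Omega k (x - z)) 0 <= mu k.
Proof.
move=> sk e0; have mb := @measurable_bset p p_pr k x.
have ndp : nondecreasing_seq part.
  move=> a b ab; apply/subsetPset => y /partP [t [Tt ht Ot]]; apply/partP.
  by exists t; split => //; apply: pball_le ht; lia.
have [n0 h0] := measure_union_tail mb (bset_fin m_haar k x) mpart ndp e0.
exists n0 => n nn; rewrite partial_tilingE //.
apply/andP; split; last exact: (mball_mu m_haar).
rewrite lerBlDr; apply: (@le_trans _ _ (mball (part n0) k x + e)); last first.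
  rewrite lerD2r; apply: (mball_le m_haar) => //.
  by apply/subsetPset; apply: ndp.
have mU : measurable (\bigcup_i part i) by exact: bigcup_measurable.
rewrite -lee_fin EFinD -(mballE m_haar) // -(m_bset m_haar k x).
pose X := bset k x `&` (\bigcup_i part i `\` part n0).
have mX : measurable X by apply: measurableI => //; exact: measurableD.
apply: (@le_trans _ _ (m ((part n0 `&` bset k x) `|` (X `|` N)))).
  apply: le_measure; rewrite ?inE //.
    by apply: measurableU; [exact: measurableI|exact: measurableU].
  move=> y hy; have [Ny|nN] := pselect (N y); first by right; right.
  have [t Tt Ot] := cover nN; have [i hi] := pball_ex t.
  have [pn|np] := pselect (part n0 y); first by left.
  right; left; split => //; split => //; exists (i + `|s|)%N => //; apply/partP.
  by exists t; split => //; apply: hi; lia.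
apply: le_trans (measureU2 _ _ _) _; [exact: measurableI|exact: measurableU|].
rewrite leeD2l //; have : (m (X `|` N) <= m X + m N)%E by exact: measureU2.
by rewrite N0 adde0 => /le_trans; apply; rewrite ltW.
Qed.

(** By [partial_tiling] the function [z |-> mball Omega k (- z)] has a constant
    convolution with the counting function of [T]. So [cnt T s n] annihilates the
    difference [a] between [p] times this function and its sum over the ball of
    level [k + 1], and [convolution_dichotomy] applies. That [a] vanishes means
    that the tile is equidistributed in the balls of level [k + 1]. *)
Lemma tile_dichotomy n : let k := s + n%:Z in
  ball_inv (k + 1) (cnt T s n) \/ ball_inv (k + 1) (mball Omega k).
Proof.
move=> k; pose f := mball Omega k.
have fi : ball_inv k f by exact: mball_inv.
pose a z : C := RtoC (p%:R * f (- z) - bsum k 1 f (- z)).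
have [[x ax]|na] := pselect (exists x, a x != 0); last first.
  right; have fE z : p%:R * f z = bsum k 1 f z.
    apply/eqP; rewrite -subr_eq0; apply/eqP; apply: contrapT => h.
    apply: na; exists (- z); rewrite /a opprK; apply/eqP => e; apply: h.
    by have := congr1 (@complex.Re R) e.
  move=> z w hw; apply: (mulfI (pR_neq0 p_pr R)); rewrite !fE.
  by rewrite (bsum_inv fi).
left; have fN n' z : bsum k n' (fun x => f (- x)) z = bsum k n' f (- z) by exact: bsum_opp.
have fle n' z : bsum k n' f z <= M.
  by rewrite -(mball_bsum m_haar) //; exact: (mball_leM m_haar).
have b1i : ball_inv k (bsum k 1 f).
  by apply: ball_inv_le (bsum_inv fi); lia.
have b1E n' z : bsum k n' (bsum k 1 f) z = \sum_(j < p ^ 1) bsum k n' f (z + j%:R * ppow (k + 1%N%:Z)).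
  by rewrite /(bsum k 1 f) bsum_sum; apply: eq_bigr => j _; rewrite bsum_shift.
have ai : ball_inv k a.
  by move=> z w hw; rewrite /a opprD fi ?pballN // b1i ?pballN.
apply: (@convolution_dichotomy p p_pr R k (cnt T s n) a (p ^ n) (p%:R * M + p%:R * M)).
- exact: cnt_inv.
- exact: cnt_le.
- exact: ai.
- move=> z; rewrite /a /bsum -rmorph_sum sumrB -mulr_sumr.
  have -> : \sum_(j < p ^ 1) f (- (z + j%:R * ppow (k + 1%N%:Z))) = bsum k 1 f (- z) by rewrite -fN.
  rewrite (eq_bigr (fun=> bsum k 1 f (- z))) => [|j _]; last first.
    rewrite -[LHS]/(bsum k 1 f (- (z + j%:R * ppow (k + 1%N%:Z)))).
    by rewrite opprD (bsum_inv fi) // pballN pball_natM.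
  by rewrite sumr_const card_ord expn1 mulr_natl subrr.
- move=> n' z; apply: (@le_trans _ _ (bsum k n' (fun x => p%:R * f (- x) + bsum k 1 f (- x)) z)).
    apply: ler_bsum => x0; rewrite /a /= expr0n addr0 sqrtr_sqr.
    have f0 : 0 <= p%:R * f (- x0) by rewrite mulr_ge0 // mball_ge0.
    have b0 : 0 <= bsum k 1 f (- x0) by apply: bsum_ge0 => ?; exact: mball_ge0.
    by rewrite ler_norml; apply/andP; split; lra.
  rewrite bsumD bsum_scal fN (bsum_opp _ _ b1i) b1E; apply: lerD.
    by rewrite ler_wpM2l.
  rewrite mulr_natl -[X in _ *+ X](expn1 p) -[X in _ <= _ *+ X]card_ord -sumr_const.
  by apply: ler_sum => j _.
- move=> y e e0; have sk : s <= k by rewrite /k; lia.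
  have p0 : 0 < p%:R :> R by rewrite ltr0n prime_gt0.
  pose S n' x := bsum s n' (fun z => (meets T s z)%:R * mball Omega k (x - z)) 0.
  pose d := e / (2 * p%:R); have d0 : 0 < d by rewrite divr_gt0 // mulr_gt0.
  have [n1 h1] := partial_tiling y sk d0.
  have [g hg] : exists g : nat -> nat, forall j n' : nat, (g j <= n')%N ->
     mu k - d <= S n' (y + j%:R * ppow (k + 1%N%:Z)) <= mu k.
    suff /choice [g h] : forall j : nat, exists g, forall n', (g <= n')%N ->
       mu k - d <= S n' (y + j%:R * ppow (k + 1%N%:Z)) <= mu k by exists g.
    by move=> j; exact: partial_tiling.
  exists (maxn n1 (\max_(j < p ^ 1) g j)) => n' hn.
  have -> : bsum k n' (fun z => (cnt T s n z)%:R * a (z - y)) 0 =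
    RtoC (p%:R * S (n + n')%N y - \sum_(j < p ^ 1) S (n + n')%N (y + j%:R * ppow (k + 1%N%:Z))).
    have e1 z : (cnt T s n z)%:R * a (z - y) = bsum s n (fun z => (meets T s z)%:R * a (z - y)) z.
      transitivity (bsum s n (fun u => a (u - y) * (meets T s u)%:R) z); last first.
        by apply: eq_bsum => u; rewrite mulrC.
      rewrite (bsum_mull _ _ (g := fun u => a (u - y))); first by rewrite -bsum_nat_eq mulrC.
      by move=> u w hw; rewrite addrAC; exact: ai.
    rewrite (eq_bsum _ _ _ e1) -bsum_comp.
    have e2 z : (meets T s z)%:R * a (z - y) =
        RtoC ((meets T s z)%:R * (p%:R * f (y - z) - bsum k 1 f (y - z))).
      by rewrite /a opprB rmorphM /= rmorph_nat.
    rewrite (eq_bsum _ _ _ e2) /bsum -rmorph_sum; congr RtoC.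
    rewrite /S /bsum mulr_sumr exchange_big /= -sumrB; apply: eq_bigr => j _.
    rewrite mulrBr mulrCA mulr_sumr; congr (_ - _); apply: eq_bigr => i _.
    by rewrite addrAC.
  have [hn1 hn2] : (n1 <= n + n')%N /\ forall j : 'I_(p ^ 1), (g j <= n + n')%N.
    move: hn; rewrite geq_max => /andP [n1n gn]; split; first by lia.
    move=> j; apply: (leq_trans _ (leq_addl n n')); apply: leq_trans gn.
    exact: (leq_bigmax (F := fun j : 'I_(p ^ 1) => g j) j).
  have /andP [l1 l2] := h1 _ hn1.
  set S1 := \sum_(_ < _) _.
  have u2 : S1 <= p%:R * mu k.
    rewrite mulr_natl -[X in _ *+ X](expn1 p) -[X in _ <= _ *+ X]card_ord -sumr_const.
    by apply: ler_sum => j _; have /andP [] := hg j _ (hn2 j).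
  have u1 : p%:R * (mu k - d) <= S1.
    rewrite mulr_natl -[X in _ *+ X](expn1 p) -[X in _ *+ X <= _]card_ord -sumr_const.
    by apply: ler_sum => j _; have /andP [] := hg j _ (hn2 j).
  have l1' := ler_wpM2l (ltW p0) l1; have l2' := ler_wpM2l (ltW p0) l2.
  have pd : p%:R * d = e / 2 by rewrite /d; field; rewrite gt_eqF.
  rewrite /= expr0n addr0 sqrtr_sqr ler_norml.
  move: l1' l2' u1 u2; rewrite !mulrBr pd /S.
  set X1 := p%:R * bsum _ _ _ _; set X2 := p%:R * mu k => *.
  by apply/andP; split; lra.
- by exists x.
Qed.

End Level.

(** Let [J] be the set of levels above [s] at which [T] is equidistributed; it
    contains all large levels, and at the levels outside [J] the tile is
    equidistributed. Between the levels [s] and [s + e0] this gives [T] at least [w]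
    points in every ball of level [s + e0], and the tile a measure of at least
    [mu s * v] in the balls where it is not null, with [w * v = p ^ e0]. The number
    of points of [T] in a ball of level [s + e0] is a constant [c], and the tiling
    gives [c * M <= mu (s + e0)]. Hence all these inequalities are equalities: up
    to a null set the tile lies in one ball of level [s + e0], and its tree of
    balls branches completely at the levels outside [J] and does not branch at
    those in [J]. *)
Theorem tile_homogeneous : exists2 H, homogeneous H & aeq m Omega H.
Proof.
have [s sepT] := tile_separated; have [N [mN N0 hN]] := tile_points.
have cover x : ~ N x -> exists2 t, T t & Omega (x - t) by move=> /hN [].
have packing x : ~ N x -> forall t t', T t -> T t' -> Omega (x - t) ->
    Omega (x - t') -> t = t' by move=> /hN [].
have M0 : 0 < M := tile_gt0; have p1 : 1 < p%:R :> R by rewrite ltr1n prime_gt1.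
have [t0 Tt0] : exists t, T t.
  have [x nN] : exists x, ~ N x.
    apply: contrapT => /forallNP h; have /eqP := haar_neq0 m_haar; apply.
    by rewrite -N0; congr (m _); apply/seteqP; split => // x _; apply: contrapT => /h.
  by have [t Tt _] := cover x nN; exists t.
(* T, separated at level s, is not equidistributed below it *)
have low k : k < s -> ball_inv (k + 1) (mball Omega k).
  move=> ks; have sepk : separated k T by apply: separated_le sepT; exact: ltW.
  have := tile_dichotomy sepk mN N0 cover packing 0; rewrite /= addr0 => -[h|//].
  exfalso; apply: (separated_unbalanced sepT Tt0 ks).
  by move=> z w hw; have := h z w hw; rewrite !cnt0.
have full z := null_or_full m_haar z mOmega low.
(* a ball with more than half of the tile is not one of p equal parts of it *)
have [e0 he0] : exists e0 : nat, forall n, (e0 <= n)%N -> ball_inv (s + n%:Z + 1) (cnt T s n).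
  have M3 : 0 < M / 3 by rewrite divr_gt0.
  have [n0 hn0] := mball_lim 0 mOmega Omega_fin M3.
  exists (n0 + `|s|)%N => n nn.
  have [//|h] := tile_dichotomy sepT mN N0 cover packing n; exfalso.
  have hk : M - M / 3 <= mball Omega (s + n%:Z) 0 by apply: hn0; move: nn; clear; lia.
  have : mball Omega (s + n%:Z + 1%N%:Z) 0 <= M by exact: (mball_leM m_haar).
  rewrite (mball_bsum m_haar) // bsum1_const // => hM.
  have : mball Omega (s + n%:Z) 0 *+ 2 <= mball Omega (s + n%:Z) 0 *+ p.
    by rewrite ler_wpMn2l ?mball_ge0 // prime_gt1.
  by move: hk hM; set b := mball _ _ _; rewrite mulr2n; lra.
pose J i := `[< ball_inv (s + i%:Z + 1) (cnt T s i) >].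
pose w := wgt p J e0; pose v n := wgt p (fun i => ~~ J i) n.
have vJ n : (v n.+1 = v n * (if J n then 1 else p))%N by rewrite /v wgtS; case: (J n).
have bal n : ~~ J n -> ball_inv (s + n%:Z + 1) (mball Omega (s + n%:Z)).
  by move=> /asboolPn nJ; have [] := tile_dichotomy sepT mN N0 cover packing n.
have mS n z : ~~ J n -> mball Omega (s + n.+1%:Z) z = p%:R * mball Omega (s + n%:Z) z.
  move=> nJ; rewrite mulr_natl -(bsum1_const _ (bal n nJ)) -(mball_bsum m_haar) //.
  by congr (mball _ _ _); clear; lia.
have mSge n z : mball Omega (s + n%:Z) z <= mball Omega (s + n.+1%:Z) z.
  rewrite (_ : s + n.+1%:Z = s + n%:Z + 1%N%:Z); last by clear; lia.
  exact: (mball_le_level m_haar).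
have lower y n : mball Omega s y = mu s -> mu s * (v n)%:R <= mball Omega (s + n%:Z) y.
  move=> hy; elim: n => [|n IH]; first by rewrite addr0 hy /v /wgt big_ord0 mulr1.
  rewrite vJ natrM mulrA; case: ifP => Jn.
    by rewrite mulr1; apply: le_trans IH _.
  by rewrite mS ?Jn // mulrC ler_wpM2l.
pose c := cnt T s e0 t0.
have cc z : cnt T s e0 z = c by exact: (cnt_const he0).
have wc : (w <= c)%N by apply: cnt_wgt => // i _ /asboolP.
have mus : 0 < mu s := mu_gt0 m_haar s.
have wv : w%:R * (v e0)%:R = (p ^ e0)%:R :> R by rewrite -natrM wgt_compl.
have w0 : 0 < w%:R :> R by rewrite ltr0n wgt_gt0.
(* the density of T times the measure of the tile is at most 1 *)
have cM : c%:R * M <= (p ^ e0)%:R * mu s.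
  rewrite -(muX m_haar); apply/ler_addgt0Pr => e epos.
  have c0 : 0 < c%:R :> R by rewrite ltr0n; apply: leq_trans wc; exact: wgt_gt0.
  pose d := e / (2 * c%:R); have d0 : 0 < d by rewrite divr_gt0 // mulr_gt0.
  have e2 : 0 < e / 2 by rewrite divr_gt0.
  have se : s <= s + e0%:Z by rewrite lerDl.
  have [n1 h1] := partial_tiling sepT mN N0 cover packing 0 se e2.
  have [n2 h2] := mball_lim 0 mOmega Omega_fin d0.
  pose n := (n1 + n2 + `|s|)%N.
  have /andP [_ up] := h1 (e0 + n)%N ltac:(rewrite /n; clear; lia).
  have := h2 (s + (e0 + n)%N%:Z) ltac:(rewrite /n; clear; lia).
  have E : bsum s (e0 + n) (fun z => (meets T s z)%:R * mball Omega (s + e0%:Z) (0 - z)) 0 =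
      c%:R * mball Omega (s + (e0 + n)%N%:Z) 0.
    rewrite bsum_comp.
    have e1 z : bsum s e0 (fun z => (meets T s z)%:R * mball Omega (s + e0%:Z) (0 - z)) z =
        c%:R * mball Omega (s + e0%:Z) (- z).
      rewrite (@eq_bsum _ _ _ _ _ _ (fun z => mball Omega (s + e0%:Z) (- z) * (meets T s z)%:R)); last first.
        by move=> u; rewrite sub0r mulrC.
      rewrite bsum_mull; last by move=> u h hh; rewrite opprD mball_inv // pballN.
      by rewrite -bsum_nat_eq -/(cnt T s e0 z) cc mulrC.
    rewrite (eq_bsum _ _ _ e1) bsum_scal bsum_opp ?oppr0; last exact: mball_inv.
    by rewrite -(mball_bsum m_haar) // PoszD addrA.
  rewrite E in up; move: up; rewrite -/M; set b := mball _ _ _ => up lo.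
  have := ler_wpM2l (ltW c0) lo; rewrite mulrBr.
  have -> : c%:R * d = e / 2 by rewrite /d; field; rewrite gt_eqF.
  by move: up; set X := c%:R * b; set Y := c%:R * M; set Z := mu _; lra.
have top y : mball Omega s y = mu s ->
    M = mball Omega (s + e0%:Z) y /\ mball Omega (s + e0%:Z) y = mu s * (v e0)%:R.
  move=> hy; have l1 := lower y e0 hy.
  have l2 : mball Omega (s + e0%:Z) y <= M := mball_leM m_haar _ _ mOmega Omega_fin.
  have wM : w%:R * M <= w%:R * (mu s * (v e0)%:R).
    apply: le_trans (_ : c%:R * M <= _); first by rewrite ler_wpM2r ?ler_nat // ltW.
    by rewrite mulrCA wv [mu s * _]mulrC.
  move: wM; rewrite ler_pM2l // => wM.
  by split; apply/eqP; rewrite eq_le ?l1 ?l2 ?andbT //=; [apply: le_trans wM l1|apply: le_trans l2 wM].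
have lev y n : mball Omega s y = mu s -> (n <= e0)%N ->
    mball Omega (s + n%:Z) y = mu s * (v n)%:R.
  move=> hy ne; rewrite -(subKn ne); elim: (e0 - n)%N => [|i IH]; first by rewrite subn0; case: (top y hy).
  have [ei|ie] := leqP e0 i.
    by move: IH; rewrite (_ : e0 - i = e0 - i.+1)%N //; move: ei; clear; lia.
  have iE : (e0 - i = (e0 - i.+1).+1)%N by move: ie; clear; lia.
  move: IH; rewrite iE vJ; set q := (e0 - i.+1)%N; case: ifP => Jq.
    rewrite muln1 => IH; apply/eqP; rewrite eq_le lower // andbT.
    by rewrite -IH.
  rewrite mS ?Jq // natrM mulrA mulrC => h.
  exact: (mulIf (pR_neq0 p_pr R)).
exists [set z | mball Omega s z != 0]; last exact: (aeq_full m_haar).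
have fullE z : mball Omega s z != 0 -> mball Omega s z = mu s.
  by case: (full z) => [->|//]; rewrite eqxx.
split.
- apply: contrapT => h; have z0 z : mball Omega s z = 0.
    by apply/eqP/negPn/negP => hz; apply: h; exists z.
  by move: Omega_gt0; rewrite (null_of_balls m_haar mOmega z0) ltxx.
- by exists s => z u hu; rewrite /= mball_inv.
- exists (s + e0%:Z) => x y /fullE /top [hx _] /fullE /top [hy _].
  apply/negPn/negP => nb; have := mball_disj m_haar mOmega Omega_fin nb.
  by rewrite -hx -hy -/M; lra.
move=> k x y /fullE hx /fullE hy kxy z u /fullE hz hu.
have [ks|sk] := ltP k s.
  exists (z + u); last by rewrite subrr pball0.
  rewrite /= mball_inv ?hz ?gt_eqF //; apply: pball_le hu; move: ks; clear; lia.
have [n kE] : exists n : nat, k = s + n%:Z by exists `|k - s|%N; move: sk; clear; lia.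
subst k; have [nb xyk] : ~~ pball (s + n%:Z) (x - y) /\ pball (s + n.+1%:Z) (x - y).
  case/andP: kxy => h1 h2; split => //; apply: pball_le h1; clear; lia.
have [ne|en] := ltnP n e0; last first.
  have [hx1 _] := top x hx; have [hy1 _] := top y hy.
  have nb' : ~~ pball (s + e0%:Z) (x - y) by apply: contra nb; apply: pball_le; move: en; clear; lia.
  by have := mball_disj m_haar mOmega Omega_fin nb'; rewrite -hx1 -hy1 -/M; lra.
have [Jn|nJ] := boolP (J n).
  exfalso; have e1 := lev x n.+1 hx ne; have e2 := lev x n hx (ltnW ne).
  have ey := lev y n hy (ltnW ne).
  have mb k' z' : measurable (Omega `&` bset k' z').
    by apply: measurableI => //; exact: measurable_bset.
  have : (m (Omega `&` bset (s + n%:Z) x) + m (Omega `&` bset (s + n%:Z) y) <=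
          m (Omega `&` bset (s + n.+1%:Z) x))%E.
    rewrite -measureU //; last by rewrite setIACA bset_disj // setI0.
    apply: le_measure; rewrite ?inE //; first exact: measurableU.
    move=> q [[Oq hq]|[Oq hq]]; split => //; first by apply: pball_le hq; clear; lia.
    apply: (@pball_trans _ _ _ y); last by rewrite pball_sym.
    by apply: pball_le hq; clear; lia.
  rewrite !(mballE m_haar) // -EFinD lee_fin e1 e2 ey vJ Jn muln1.
  have : 0 < mu s * (v n)%:R by rewrite mulr_gt0 // ltr0n wgt_gt0.
  by set q := _ * _; lra.
have : mball Omega (s + n%:Z) (z + u) != 0.
  rewrite (bal n nJ) //; apply/eqP => e1; have := lower z n hz.
  by rewrite e1 leNgt mulr_gt0 // ltr0n wgt_gt0.
rewrite (mball_bsum m_haar) // => nz.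
have [j hj] : exists j : 'I_(p ^ n), mball Omega s (z + u + j%:R * ppow (s + n%:Z)) != 0.
  apply: contrapT => /forallNP h; move/negP: nz; apply; apply/eqP/big1 => j _.
  by apply/eqP/negPn/negP => /h.
exists (z + u + j%:R * ppow (s + n%:Z)) => //.
by rewrite opprD addrA subrr add0r pballN pball_natM.
Qed.

End Tile.

(** * Integrals of bounded complex functions *)

Section BoundedComplex.
Context d (T : measurableType d) (R : realType).
Variables (m : {measure set T -> \bar R}) (D : set T).
Hypothesis mD : measurable D.
Hypothesis Dfin : (m D < +oo)%E.
Local Notation C := (R[i]).
Local Notation Re := (@complex.Re R).
Local Notation Im := (@complex.Im R).
Local Notation RtoC := (real_complex R).
Local Notation cabs := (@ComplexField.Normc.normc R).
Implicit Types (f g : T -> C) (c : C).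

Definition bmf f : Prop := [/\ measurable_fun setT (Re \o f),
  measurable_fun setT (Im \o f) & exists K, forall x, cabs (f x) <= K].

Lemma cabs_sqr (c : C) : cabs c ^+ 2 = Re c ^+ 2 + Im c ^+ 2.
Proof. by case: c => a b /=; rewrite sqr_sqrtr // addr_ge0 // sqr_ge0. Qed.

Lemma cabs_conj (c : C) : cabs (conjc c) = cabs c.
Proof. by case: c => a b /=; rewrite sqrrN. Qed.

Lemma Re_le_cabs (c : C) : `|Re c| <= cabs c.
Proof.
rewrite -ler_sqr ?nnegrE ?normr_ge0 ?cabs_ge0 // cabs_sqr real_normK ?num_real //.
by rewrite lerDl sqr_ge0.
Qed.

Lemma Im_le_cabs (c : C) : `|Im c| <= cabs c.
Proof.
rewrite -ler_sqr ?nnegrE ?normr_ge0 ?cabs_ge0 // cabs_sqr real_normK ?num_real //.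
by rewrite lerDr sqr_ge0.
Qed.

Lemma cabs_le_ReIm (c : C) : cabs c <= `|Re c| + `|Im c|.
Proof.
rewrite -ler_sqr ?nnegrE ?addr_ge0 ?cabs_ge0 // cabs_sqr sqrrD !real_normK ?num_real //.
by rewrite addrAC lerDl mulrn_wge0 // mulr_ge0.
Qed.

Lemma ReM (a b : C) : Re (a * b) = Re a * Re b - Im a * Im b.
Proof. by case: a b => [a1 a2] [b1 b2]. Qed.

Lemma ImM (a b : C) : Im (a * b) = Re a * Im b + Im a * Re b.
Proof. by case: a b => [a1 a2] [b1 b2]. Qed.

Lemma ReD (a b : C) : Re (a + b) = Re a + Re b.
Proof. by case: a b => [a1 a2] [b1 b2]. Qed.

Lemma ImD (a b : C) : Im (a + b) = Im a + Im b.
Proof. by case: a b => [a1 a2] [b1 b2]. Qed.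

Lemma Re_sum (I : Type) (r : seq I) (P : pred I) (F : I -> C) :
  Re (\sum_(i <- r | P i) F i) = \sum_(i <- r | P i) Re (F i).
Proof. by elim/big_ind2: _ => // a b c' e <- <-; rewrite ReD. Qed.

Lemma bmfM f g : bmf f -> bmf g -> bmf (fun x => f x * g x).
Proof.
move=> [mRf mIf [K fK]] [mRg mIg [L gL]]; split.
- rewrite (_ : _ \o _ = (fun x => Re (f x) * Re (g x) - Im (f x) * Im (g x))).
    by apply: measurable_funB; apply: measurable_funM.
  by apply/funext => x /=; rewrite ReM.
- rewrite (_ : _ \o _ = (fun x => Re (f x) * Im (g x) + Im (f x) * Re (g x))).
    by apply: measurable_funD; apply: measurable_funM.
  by apply/funext => x /=; rewrite ImM.
- by exists (K * L) => x; rewrite cabsM ler_pM ?cabs_ge0.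
Qed.

Lemma bmfD f g : bmf f -> bmf g -> bmf (fun x => f x + g x).
Proof.
move=> [mRf mIf [K fK]] [mRg mIg [L gL]]; split.
- rewrite (_ : _ \o _ = (fun x => Re (f x) + Re (g x))); first exact: measurable_funD.
  by apply/funext => x /=; rewrite ReD.
- rewrite (_ : _ \o _ = (fun x => Im (f x) + Im (g x))); first exact: measurable_funD.
  by apply/funext => x /=; rewrite ImD.
- by exists (K + L) => x; apply: le_trans (cabsD _ _) _; rewrite lerD.
Qed.

Lemma bmf_cst c : bmf (fun=> c).
Proof. by split; [exact: measurable_cst|exact: measurable_cst|exists (cabs c)]. Qed.

Lemma bmfZ c f : bmf f -> bmf (fun x => c * f x).
Proof. by apply: bmfM; exact: bmf_cst. Qed.

Lemma bmfN f : bmf f -> bmf (fun x => - f x).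
Proof.
move=> hf; rewrite (_ : (fun x => - f x) = (fun x => -1 * f x)); first exact: bmfZ.
by apply/funext => x; rewrite mulN1r.
Qed.

Lemma bmf_conj f : bmf f -> bmf (fun x => conjc (f x)).
Proof.
move=> [mRf mIf [K fK]]; split.
- by rewrite (_ : _ \o _ = Re \o f) //; apply/funext => x /=; case: (f x).
- rewrite (_ : _ \o _ = \- (Im \o f)); first exact: measurable_funN.
  by apply/funext => x /=; case: (f x).
- by exists K => x; rewrite cabs_conj.
Qed.

Lemma bmf_sum (I : Type) (r : seq I) (F : I -> T -> C) :
  (forall i, bmf (F i)) -> bmf (fun x => \sum_(i <- r) F i x).
Proof.
move=> h; elim: r => [|i r IH].
  rewrite (_ : (fun _ => _) = (fun=> 0)); first exact: bmf_cst.
  by apply/funext => x; rewrite big_nil.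
rewrite (_ : (fun _ => _) = (fun x => F i x + \sum_(j <- r) F j x)); first exact: bmfD.
by apply/funext => x; rewrite big_cons.
Qed.

Definition cind (A : set T) x : C := RtoC (\1_A x).

Lemma cindT A x : A x -> cind A x = 1.
Proof. by move=> Ax; rewrite /cind indicE mem_set. Qed.

Lemma cindF A x : ~ A x -> cind A x = 0.
Proof. by move=> Ax; rewrite /cind indicE memNset. Qed.

Lemma bmf_cind A : measurable A -> bmf (cind A).
Proof.
move=> mA; split.
- by rewrite (_ : _ \o _ = \1_A) //; exact: measurable_indic.
- rewrite (_ : _ \o _ = cst 0) //; exact: measurable_cst.
- exists 1 => x; have [Ax|nA] := pselect (A x); first by rewrite cindT // ComplexField.Normc.normc1.
  by rewrite cindF // cabs0.
Qed.

Lemma bounded_integrable (h : T -> R) K : measurable_fun setT h ->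
  (forall x, `|h x| <= K) -> m.-integrable D (EFin \o h).
Proof.
move=> mh hK; apply: measurable_bounded_integrable => //.
  exact: measurable_funTS.
exists K; split; first exact: num_real.
by move=> y Ky x _ /=; apply: le_trans (hK x) (ltW Ky).
Qed.

Lemma integrable_Re f : bmf f -> m.-integrable D (EFin \o (Re \o f)).
Proof.
move=> [mf _ [K hK]]; apply: bounded_integrable mf _ => x.
exact: le_trans (Re_le_cabs _) (hK x).
Qed.

Lemma integrable_Im f : bmf f -> m.-integrable D (EFin \o (Im \o f)).
Proof.
move=> [_ mf [K hK]]; apply: bounded_integrable mf _ => x.
exact: le_trans (Im_le_cabs _) (hK x).
Qed.

Local Notation I := (Cintegral m D).

Lemma eq_Cintegral f g : (forall x, D x -> f x = g x) -> I f = I g.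
Proof.
by move=> fg; congr Complex; apply: eq_Rintegral => x; rewrite inE => Dx; rewrite fg.
Qed.

Lemma CintegralD f g : bmf f -> bmf g -> I (fun x => f x + g x) = I f + I g.
Proof.
move=> hf hg; rewrite /Cintegral; apply/eqP; rewrite eq_complex /=; apply/andP; split; apply/eqP.
  rewrite -RintegralD //; [|exact: integrable_Re|exact: integrable_Re].
  by apply: eq_Rintegral => x _; rewrite ReD.
rewrite -RintegralD //; [|exact: integrable_Im|exact: integrable_Im].
by apply: eq_Rintegral => x _; rewrite ImD.
Qed.

Lemma CintegralZ c f : bmf f -> I (fun x => c * f x) = c * I f.
Proof.
move=> hf; rewrite /Cintegral; case: c => a b.
have iR := integrable_Re hf; have iI := integrable_Im hf.
have hZ (r : R) : bmf (fun x => RtoC r * f x) by exact: bmfZ.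
have ReZ (r : R) : m.-integrable D (EFin \o (fun x => r * Re (f x))).
  apply: eq_integrable (integrable_Re (hZ r)) => //= x _.
  by rewrite ReM /= mul0r subr0.
have ImZ (r : R) : m.-integrable D (EFin \o (fun x => r * Im (f x))).
  apply: eq_integrable (integrable_Im (hZ r)) => //= x _.
  by rewrite ImM /= mul0r addr0.
apply/eqP; rewrite eq_complex /=; apply/andP; split; apply/eqP.
  rewrite -!RintegralZl // -RintegralB //.
  by apply: eq_Rintegral => x _; rewrite ReM.
rewrite -!RintegralZl // -RintegralD //.
by apply: eq_Rintegral => x _; rewrite ImM.
Qed.

Lemma Cintegral_sum (J : Type) (r : seq J) (F : J -> T -> C) :
  (forall i, bmf (F i)) -> I (fun x => \sum_(i <- r) F i x) = \sum_(i <- r) I (F i).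
Proof.
move=> h; elim: r => [|i r IH].
  rewrite big_nil (@eq_Cintegral _ (fun=> 0 * 0)); last by move=> x _; rewrite big_nil mulr0.
  by rewrite CintegralZ ?mul0r //; exact: bmf_cst.
rewrite big_cons -IH -CintegralD //; last exact: bmf_sum.
by apply: eq_Cintegral => x _; rewrite big_cons.
Qed.

Lemma Cintegral_conj f : bmf f -> I (fun x => conjc (f x)) = conjc (I f).
Proof.
move=> hf; rewrite /Cintegral /=; congr Complex.
  by apply: eq_Rintegral => x _; case: (f x).
rewrite -mulN1r -RintegralZl //; last exact: integrable_Im.
by apply: eq_Rintegral => x _; case: (f x) => a b /=; rewrite mulN1r.
Qed.

Lemma Cintegral_cst c : I (fun=> c) = c * RtoC (fine (m D)).
Proof.
rewrite /Cintegral !Rintegral_cst //; case: c => a b /=.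
by apply/eqP; rewrite eq_complex /= !mulr0 subr0 add0r !eqxx.
Qed.

Lemma Cintegral_cind A f : I (fun x => cind A x * f x) = Cintegral m (D `&` A) f.
Proof.
rewrite /Cintegral !Rintegral_mkcondr; congr Complex; apply: eq_Rintegral => x _ /=;
  rewrite /patch; case: ifPn => [/set_mem Ax|/negP nA].
- by rewrite cindT ?mul1r.
- by rewrite cindF ?mul0r // => Ax; apply: nA; rewrite inE.
- by rewrite cindT ?mul1r.
- by rewrite cindF ?mul0r // => Ax; apply: nA; rewrite inE.
Qed.

Local Notation ip := (L2_dot m D).

Definition nrm2 f : R := \int[m]_(x in D) (cabs (f x) ^+ 2).

Lemma bmf_ip f g : bmf f -> bmf g -> bmf (fun x => f x * conjc (g x)).
Proof. by move=> hf hg; apply: bmfM => //; exact: bmf_conj. Qed.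

Lemma ipDl f g h : bmf f -> bmf g -> bmf h ->
  ip (fun x => f x + g x) h = ip f h + ip g h.
Proof.
move=> hf hg hh; rewrite -CintegralD; [|exact: bmf_ip|exact: bmf_ip].
by apply: eq_Cintegral => x _; rewrite mulrDl.
Qed.

Lemma ipZl c f h : bmf f -> bmf h -> ip (fun x => c * f x) h = c * ip f h.
Proof.
move=> hf hh; rewrite -CintegralZ; last exact: bmf_ip.
by apply: eq_Cintegral => x _; rewrite mulrA.
Qed.

Lemma ip_conj f g : bmf f -> bmf g -> ip g f = conjc (ip f g).
Proof.
move=> hf hg; rewrite -Cintegral_conj; last exact: bmf_ip.
by apply: eq_Cintegral => x _; rewrite rmorphM /= conjcK mulrC.
Qed.

Lemma ip_suml (J : Type) (r : seq J) (c : J -> C) (e : J -> T -> C) h :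
  (forall j, bmf (e j)) -> bmf h ->
  ip (fun x => \sum_(j <- r) c j * e j x) h = \sum_(j <- r) c j * ip (e j) h.
Proof.
move=> he hh; rewrite /L2_dot (@eq_Cintegral _ (fun x => \sum_(j <- r) c j * (e j x * conjc (h x)))).
  rewrite Cintegral_sum; last by move=> j; apply: bmfZ; exact: bmf_ip.
  by apply: eq_bigr => j _; rewrite CintegralZ //; exact: bmf_ip.
by move=> x _; rewrite mulr_suml; apply: eq_bigr => j _; rewrite mulrA.
Qed.

Lemma nrm2E f : bmf f -> ip f f = RtoC (nrm2 f).
Proof.
move=> hf; rewrite /L2_dot /Cintegral /nrm2; apply/eqP; rewrite eq_complex /=; apply/andP.
split; apply/eqP.
  by apply: eq_Rintegral => x _; rewrite cabs_sqr ReM; case: (f x) => a b /=; ring.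
rewrite -[RHS](mul0r (fine (m D))) -Rintegral_cst //.
by apply: eq_Rintegral => x _; rewrite ImM; case: (f x) => a b /=; ring.
Qed.

Lemma nrm2_ge0 f : 0 <= nrm2 f.
Proof. by apply: Rintegral_ge0 => x _; rewrite sqr_ge0. Qed.

Lemma measurable_cabs2 f : bmf f -> measurable_fun setT (fun x => cabs (f x) ^+ 2).
Proof.
move=> [mR mI _]; rewrite (_ : (fun _ => _) = (fun x => Re (f x) ^+ 2 + Im (f x) ^+ 2)).
  by apply: measurable_funD; apply: measurable_funX.
by apply/funext => x; rewrite cabs_sqr.
Qed.

Lemma integrable_cabs2 f : bmf f -> m.-integrable D (EFin \o (fun x => cabs (f x) ^+ 2)).
Proof.
move=> hf; have [_ _ [K hK]] := hf.
apply: (@bounded_integrable _ (K ^+ 2)); first exact: measurable_cabs2.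
move=> x; rewrite ger0_norm ?sqr_ge0 // ler_sqr ?nnegrE ?cabs_ge0 //.
exact: le_trans (cabs_ge0 _) (hK x).
Qed.

Lemma L2_sqdistE f g : bmf f -> bmf g ->
  L2_sqdist m D f g = (nrm2 (fun x => f x - g x))%:E.
Proof.
move=> hf hg; rewrite /L2_sqdist /nrm2 /Rintegral fineK //.
have := integrable_cabs2 (bmfD hf (bmfN hg)) => /integrableP [mi fi].
rewrite ge0_fin_numE; last by apply: integral_ge0 => x _; rewrite lee_fin sqr_ge0.
apply: le_lt_trans fi; apply: ge0_le_integral => //.
- by move=> x _; rewrite lee_fin sqr_ge0.
- by apply: measurableT_comp; [exact: abse_measurable|exact: mi].
- by move=> x _; rewrite /= lee_fin ler_norm.
Qed.

Lemma bmf_L2 f : bmf f -> L2_fun m D f.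
Proof.
move=> hf; have [mR mI _] := hf; split; [exact: measurable_funTS|exact: measurable_funTS|].
have := L2_sqdistE hf (bmf_cst 0).
have -> : L2_sqdist m D f (fun=> 0) = (\int[m]_(x in D) (cabs (f x) ^+ 2)%:E)%E.
  by apply: eq_integral => x _; rewrite subr0.
by move=> ->; exact: ltry.
Qed.

Section Orthogonal.
Variables (J : choiceType) (e : J -> T -> C) (E : R).
Hypothesis be : forall j, bmf (e j).
Hypothesis E0 : 0 < E.
Variable s : seq J.
Hypothesis us : uniq s.
Hypothesis orth : forall i j, i \in s -> j \in s -> i != j -> ip (e i) (e j) = 0.
Hypothesis nrm : forall i, i \in s -> ip (e i) (e i) = RtoC E.

Lemma pythagoras f (c : J -> C) : bmf f ->
  nrm2 (fun x => f x - \sum_(j <- s) c j * e j x) = nrm2 f -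
    \sum_(j <- s) (2 * (Re (c j) * Re (ip f (e j)) + Im (c j) * Im (ip f (e j)))
                   - E * (Re (c j) ^+ 2 + Im (c j) ^+ 2)).
Proof.
move=> hf; pose g x := \sum_(j <- s) c j * e j x.
have hg : bmf g by apply: bmf_sum => j; exact: bmfZ.
have hN := bmfN hg.
have hfg : bmf (fun x => f x - g x) by exact: bmfD.
have ipg h : bmf h -> ip g h = \sum_(j <- s) c j * ip (e j) h by move=> ?; exact: ip_suml.
have ipgg : ip g g = \sum_(j <- s) c j * conjc (c j) * RtoC E.
  rewrite ipg //; apply: eq_big_seq => i si; rewrite -mulrA; congr (_ * _).
  rewrite (ip_conj hg (be i)) ipg // (bigD1_seq i) //= nrm //.
  rewrite big1_seq ?addr0 ?rmorphM /=; last by move=> j /andP [ji sj]; rewrite orth // mulr0.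
  by congr (_ * _); apply/eqP; rewrite eq_complex /= oppr0 !eqxx.
have NE h : bmf h -> ip (fun x => - g x) h = - ip g h.
  move=> hh; rewrite -mulN1r -ipZl //; apply: eq_Cintegral => x _.
  by rewrite mulN1r.
have e1 : ip (fun x => f x - g x) (fun x => f x - g x) =
    ip f f - ip f g - ip g f + ip g g.
  rewrite (ipDl hf hN hfg) (@ip_conj (fun x => f x - g x) f) // (ipDl hf hN hf) NE //.
  rewrite NE // (@ip_conj (fun x => f x - g x) g) // (ipDl hf hN hg) NE //.
  have cB (a b : C) : conjc (a - b) = conjc a - conjc b.
    by case: a b => [a1 a2] [b1 b2]; apply/eqP; rewrite eq_complex /= opprD !eqxx.
  rewrite !cB -(ip_conj hg hf) -(ip_conj hf hg) -(ip_conj hf hf) -(ip_conj hg hg).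
  by rewrite opprB addrA addrAC.
have -> : nrm2 (fun x => f x - g x) = Re (RtoC (nrm2 f) - ip f g - ip g f + ip g g).
  by rewrite -nrm2E // -e1 nrm2E.
have -> : Re (RtoC (nrm2 f) - ip f g - ip g f + ip g g) =
   nrm2 f - (Re (ip f g) + Re (ip g f) - Re (ip g g)).
  by rewrite !ReD; case: (ip f g) (ip g f) => [a1 a2] [b1 b2] /=; ring.
congr (_ - _); rewrite (ip_conj hg hf).
have -> : Re (conjc (ip g f)) = Re (ip g f) by case: (ip g f).
have key (a F : C) : Re (a * conjc F) + Re (a * conjc F) - Re (a * conjc a * RtoC E) =
    2 * (Re a * Re F + Im a * Im F) - E * (Re a ^+ 2 + Im a ^+ 2).
  by case: a F => [a1 a2] [b1 b2] /=; ring.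
rewrite ipg // ipgg !Re_sum -big_split -sumrB; apply: eq_bigr => j _.
by rewrite (ip_conj hf (be j)); exact: key.
Qed.

(** Completing the square. *)
Lemma completed_square_le (c F : C) : 2 * (Re c * Re F + Im c * Im F) -
  E * (Re c ^+ 2 + Im c ^+ 2) <= cabs F ^+ 2 / E.
Proof.
rewrite cabs_sqr ler_pdivlMr // -subr_ge0.
have -> : Re F ^+ 2 + Im F ^+ 2 - (2 * (Re c * Re F + Im c * Im F) -
  E * (Re c ^+ 2 + Im c ^+ 2)) * E = (Re F - E * Re c) ^+ 2 + (Im F - E * Im c) ^+ 2 by ring.
by rewrite addr_ge0 // sqr_ge0.
Qed.

(** Among the combinations of the [e j], the orthogonal projection is the one
    closest to [f]. *)
Lemma projection_best f (c : J -> C) : bmf f ->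
  nrm2 f - \sum_(j <- s) cabs (ip f (e j)) ^+ 2 / E <=
  nrm2 (fun x => f x - \sum_(j <- s) c j * e j x).
Proof.
move=> hf; rewrite pythagoras // lerD2l lerN2; apply: ler_sum => j _; exact: completed_square_le.
Qed.

(** The distance of [f] to its projection is not negative. *)
Lemma bessel f : bmf f -> \sum_(j <- s) cabs (ip f (e j)) ^+ 2 <= E * nrm2 f.
Proof.
move=> hf; have := nrm2_ge0 (fun x => f x - \sum_(j <- s) (ip f (e j) / RtoC E) * e j x).
rewrite pythagoras // subr_ge0 -ler_pdivrMl // mulrC mulr_suml; apply: le_trans.
rewrite le_eqVlt; apply/orP; left; apply/eqP; apply: eq_bigr => j _.
have -> : ip f (e j) / RtoC E = Complex (Re (ip f (e j)) / E) (Im (ip f (e j)) / E).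
  rewrite -fmorphV; case: (ip f (e j)) => a b; apply/eqP.
  by rewrite eq_complex /= !mulr0 subr0 add0r !eqxx.
by rewrite cabs_sqr /=; field; rewrite gt_eqF.
Qed.

End Orthogonal.

End BoundedComplex.

(** * Spectral sets are homogeneous *)

Section Points.
Variables (p : nat) (p_pr : prime p).
Local Notation Qp := (padic p_pr).
Local Notation ppow := (@ppow p p_pr).
Implicit Types (x y z w t : Qp) (k l s e : int) (n i : nat) (A B H T : set Qp).

(** One point in each of the balls of level [s] that meet [T]; if [T] is separated
    at level [s], there is no other point of [T] in the ball of level [s + n]. *)
Definition points T s n : seq Qp :=
  [seq xget 0 [set t | T t /\ pball s (t - j%:R * ppow (s + n%:Z))] |
     j <- iota 0 (p ^ n) & meets T s (j%:R * ppow (s + n%:Z)) == 1%N].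

Lemma meets_xget T s z : meets T s z == 1%N ->
  T (xget 0 [set t | T t /\ pball s (t - z)]) /\
  pball s (xget 0 [set t | T t /\ pball s (t - z)] - z).
Proof.
rewrite /meets; case: asboolP => //= -[t Tt ht] _.
by case: xgetP => [y _ [Ty hy]//|/(_ t)]; case; split.
Qed.

Lemma mem_points T s n t : separated s T ->
  (t \in points T s n) <-> (T t /\ pball (s + n%:Z) t).
Proof.
move=> sT; split.
  move=> /mapP [j]; rewrite mem_filter => /andP [/meets_xget [Tx hx] _] ->.
  split => //; rewrite -(subrK (j%:R * ppow (s + n%:Z)) (xget _ _)).
  by apply: pballD; [apply: pball_le hx; lia|rewrite pball_natM].
move=> [Tt /pball_rep [j jn hj]]; apply/mapP; exists j.
  rewrite mem_filter mem_iota add0n jn andbT /meets asboolT //.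
  by exists t.
have hm : meets T s (j%:R * ppow (s + n%:Z)) == 1%N.
  by rewrite /meets asboolT //; exists t.
have [Tx hx] := meets_xget hm; apply: sT => //.
by apply: pball_trans hj _; rewrite pball_sym.
Qed.

Lemma uniq_points T s n : uniq (points T s n).
Proof.
rewrite map_inj_in_uniq ?filter_uniq ?iota_uniq // => i j.
rewrite !mem_filter !mem_iota !add0n /= => /andP [/meets_xget [_ hi] ip] /andP [/meets_xget [_ hj] jp] e.
apply: (pball_rep_uniq ip jp (k := s)).
apply: (@pball_trans _ _ _ (xget 0 [set t | T t /\ pball s (t - i%:R * ppow (s + n%:Z))])).
  by rewrite pball_sym.
by rewrite e.
Qed.

Lemma sum_points (V : pzSemiRingType) T s n (phi : Qp -> V) : ball_inv s phi ->
  \sum_(t <- points T s n) phi t = bsum s n (fun z => (meets T s z)%:R * phi z) 0.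
Proof.
move=> hphi; rewrite big_map big_filter big_mkcond /bsum -[RHS](big_mkord xpredT
  (fun j => (meets T s (0 + j%:R * ppow (s + n%:Z)))%:R * phi (0 + j%:R * ppow (s + n%:Z)))).
rewrite /index_iota subn0; apply: eq_bigr => j _; rewrite add0r.
case: ifP => [hm|]; last first.
  by rewrite /meets; case: asboolP => //= _ _; rewrite mul0r.
have [_ hx] := meets_xget hm; rewrite (eqP hm) mul1r.
exact: (ball_invE hphi).
Qed.

Lemma size_points T s n : size (points T s n) = cnt T s n 0.
Proof.
rewrite -sum1_size /cnt; have := @sum_points nat T s n (fun=> 1%N).
move=> e; rewrite -[LHS]/(\sum_(t <- points T s n) (1%N : nat)) e //.
by apply: eq_bsum => z; rewrite natn mulr1.
Qed.

End Points.

Section Spectral.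
Variables (R : realType) (p : nat) (p_pr : prime p).
Local Notation Qp := (padic p_pr).
Variables (m : {measure set Qp -> \bar R}) (m_haar : is_haar m).
Local Notation ppow := (@ppow p p_pr).
Local Notation bset := (@bset p p_pr).
Local Notation mball := (mball m).
Local Notation mu := (mu m).
Local Notation C := (R[i]).
Local Notation Re := (@complex.Re R).
Local Notation Im := (@complex.Im R).
Local Notation RtoC := (real_complex R).
Local Notation cabs := (@ComplexField.Normc.normc R).
Local Notation ch := (@ch p p_pr R).
Implicit Types (x y z w t : Qp) (k l s : int) (n i : nat) (A B D H : set Qp).

Lemma bmf_ch x : bmf (fun y => ch (x * y)).
Proof.
have [n hn] := pball_ex x; have hx : pball (- - n%:Z) x by apply: hn; rewrite opprK.
have hi := ch_inv R hx; split.
- by apply: (@measurable_fun_ball_inv _ _ _ _ (- n%:Z)) => // z w hw; rewrite /comp hi.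
- by apply: (@measurable_fun_ball_inv _ _ _ _ (- n%:Z)) => // z w hw; rewrite /comp hi.
- by exists 1 => y; rewrite normc_ch.
Qed.

Lemma ch_unit x : ch x * conjc (ch x) = 1.
Proof. by rewrite -chN -chD subrr ch0. Qed.

Lemma cindE A (B : set Qp) x y : (A x <-> B y) -> cind R A x = cind R B y.
Proof.
move=> AB; have [Ax|nA] := pselect (A x); first by rewrite !cindT //; apply/AB.
by rewrite !cindF // => /AB.
Qed.

Lemma cind_bsum k n z x : cind R (bset (k + n%:Z) z) x =
  \sum_(j < p ^ n) cind R (bset k (z + j%:R * ppow (k + n%:Z))) x.
Proof.
have [hx|hx] := pselect (bset (k + n%:Z) z x); last first.
  rewrite cindF // big1 // => j _; rewrite cindF // => hj; apply: hx.
  by rewrite bset_cover -(bigcup_mkord _ (fun j : nat => bset k (z + j%:R * ppow (k + n%:Z)))); exists j => //=.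
rewrite cindT //; have [j jn hj] := pball_rep hx.
rewrite (bigD1 (Ordinal jn)) //= cindT; last by rewrite bsetE opprD addrA.
rewrite big1 ?addr0 // => i ij; rewrite cindF // => hi; move/eqP: ij; apply.
apply/val_inj; apply: (@pball_rep_uniq p p_pr k n) => //=.
move: hi; rewrite bsetE opprD addrA => hi.
by apply: pball_trans hj; rewrite pball_sym.
Qed.

(** [f] is constant on the balls of level [k] that make up the domain. *)
Lemma Cintegral_balls A k n z (f : Qp -> C) : measurable A -> (m A < +oo)%E ->
  bmf f -> ball_inv k f ->
  Cintegral m (A `&` bset (k + n%:Z) z) f = bsum k n (fun x => RtoC (mball A k x) * f x) z.
Proof.
move=> mA Afin bf fi; have bc j : bmf (cind R (bset k (z + j%:R * ppow (k + n%:Z)))).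
  by apply: bmf_cind; exact: measurable_bset.
rewrite -Cintegral_cind (@eq_Cintegral _ _ _ _ _ _ (fun x =>
  \sum_(0 <= j < p ^ n) cind R (bset k (z + j%:R * ppow (k + n%:Z))) x * f x)); last first.
  move=> x _; by rewrite cind_bsum -mulr_suml big_mkord.
rewrite Cintegral_sum //; last by move=> j; exact: bmfM.
rewrite big_mkord /bsum; apply: eq_bigr => j _.
have mb := @measurable_bset p p_pr k (z + j%:R * ppow (k + n%:Z)).
rewrite Cintegral_cind (@eq_Cintegral _ _ _ _ _ _ (fun=> f (z + j%:R * ppow (k + n%:Z)))).
  rewrite Cintegral_cst; last exact: measurableI.
  exact: mulrC.
by move=> x [_ hx]; exact: (ball_invE fi).
Qed.

(** Cutting the ball into balls on which the character is constant turns the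
    integral into a geometric sum. *)
Lemma Cintegral_ball k z x : ~~ pball (- k) x ->
  Cintegral m (bset k z) (fun y => ch (x * y)) = 0.
Proof.
move=> hx; have [n hn] := pball_ex x.
pose r := (n + `|k|)%N; pose k' := k - r%:Z.
have xk : pball (- k') x by apply: hn; rewrite /k' /r; clear; lia.
have kE : k = k' + r%:Z by rewrite /k' subrK.
have mb := @measurable_bset p p_pr k z; have fb := bset_fin m_haar k z.
rewrite -[bset k z]setIid {2}kE Cintegral_balls //; [|exact: bmf_ch|exact: ch_inv].
rewrite /bsum -kE (eq_bigr (fun j : 'I__ => RtoC (mu k') * ch (x * z) * ch (j%:R * (x * ppow k)))) => [|j _].
  rewrite -mulr_sumr sum_ch ?pballM; last by apply: pball_le xk; rewrite /k'; clear; lia.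
  by rewrite sub0r (negPf hx) mulr0.
rewrite -mulrA -chD; congr (RtoC _ * ch _); last by ring.
rewrite -(setTI (bset k z)) mball_ball_inv; last first.
  by apply: ball_inv_set_le (@bset_inv _ _ k z); rewrite /k'; clear; lia.
rewrite asboolT ?mballT //.
by rewrite bsetE addrAC subrr add0r pball_natM.
Qed.

Lemma mean_sqr (b c : R) : b * c <= 2^-1 * (b ^+ 2 + c ^+ 2).
Proof. have := sqr_ge0 (b - c); rewrite sqrrB; lra. Qed.

Lemma deviation_bound (K N d1 d2 ep : R) : 0 < K -> 0 <= d1 <= ep / K ->
  0 <= d2 <= ep / K -> `|(K * (N - d1) - K * (N - d2)) / 4| <= ep / 2.
Proof.
move=> K0 /andP [l1 u1] /andP [l2 u2].
rewrite ler_pdivlMr // in u1; rewrite ler_pdivlMr // in u2.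
have e3 : 0 <= d1 * K by rewrite mulr_ge0 // ltW.
have e4 : 0 <= d2 * K by rewrite mulr_ge0 // ltW.
have -> : (K * (N - d1) - K * (N - d2)) / 4 = (d2 * K - d1 * K) / 4 by field.
by rewrite ler_norml; apply/andP; split; lra.
Qed.

(** Fourier transform of the part of [D] in [W], with [u] as origin. *)
Definition piece_ft D W u x : C :=
  Cintegral m D (fun y => cind R W y * ch (- (x * (y - u)))).

Lemma piece_ftE D W u x :
  piece_ft D W u x = Cintegral m D (fun y => cind R W y * ch (- (x * (y - u)))).
Proof. by []. Qed.

Local Opaque piece_ft.

Section Spectrum.
Variables (Omega Lambda : set Qp).
Hypothesis mOmega : measurable Omega.
Hypothesis Omega_gt0 : (0 < m Omega)%E.
Hypothesis Omega_fin : (m Omega < +oo)%E.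
Hypothesis basis : orthogonal_basis m Omega Lambda (@padic_char p p_pr R).

Let M := fine (m Omega).
Local Notation I := (Cintegral m Omega).
Local Notation ip := (L2_dot m Omega).
Local Notation nrm2 := (nrm2 m Omega).
Let e (x : Qp) : Qp -> C := fun y => ch (x * y).

Let M0 : 0 < M.
Proof. by rewrite fine_gt0 // Omega_gt0. Qed.

Let be x : bmf (e x).
Proof. exact: bmf_ch. Qed.

Let ip_e D x : measurable D -> L2_dot m D (e x) (e x) = RtoC (fine (m D)).
Proof.
move=> mD; rewrite -[RHS]mul1r -Cintegral_cst //.
by apply: eq_Cintegral => y _; rewrite ch_unit.
Qed.

Let ip_ee x y D : L2_dot m D (e x) (e y) = Cintegral m D (fun z => ch ((x - y) * z)).
Proof. by apply: eq_Cintegral => z _; rewrite mulrBl chD chN. Qed.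

Let orth x y : Lambda x -> Lambda y -> x != y -> ip (e x) (e y) = 0.
Proof. exact: basis_orthogonal basis x y. Qed.

Lemma sum_count_mem (V : nmodType) (J : choiceType) (s S : seq J) (F : J -> V) :
  uniq S -> {subset s <= S} ->
  \sum_(i <- s) F i = \sum_(j <- S) F j *+ count_mem j s.
Proof.
move=> uS; elim: s => [_|i s IH sub]; first by rewrite big_nil big1 // => j _; rewrite mulr0n.
rewrite big_cons IH; last by move=> j js; apply: sub; rewrite inE js orbT.
under [RHS]eq_bigr => j _ do rewrite /= mulrnDr.
rewrite big_split /=; congr (_ + _); rewrite (bigD1_seq i) //=; last by apply: sub; rewrite mem_head.
by rewrite eqxx big1 ?addr0 // => j /negPf; rewrite eq_sym => ->.
Qed.

(** Finite combinations of characters of the spectrum approximate [f], and the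
    projection of [f] to any larger finite set of characters is at least as
    close by [projection_best]. *)
Lemma parseval f (eps : R) : bmf f -> 0 < eps -> exists2 s0 : seq Qp,
  (forall x, x \in s0 -> Lambda x) & forall S : seq Qp, uniq S ->
  (forall x, x \in S -> Lambda x) -> {subset s0 <= S} ->
  nrm2 f - \sum_(x <- S) cabs (ip f (e x)) ^+ 2 / M <= eps.
Proof.
move=> bf e0; have [s [c [sL hs]]] := basis_dense basis (bmf_L2 mOmega Omega_fin bf) e0.
exists s => // S uS SL sS; apply: ltW; apply: le_lt_trans (_ : _ < eps); last first.
  move: hs; rewrite L2_sqdistE //; first by rewrite lte_fin; apply.
  by apply: bmf_sum => x; apply: bmfZ; exact: bmf_ch.
have -> : (fun x => f x - \sum_(i <- s) c i * padic_char R i x) =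
    (fun x => f x - \sum_(j <- S) (c j *+ count_mem j s) * e j x).
  apply/funext => x; rewrite (@sum_count_mem _ _ s S) //; congr (_ - _).
  by apply: eq_bigr => j _; rewrite mulrnAl.
apply: (projection_best mOmega Omega_fin be M0 uS _ _ _ bf) => [x y xS yS|x xS].
  by apply: orth; apply: SL.
exact: ip_e.
Qed.

Lemma bessel_spectrum f (S : seq Qp) : bmf f -> uniq S -> (forall x, x \in S -> Lambda x) ->
  \sum_(x <- S) cabs (ip f (e x)) ^+ 2 <= M * nrm2 f.
Proof.
move=> bf uS SL; apply: (bessel mOmega Omega_fin be M0 uS _ _ bf) => [x y xS yS|x xS].
  by apply: orth; apply: SL.
exact: ip_e.
Qed.

(** If [x] and [y] are close, the character of [x - y] is 1 on a ball that contains
    at least two thirds of [Omega], so that its integral over [Omega] is not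
    0. *)
Lemma spectrum_separated : exists s, separated s Lambda.
Proof.
have M3 : 0 < M / 3 by rewrite divr_gt0.
have [n hn] := mball_lim 0 mOmega Omega_fin M3; have {}hn := hn n%:Z (lexx _).
exists (- n%:Z) => x y Lx Ly xy; apply: contrapT => /eqP nxy.
have := orth Lx Ly nxy; rewrite ip_ee => h0.
pose g z : C := 2 * cind R (bset n%:Z 0) z - 1.
have bi : bmf (cind R (bset n%:Z 0)) by apply: bmf_cind; exact: measurable_bset.
have bg : bmf g by apply: bmfD; [exact: bmfZ|exact: bmf_cst].
have : Re (I g) <= Re (I (fun z => ch ((x - y) * z))).
  apply: (le_Rintegral mOmega); [exact: integrable_Re|exact/integrable_Re/bmf_ch|].
  move=> z _; rewrite /g; have [hz|hz] := pselect (bset n%:Z 0 z).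
    rewrite cindT // mulr1 addrK ch_int //.
    have hi := ch_inv R xy.
    have : pball (n%:Z) z by move: hz; rewrite bsetE subr0.
    move=> zn; have : padic_norm ((x - y) * z) <= p%:R ^ (- n%:Z) * p%:R ^ n%:Z.
      by rewrite padic_normM ler_pM ?padic_norm_ge0.
    by rewrite -expfzDr ?p_neq0 // addNr.
  rewrite cindF // mulr0 sub0r.
  have := Re_le_cabs (ch ((x - y) * z)); rewrite normc_ch ler_norml => /andP [+ _].
  by [].
rewrite h0 /g CintegralD //; [|exact: bmfZ|exact: bmf_cst].
rewrite CintegralZ // (@eq_Cintegral _ _ _ m Omega (cind R _) (fun z => cind R (bset n%:Z 0) z * 1)); last first.
  by move=> z _; rewrite mulr1.
have mb := @measurable_bset p p_pr n%:Z 0.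
rewrite Cintegral_cind !Cintegral_cst //; last exact: measurableI.
rewrite -/(mball Omega n%:Z 0) -/M /= => h.
move: hn h; rewrite -/M; set b := mball _ _ _; rewrite !mul0r !mul1r !subr0 => *; lra.
Qed.

Section Branching.
Variables (i : int) (u v : Qp).
Hypothesis uv : psphere i (u - v).
Hypothesis u0 : mball Omega i u != 0.
Hypothesis v0 : mball Omega i v != 0.
Local Notation U := (bset i u).
Local Notation V := (bset i v).
Let k := - (i + 1).

Let mU : measurable U. Proof. exact: measurable_bset. Qed.
Let mV : measurable V. Proof. exact: measurable_bset. Qed.

Let UV y : U y -> V y -> False.
Proof.
move=> Uy Vy; have := bset_disj (p_pr := p_pr) (k := i) (z := u) (z' := v).
case/andP: uv => _ nb /(_ nb) h; have : (U `&` V) y by [].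
by rewrite h.
Qed.

Local Notation F W x := (piece_ft Omega W u x).

Let bF W x : measurable W -> bmf (fun y => cind R W y * ch (- (x * (y - u)))).
Proof.
move=> mW; apply: bmfM; first exact: bmf_cind.
rewrite (_ : (fun y => _) = (fun y => ch (x * u) * ch ((- x) * y))); first exact/bmfZ/bmf_ch.
by apply/funext => y; rewrite -chD; congr ch; ring.
Qed.

Let F_shift W x w c : measurable W -> (forall y, W y -> ch (- (w * (y - u))) = c) ->
  F W (x + w) = c * F W x.
Proof.
move=> mW h; rewrite !piece_ftE -CintegralZ //; last exact: bF.
apply: eq_Cintegral => y _; have [Wy|nW] := pselect (W y); last by rewrite cindF // !mul0r mulr0.
by rewrite cindT // !mul1r -(h y Wy) -chD; congr ch; ring.
Qed.

Let pball_prod a b x y : pball a x -> pball b y -> pball (a + b) (x * y).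
Proof.
by move=> hx hy; rewrite /pball padic_normM expfzDr ?p_neq0 // ler_pM ?padic_norm_ge0.
Qed.

Let pm x y l : pball (- l) x -> pball l y -> ch (- (x * y)) = 1.
Proof. by move=> hx hy; rewrite ch_int // pballN -(addNr l); exact: pball_prod. Qed.

Let Uu y : U y -> pball i (y - u). Proof. by []. Qed.
Let Vv y : V y -> pball i (y - v). Proof. by []. Qed.
Let Vu y : V y -> pball (i + 1) (y - u).
Proof.
move=> /Vv Vy; apply: (@pball_trans _ _ _ v); first by apply: pball_le Vy; clear; lia.
by rewrite pball_sym; case/andP: uv.
Qed.

Let a (x : Qp) : C := F U x * conjc (F V x).

Let FU_inv x w : pball (- i) w -> F U (x + w) = F U x.
Proof. by move=> hw; rewrite (@F_shift U x w 1) ?mul1r // => y /Uu; exact: pm. Qed.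

Let FV_inv x w : pball k w -> F V (x + w) = F V x.
Proof. by move=> hw; rewrite (@F_shift V x w 1) ?mul1r // => y /Vu; exact: pm. Qed.

Let FV_shift x w : pball (- i) w -> F V (x + w) = ch (- (w * (v - u))) * F V x.
Proof.
move=> hw; apply: F_shift => // y /Vv Vy.
have -> : - (w * (y - u)) = - (w * (y - v)) + - (w * (v - u)) by ring.
by rewrite chD (pm hw Vy) mul1r.
Qed.

Let ki : k <= - i. Proof. by rewrite /k; clear; lia. Qed.
Let k1 : k + 1 = - i. Proof. by rewrite /k; clear; lia. Qed.

Let a_inv : ball_inv k a.
Proof.
move=> x w hw; have h1 := FV_inv x hw; have h2 := FU_inv x (pball_le ki hw).
by rewrite /a h1 h2.
Qed.

Let a_mean0 x : bsum k 1 a x = 0.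
Proof.
rewrite /bsum (eq_bigr (fun j : 'I__ => a x * ch (j%:R * (ppow (k + 1%N%:Z) * (v - u))))) => [|j _].
  rewrite -mulr_sumr sum_ch; last first.
    rewrite (mulrC (ppow _)) pballM pball_sym; case/andP: uv => h _; apply: pball_le h.
    by rewrite /k; clear; lia.
  rewrite (mulrC (ppow _)) pballM pball_sym; case/andP: uv => _ /negPf h.
  by rewrite (_ : 0 - _ = i) ?h ?mulr0 //; rewrite /k; clear; lia.
have hw : pball (- i) (j%:R * ppow (k + 1%N%:Z)) by rewrite pball_natM // k1.
have cM (b c : C) : conjc (b * c) = conjc b * conjc c.
  by case: b c => [b1 b2] [c1 c2]; apply/eqP; rewrite eq_complex /=; apply/andP; split; apply/eqP; ring.
have h1 := FU_inv x hw; have h2 := FV_shift x hw.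
rewrite /a h1 h2 cM -chN opprK mulrA -[RHS]mulrA [RHS]mulrCA [in RHS]mulrC.
by congr (_ * ch _ * _); rewrite mulrA.
Qed.

Let a0 : a 0 != 0.
Proof.
have F0 W : measurable W -> F W 0 = RtoC (fine (m (Omega `&` W))).
  move=> mW; rewrite piece_ftE (@eq_Cintegral _ _ _ _ _ _ (fun y => cind R W y * 1)); last first.
    by move=> y _; rewrite mul0r oppr0 ch0.
  by rewrite Cintegral_cind Cintegral_cst ?mul1r //; exact: measurableI.
rewrite /a !F0 // mulf_neq0 //; apply/eqP => h.
  by move/eqP: u0; apply; have := congr1 Re h.
by move/eqP: v0; apply; have := congr1 Re h.
Qed.

(* Bessel's inequality in the ball of level i + 1 around u, whose characters of
   frequencies in distinct balls of level k are orthogonal *)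
Let FW_l2 W n x : measurable W -> W `<=` bset (i + 1) u ->
  bsum k n (fun y => cabs (F W y) ^+ 2) x <= mu (i + 1) * mu (i + 1).
Proof.
move=> mW WB; pose B := bset (i + 1) u; have mB : measurable B by exact: measurable_bset.
have Bfin := bset_fin m_haar (i + 1) u.
pose xi (j : nat) := x + j%:R * ppow (k + n%:Z).
pose f := cind R (Omega `&` W); have mOW := measurableI _ _ mOmega mW.
have bf : bmf f by exact: bmf_cind.
have FE z : cabs (F W z) = cabs (L2_dot m B f (e z)).
  have -> : L2_dot m B f (e z) = ch (- (z * u)) * F W z.
    rewrite piece_ftE -CintegralZ; [|by []|by []|exact: bF].
    rewrite /L2_dot (@eq_Cintegral _ _ _ m Omega _ (fun y => cind R W y * conjc (e z y))); last first.
      by move=> y _; rewrite mulrCA -chD -chN; congr (_ * ch _); ring.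
    rewrite !Cintegral_cind; congr (Cintegral m _ _).
    by apply/seteqP; split => y; [case=> _ []|case=> ? Wy; split => //; exact: WB].
  by rewrite cabsM normc_ch mul1r.
rewrite /bsum (eq_bigr (fun j : 'I__ => cabs (L2_dot m B f (e (xi j))) ^+ 2)) => [|j _]; last by rewrite FE.
have us : uniq (index_iota 0 (p ^ n)) by exact: iota_uniq.
have mi : mu (i + 1) = fine (m B) by rewrite m_bset.
have hb : \sum_(j <- index_iota 0 (p ^ n)) cabs (L2_dot m B f (e (xi j))) ^+ 2 <=
    mu (i + 1) * \int[m]_(y in B) (cabs (f y) ^+ 2).
  apply: (bessel mB Bfin (fun j => be (xi j)) (mu_gt0 m_haar _) us _ _ bf); last first.
    by move=> j _; rewrite ip_e // mi.
  move=> j l; rewrite !mem_index_iota /= => jn ln jl; rewrite ip_ee.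
  apply: Cintegral_ball; apply: contra jl => h; apply/eqP.
  apply: (pball_rep_uniq jn ln (k := k)).
  have -> : j%:R * ppow (k + n%:Z) - l%:R * ppow (k + n%:Z) = xi j - xi l by rewrite /xi; ring.
  exact: h.
rewrite -(big_mkord xpredT (fun j => cabs (L2_dot m B f (e (xi j))) ^+ 2)).
apply: le_trans hb _; apply: ler_wpM2l; first exact: mu_ge0.
rewrite mi -[fine _]mul1r -Rintegral_cst //; apply: le_Rintegral => //.
- exact: integrable_cabs2.
- exact: (integrable_Re mB Bfin (bmf_cst _ 1)).
move=> y _; rewrite /f; have [h|h] := pselect ((Omega `&` W) y).
  by rewrite cindT // ComplexField.Normc.normc1 expr1n.
by rewrite cindF // cabs0 expr0n.
Qed.

Let a_l1 n x : bsum k n (fun y => cabs (a y)) x <= mu (i + 1) * mu (i + 1).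
Proof.
have UB : U `<=` bset (i + 1) u by apply: sub_bset; rewrite lerDl.
have h1 := FW_l2 n x mU UB; have h2 := FW_l2 n x mV Vu.
apply: (@le_trans _ _ ((bsum k n (fun y => cabs (F U y) ^+ 2) x + bsum k n (fun y => cabs (F V y) ^+ 2) x) / 2)).
  rewrite -bsumD mulrC -bsum_scal; apply: ler_bsum => y.
  rewrite /a cabsM cabs_conj; exact: mean_sqr.
by rewrite ler_pdivrMr // mulr_natr mulr2n; exact: (lerD h1 h2).
Qed.

(* the function whose Fourier coefficients against the spectrum are the
   combinations F U + c F V, up to unimodular factors *)
Let f (c : C) (x : Qp) y : C := ch (x * y) * (cind R U y + c * cind R V y).

Let bf c x : bmf (f c x).
Proof.
apply: bmfM; first exact: bmf_ch.
by apply: bmfD; [exact: bmf_cind|apply: bmfZ; exact: bmf_cind].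
Qed.

Let ip_f c x (l : Qp) : cabs (ip (f c x) (e l)) = cabs (F U (l - x) + c * F V (l - x)).
Proof.
have -> : ip (f c x) (e l) = ch (- ((l - x) * u)) * (F U (l - x) + c * F V (l - x)).
  rewrite !piece_ftE -CintegralZ //; last exact: bF.
  rewrite -CintegralD //; [|exact: bF|by apply: bmfZ; exact: bF].
  rewrite -CintegralZ //; last by apply: bmfD; [exact: bF|apply: bmfZ; exact: bF].
  apply: eq_Cintegral => y _; rewrite /f /e -chN.
  have -> : ch (x * y) * (cind R U y + c * cind R V y) * ch (- (l * y)) =
     (cind R U y + c * cind R V y) * (ch (x * y) * ch (- (l * y))) by ring.
  have -> : ch (x * y) * ch (- (l * y)) = ch (- ((l - x) * u)) * ch (- ((l - x) * (y - u))).
    by rewrite -!chD; congr ch; ring.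
  by ring.
by rewrite cabsM normc_ch mul1r.
Qed.

Let nrm2_f c x : cabs c = 1 -> nrm2 (f c x) = nrm2 (f 1 x).
Proof.
move=> c1; apply: eq_Rintegral => y _; congr (_ ^+ 2); rewrite /f !cabsM !normc_ch !mul1r.
have [Vy|nV] := pselect (V y); last by rewrite (cindF _ nV) !mulr0.
have nU : ~ U y by move=> /UV /(_ Vy).
by rewrite (cindF _ nU) !add0r cindT // mulr1 c1 ComplexField.Normc.normc1.
Qed.

(* parseval only controls squared moduli, and a is a product of two transforms *)
Let polar (b c : C) : b * conjc c = 
  Complex ((cabs (b + 1 * c) ^+ 2 - cabs (b + (-1) * c) ^+ 2) / 4)
          ((cabs (b + 'i%C * c) ^+ 2 - cabs (b + (- 'i%C) * c) ^+ 2) / 4).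
Proof.
rewrite !cabs_sqr; case: b c => [b1 b2] [c1 c2]; apply/eqP; rewrite eq_complex /=.
by apply/andP; split; apply/eqP; field.
Qed.

(** Let [a] be the product of the Fourier transform of the part of [Omega] in the
    ball around [u] with the conjugate of the one for [v]. By Parseval's identity,
    the sum of [a (l - x)] over the spectrum is [M] times the inner product of two
    functions with disjoint supports, which is 0. Since both pieces lie in the
    ball of level [i + 1] around [u], [a] is constant on the balls of level [k]. It
    has mean zero on those of level [k + 1]: a frequency in the ball of level
    [k + 1] around 0 leaves the first factor unchanged and multiplies the second
    one by its value at [v - u]. And [a 0] is the product of the measures of the
    pieces. So [convolution_dichotomy] applies to the counting function of the
    spectrum. *)
Lemma branching_balanced s n : separated s Lambda -> k = s + n%:Z ->
  ball_inv (k + 1) (cnt Lambda s n).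
Proof.
move=> sL kE; have sk : s <= k by rewrite kE lerDl.
apply: (@convolution_dichotomy p p_pr R k (cnt Lambda s n) a (p ^ n) (mu (i + 1) * mu (i + 1))).
- by rewrite kE; exact: cnt_inv.
- exact: cnt_le.
- exact: a_inv.
- exact: a_mean0.
- exact: a_l1.
- move=> x eps eps0; have d0 : 0 < eps / M by rewrite divr_gt0.
  pose dev c S := nrm2 (f c x) - \sum_(l <- S) cabs (ip (f c x) (e l)) ^+ 2 / M.
  have devP c : exists n0 : nat, forall r, (n0 <= r)%N -> 0 <= dev c (points Lambda s r) <= eps / M.
    have [s0 sL0 h0] := parseval (bf c x) d0.
    have [n0 hn0] : exists n0 : nat, forall l : Qp, l \in s0 -> forall r : nat, (n0 <= r)%N -> pball (s + r%:Z) l.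
      elim: (s0) => [|l s1 [n1 h1]]; first by exists 0%N.
      have [n2 h2] := pball_ex l; exists (n1 + (n2 + `|s|))%N => l'.
      rewrite inE => /orP [/eqP ->|l1] r rn; last by apply: h1 => //; apply: leq_trans rn; exact: leq_addr.
      by apply: h2; move: rn; clear; lia.
    exists n0 => r rn; have SL (l : Qp) : l \in points Lambda s r -> Lambda l by move=> /(mem_points r l sL) [].
    apply/andP; split.
      rewrite /dev subr_ge0 -mulr_suml ler_pdivrMr // mulrC.
      exact: (bessel_spectrum (bf c x) (uniq_points _ _ _) SL).
    apply: h0 => [|//|l l0]; first exact: uniq_points.
    by apply/(mem_points r l sL); split; [exact: sL0|exact: hn0].
  have [[n1 h1] [n2 h2]] := (devP 1, devP (-1)).
  have [[n3 h3] [n4 h4]] := (devP 'i%C, devP (- 'i%C)).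
  exists (n1 + n2 + n3 + n4)%N => r hr.
  have -> : bsum k r (fun z => (cnt Lambda s n z)%:R * a (z - x)) 0 =
      \sum_(l <- points Lambda s (n + r)) a (l - x).
    rewrite sum_points; last by move=> z w hw; rewrite addrAC; apply: a_inv; exact: pball_le hw.
    rewrite bsum_comp -kE; apply: eq_bsum => z; rewrite /cnt bsum_nat_eq.
    transitivity (bsum s n (fun u => a (u - x) * (meets Lambda s u)%:R) z); last first.
      by apply: eq_bsum => y; exact: mulrC.
    rewrite (bsum_mull _ _ (g := fun u => a (u - x))); first exact: mulrC.
    by rewrite -kE => y w hw; rewrite addrAC; exact: a_inv.
  pose S := points Lambda s (n + r).
  pose P c := \sum_(l <- S) cabs (ip (f c x) (e l)) ^+ 2.
  have Pdev c : P c = M * (nrm2 (f c x) - dev c S).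
    rewrite /dev opprB addrCA subrr addr0 -mulr_suml mulrC divfK // gt_eqF //.
  have -> : \sum_(l <- S) a (l - x) = Complex ((P 1 - P (-1)) / 4) ((P 'i%C - P (- 'i%C)) / 4).
    apply/eqP; rewrite eq_complex; apply/andP; split; apply/eqP.
      rewrite Re_sum /P -sumrB mulr_suml; apply: eq_bigr => l _.
      by rewrite !ip_f /a polar.
    have Im_sum (r' : seq Qp) (G : Qp -> C) : Im (\sum_(j <- r') G j) = \sum_(j <- r') Im (G j).
      by elim/big_ind2: _ => // b b' c c' <- <-; rewrite ImD.
    rewrite Im_sum -[RHS]/((P 'i%C - P (- 'i%C)) / 4) /P -sumrB mulr_suml.
    by apply: eq_bigr => l _; rewrite !ip_f /a polar.
  have hS n0 : (n0 <= n1 + n2 + n3 + n4)%N -> (n0 <= n + r)%N by move: hr; clear; lia.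
  have {}h1 := h1 _ (hS n1 ltac:(clear; lia)); have {}h2 := h2 _ (hS n2 ltac:(clear; lia)).
  have {}h3 := h3 _ (hS n3 ltac:(clear; lia)); have {}h4 := h4 _ (hS n4 ltac:(clear; lia)).
  have i1 : cabs ('i%C : C) = 1 by rewrite /= expr0n expr1n add0r sqrtr1.
  have N1 : cabs (-1 : C) = 1 by rewrite cabsN ComplexField.Normc.normc1.
  have Ni : cabs (- 'i%C : C) = 1 by rewrite cabsN.
  have bd c c' : cabs c = 1 -> cabs c' = 1 -> 0 <= dev c S <= eps / M ->
      0 <= dev c' S <= eps / M -> `|(P c - P c') / 4| <= eps / 2.
    move=> hc hc' d1 d2; rewrite !Pdev (nrm2_f x hc) (nrm2_f x hc').
    exact: deviation_bound.
  apply: le_trans (cabs_le_ReIm _) _; rewrite (splitr eps); apply: lerD.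
    exact: (bd 1 (-1) (ComplexField.Normc.normc1 R) N1 h1 h2).
  exact: (bd _ _ i1 Ni h3 h4).
- by exists 0.
Qed.

End Branching.
End Spectrum.
End Spectral.

Section SpectralHomogeneous.
Variables (R : realType) (p : nat) (p_pr : prime p).
Local Notation Qp := (padic p_pr).
Variables (m : {measure set Qp -> \bar R}) (m_haar : is_haar m).
Local Notation ppow := (@ppow p p_pr).
Local Notation bset := (@bset p p_pr).
Local Notation mball := (mball m).
Local Notation mu := (mu m).
Local Notation C := (R[i]).
Local Notation RtoC := (real_complex R).
Local Notation cabs := (@ComplexField.Normc.normc R).
Local Notation ch := (@ch p p_pr R).
Implicit Types (x y z w t : Qp) (k l s : int) (n i : nat) (A B D H : set Qp).
Variables (Omega Lambda : set Qp).
Hypothesis mOmega : measurable Omega.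
Hypothesis Omega_gt0 : (0 < m Omega)%E.
Hypothesis Omega_fin : (m Omega < +oo)%E.
Hypothesis basis : orthogonal_basis m Omega Lambda (@padic_char p p_pr R).

Let M := fine (m Omega).

Let M0 : 0 < M.
Proof. by rewrite fine_gt0 // Omega_gt0. Qed.

Definition branching k : Prop := exists z z',
  [/\ mball Omega k z != 0, mball Omega k z' != 0 & psphere k (z - z')].

Lemma charged_ball k : exists z, mball Omega k z != 0.
Proof.
apply: contrapT => /forallNP h; have z0 z : mball Omega k z = 0.
  by apply/eqP/negPn/negP => /h.
by move: Omega_gt0; rewrite (null_of_balls m_haar mOmega z0) ltxx.
Qed.

Lemma charged_le k n z : mball Omega k z != 0 -> mball Omega (k + n%:Z) z != 0.
Proof.
move=> h; rewrite gt_eqF //; apply: lt_le_trans (mball_le_level m_haar k n z mOmega).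
by rewrite lt_def h mball_ge0.
Qed.

Lemma charged_child k n z : mball Omega (k + n%:Z) z != 0 ->
  exists2 y, pball (k + n%:Z) (y - z) & mball Omega k y != 0.
Proof.
rewrite (mball_bsum m_haar) // => nz.
have [j hj] : exists j : 'I_(p ^ n), mball Omega k (z + j%:R * ppow (k + n%:Z)) != 0.
  apply: contrapT => /forallNP h; move/negP: nz; apply; apply/eqP/big1 => j _.
  by apply/eqP/negPn/negP => /h.
exists (z + j%:R * ppow (k + n%:Z)) => //.
by rewrite addrAC subrr add0r pball_natM.
Qed.

Lemma unbranched_child k z : ~ branching k -> mball Omega k z != 0 ->
  mball Omega (k + 1) z = mball Omega k z.
Proof.
move=> nb hz; rewrite -[1]/(1%N%:Z) (mball_bsum m_haar) // /bsum.
rewrite (bigD1 (Ordinal (expp_gt0 p_pr 1))) //= mul0r addr0 big1 ?addr0 // => j.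
rewrite -(inj_eq val_inj) /= => j0; apply/eqP/negPn/negP => hj; apply: nb.
exists z, (z + j%:R * ppow (k + 1%N%:Z)); split => //.
rewrite opprD addrA subrr add0r psphereN /psphere pball_natM //=.
by rewrite pball_natu gtnNdvd // ?lt0n // ltn_ord.
Qed.

Lemma unbranched_le k z (B : R) : ~ branching k -> 0 <= B ->
  (forall y, mball Omega k y <= B) -> mball Omega (k + 1) z <= B.
Proof.
move=> nb B0 hB; have [->//|nz] := eqVneq (mball Omega (k + 1) z) 0.
have [y yz hy] := charged_child (n := 1) nz.
by rewrite -(ball_invE (@mball_inv _ _ _ m Omega (k + 1)) yz) unbranched_child.
Qed.

Lemma spectrum_neq0 : exists x, Lambda x.
Proof.
apply: contrapT => /forallNP h; have M2 : 0 < M / 2 by rewrite divr_gt0.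
have [s0 s0L h0] := parseval mOmega Omega_gt0 Omega_fin basis (bmf_cst _ 1) M2.
have := h0 [::] isT; rewrite big_nil subr0 => /(_ (fun x => _)) h1.
have : nrm2 m Omega (fun=> 1) <= M / 2.
  by apply: h1 => // x /s0L /h.
rewrite /nrm2 Rintegral_cst // ComplexField.Normc.normc1 expr1n mul1r -/M.
by move: M0; set q := M; lra.
Qed.

(** Bessel's inequality for the indicator of a small ball that [Omega] fills almost
    completely, with all the elements of the spectrum whose characters are
    constant on this ball: their coefficients have the largest modulus that is
    possible. *)
Lemma spectral_upper_density s n k : separated s Lambda -> s + n%:Z = - k ->
  (forall i, (n <= i)%N -> ball_inv (s + i%:Z + 1) (cnt Lambda s i)) ->
  (cnt Lambda s n 0)%:R * mu k <= M.
Proof.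
move=> sL sk bal; rewrite leNgt; apply/negP => lt.
set c := cnt Lambda s n 0 in lt *; have cm0 : 0 < c%:R * mu k := lt_trans M0 lt.
have c0 : 0 < c%:R :> R by rewrite -(pmulr_lgt0 _ (mu_gt0 m_haar k)).
have t1 : M / (c%:R * mu k) < 1 by rewrite ltr_pdivrMr ?mul1r.
have [k' [u [kk hu]]] := density_ball m_haar k mOmega Omega_gt0 Omega_fin t1.
have [r kE] : exists r : nat, k = k' + r%:Z by exists (absz (k - k')%R); move: kk; clear; lia.
pose S := points Lambda s (n + r).
have szS : size S = (p ^ r * c)%N.
  rewrite /S size_points cntD /bsum (eq_bigr (fun=> c)) => [|j _].
    by rewrite sumr_const card_ord -mulr_natl natn.
  exact: (cnt_const bal).
pose U := bset k' u; have mU : measurable U by exact: measurable_bset.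
have bU : bmf (cind R U) by exact: bmf_cind.
set b := mball Omega k' u in hu; have b0 : 0 < b.
  by apply: le_lt_trans hu; rewrite mulr_ge0 ?divr_ge0 ?mu_ge0 // ltW.
have mOU := measurableI _ _ mOmega mU.
have nU : nrm2 m Omega (cind R U) = b.
  have := nrm2E m mOmega bU.
  have -> : L2_dot m Omega (cind R U) (cind R U) = RtoC b.
    rewrite /L2_dot (@eq_Cintegral _ _ _ _ _ _ (fun y => cind R U y * 1)); last first.
      move=> y _; have [Uy|nUy] := pselect (U y); last by rewrite cindF // !mul0r.
      by rewrite cindT // !mul1r conjc1.
    by rewrite Cintegral_cind Cintegral_cst // mul1r.
  by move/(congr1 (@complex.Re R)) => /= <-.
have SL x : x \in S -> Lambda x by move=> /(mem_points (n + r) x sL) [].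
have ipS x : x \in S -> cabs (L2_dot m Omega (cind R U) (fun y => ch (x * y))) = b.
  move=> /(mem_points (n + r) x sL) [_ hx].
  have -> : L2_dot m Omega (cind R U) (fun y => ch (x * y)) = ch (- (x * u)) * RtoC b.
    rewrite /L2_dot Cintegral_cind (@eq_Cintegral _ _ _ _ _ _ (fun=> ch (- (x * u)))).
      by rewrite Cintegral_cst.
    move=> y [_ Uy]; rewrite -chN.
    have -> : - (x * y) = - (x * (y - u)) + - (x * u) by ring.
    rewrite chD ch_int ?mul1r // pballN /pball padic_normM.
    have -> : p%:R ^ (0 : int) = p%:R ^ (- k') * p%:R ^ k' :> rat.
      by rewrite -expfzDr ?p_neq0 // addNr.
    apply: ler_pM; rewrite ?padic_norm_ge0 //.
    move: hx; rewrite (_ : s + (n + r)%N%:Z = - k') //; move: sk kE; clear; lia.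
  rewrite cabsM normc_ch mul1r /= expr0n addr0 sqrtr_sqr ger0_norm //.
  exact: ltW.
have := bessel_spectrum mOmega Omega_gt0 Omega_fin basis bU (uniq_points _ _ _) SL.
rewrite (eq_big_seq (fun=> b ^+ 2)) => [|x xS]; last by rewrite ipS.
rewrite big_const_seq count_predT szS iter_addr_0 nU expr2 -mulrnAl.
rewrite ler_pM2r // -mulr_natl natrM => h.
move: hu; rewrite -(ltr_pM2l c0) -(ltr_pM2l (_ : 0 < (p ^ r)%:R :> R)) ?ltr0n ?expp_gt0 //.
rewrite [ltRHS]mulrA ltNge; apply/negP/negPn; apply: le_trans h _.
rewrite kE (muX m_haar) le_eqVlt -/M; apply/orP; left; apply/eqP.
have mu0 : mu k' != 0 by rewrite gt_eqF ?(mu_gt0 m_haar).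
have P0 : (p ^ r)%:R != 0 :> R by rewrite pnatr_eq0 -lt0n expp_gt0.
move: c0 mu0 P0 => /lt0r_neq0; set C := c%:R; set X := mu k'; set Y := (p ^ r)%:R; set N := M.
by move=> C0 X0 Y0; field; rewrite Y0 X0 C0.
Qed.

(** At a branching level the spectrum is equidistributed at the dual level, by
    [branching_balanced]. Let [w] be the number of leaves of the tree that branches
    completely at the branching levels between [s1] and [- s]. Equidistribution
    gives the spectrum at least [w] points in a ball of level [- s1], while [Omega]
    has measure at most [mu s1 * w] because its tree branches at these levels only.
    By [spectral_upper_density] the number of points of the spectrum in a ball of
    level [- s1] is at most [M / mu s1]. So these inequalities are equalities, and
    the tree of [Omega] branches completely at each of these levels. *)
Theorem spectral_homogeneous : exists2 H, homogeneous H & aeq m Omega H.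
Proof.
have [s sL] := spectrum_separated mOmega Omega_gt0 Omega_fin basis.
have [t0 Lt0] := spectrum_neq0.
have bal s' k n : separated s' Lambda -> branching k -> - (k + 1) = s' + n%:Z ->
    ball_inv (s' + n%:Z + 1) (cnt Lambda s' n).
  move=> sL' [z [z' [hz hz' zz']]] kE; rewrite -kE.
  exact: (branching_balanced m_haar mOmega Omega_gt0 Omega_fin basis zz' hz hz' sL' kE).
(* a branching level k >= - s would contradict the separation of the spectrum,
   whence Omega lies in one ball of level - s up to a null set *)
have top k : - s <= k -> ~ branching k.
  move=> ks bk; have ks' : - (k + 1) < s by move: ks; clear; lia.
  have sL' : separated (- (k + 1)) Lambda by apply: separated_le sL; exact: ltW.
  have := bal _ k 0%N sL' bk; rewrite addr0 => /(_ erefl) h.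
  apply: (separated_unbalanced sL Lt0 ks').
  by move=> z w hw; have := h z w hw; rewrite !cnt0.
have [y0 hy0] := charged_ball (- s).
have My0 : mball Omega (- s) y0 = M.
  apply/eqP; rewrite eq_le (mball_leM m_haar) //=; apply/ler_addgt0Pr => e e0.
  have [n0 hn0] := mball_lim y0 mOmega Omega_fin e0.
  have cst n : mball Omega (- s + n%:Z) y0 = mball Omega (- s) y0.
    elim: n => [|n IH]; first by rewrite addr0.
    rewrite (_ : - s + n.+1%:Z = - s + n%:Z + 1); last by clear; lia.
    rewrite unbranched_child // ?charged_le //.
    by apply: top; rewrite lerDl.
  by rewrite -lerBlDr -(cst (n0 + `|s|)%N); apply: hn0; clear; lia.
(* a ball that Omega fills to more than one half branches at all smaller levels *)
have [|s1 [z1 [s1s hz1]]] := density_ball m_haar (t := 1 / 2) (- s) mOmega Omega_gt0 Omega_fin.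
  by lra.
have low k : k < s1 -> branching k.
  move=> ks; apply: contrapT => nb; have [n nE] : exists n : nat, s1 = k + 1 + n%:Z.
    by exists (absz (s1 - (k + 1))%R); move: ks; clear; lia.
  move: hz1; rewrite nE (mball_bsum m_haar) // (muX m_haar) -[k + 1]/(k + 1%N%:Z) (muX m_haar) expn1.
  have : bsum (k + 1%N%:Z) n (mball Omega (k + 1%N%:Z)) z1 <= (p ^ n)%:R * mu k.
    rewrite mulr_natl -[X in _ <= _ *+ X]card_ord -sumr_const; apply: ler_sum => j _.
    by apply: unbranched_le => // [|y]; [exact: mu_ge0|exact: (mball_mu m_haar)].
  set b := bsum _ _ _ _ => h1 h2; have := lt_le_trans h2 h1.
  have P0 : 0 < (p ^ n)%:R * mu k by rewrite mulr_gt0 ?ltr0n ?expp_gt0 // mu_gt0.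
  have p2 : 2 <= p%:R :> R by rewrite ler_nat prime_gt1.
  rewrite (_ : 1 / 2 * ((p ^ n)%:R * (p%:R * mu k)) = p%:R / 2 * ((p ^ n)%:R * mu k)); last by field.
  rewrite ltNge; apply/negP/negPn; rewrite ler_peMl ?(ltW P0) //.
  by move: p2; set q := p%:R; lra.
have [e eE] : exists e : nat, - s = s1 + e%:Z by exists (absz (- s - s1)%R); move: s1s; clear; lia.
pose D q := `[< branching (s1 + q%:Z) >].
pose J r := `[< branching (- (s + r%:Z + 1)) >].
have balJ r : J r -> ball_inv (s + r%:Z + 1) (cnt Lambda s r).
  move=> /asboolP h; apply: (bal _ _ _ sL h); clear; lia.
have balt r : (e <= r)%N -> ball_inv (s + r%:Z + 1) (cnt Lambda s r).
  move=> er; apply: balJ; apply/asboolP; apply: low; move: eE er; clear; lia.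
have wE : wgt p J e = wgt p D e.
  rewrite /wgt (reindex_inj rev_ord_inj) /=; apply: eq_bigr => i _.
  congr (if _ then _ else _); rewrite /J /D; congr (asbool (branching _)).
  have := ltn_ord i; move: eE; clear; lia.
have mus : 0 < mu s1 := mu_gt0 m_haar s1.
have cw : (wgt p D e <= cnt Lambda s e t0)%N.
  by rewrite -wE; apply: cnt_wgt => // r _; exact: balJ.
have cM : (cnt Lambda s e t0)%:R * mu s1 <= M.
  rewrite (cnt_const balt _ 0); apply: (@spectral_upper_density s e) => //.
  by move: eE; clear; lia.
have S1 q : s1 + q.+1%:Z = s1 + q%:Z + 1 by clear; lia.
have bE q z : mball Omega (s1 + q.+1%:Z) z = bsum (s1 + q%:Z) 1 (mball Omega (s1 + q%:Z)) z.
  by rewrite S1 -[1]/(1%N%:Z) (mball_bsum m_haar).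
have upper q z : mball Omega (s1 + q%:Z) z <= mu s1 * (wgt p D q)%:R.
  elim: q z => [|q IH] z.
    by rewrite addr0 /wgt big_ord0 mulr1; exact: (mball_mu m_haar).
  rewrite wgtS; case: ifP => Dq; last first.
    rewrite muln1 S1; apply: unbranched_le => //; first by move/asboolPn: Dq.
    by rewrite mulr_ge0 ?ler0n // ltW.
  rewrite bE natrM mulrA mulr_natr -[X in _ *+ X]expn1 -[X in _ <= _ *+ X]card_ord -sumr_const.
  by apply: ler_sum.
have Mw : M = mu s1 * (wgt p D e)%:R.
  apply/eqP; rewrite eq_le; apply/andP; split; first by rewrite -My0 eE; exact: upper.
  by apply: le_trans cM; rewrite mulrC ler_wpM2r ?(ltW mus) // ler_nat.
(* equality in the chain of estimates propagates down to level s1 *)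
have down q z : D q -> mball Omega (s1 + q.+1%:Z) z = mu s1 * (wgt p D q.+1)%:R ->
    mball Omega (s1 + q%:Z) z = mu s1 * (wgt p D q)%:R.
  move=> Dq; rewrite wgtS Dq natrM mulrA bE /bsum (bigD1 (Ordinal (expp_gt0 p_pr 1))) //=.
  rewrite mul0r addr0 => h; apply/eqP; rewrite eq_le upper /=.
  set B := mu s1 * _ in h *.
  have : \sum_(j < p ^ 1 | j != Ordinal (expp_gt0 p_pr 1))
      mball Omega (s1 + q%:Z) (z + j%:R * ppow (s1 + q%:Z + 1%N%:Z)) <=
      \sum_(j < p ^ 1 | j != Ordinal (expp_gt0 p_pr 1)) B by apply: ler_sum.
  rewrite sumr_const; set K := #|_| => h2.
  have KE : K.+1 = p.
    rewrite /K cardC1 card_ord expn1 prednK //; exact: prime_gt0.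
  move: h; rewrite -[X in B * X%:R]KE -natr1 mulrDr mulr1 mulr_natr => h.
  by move: h h2; set X1 := mball _ _ _; set X2 := \sum_(_ < _ | _) _; set X3 := B *+ K; lra.
have lev q : (q <= e)%N -> forall z, mball Omega (s1 + q%:Z) z != 0 ->
    mball Omega (s1 + q%:Z) z = mu s1 * (wgt p D q)%:R.
  move=> qe; rewrite -(subKn qe); elim: (e - q)%N => [|i IH] z.
    rewrite subn0 -Mw -eE => hz.
    have [zy|nzy] := boolP (pball (- s) (z - y0)).
      by rewrite (ball_invE (@mball_inv _ _ _ m Omega (- s)) zy).
    have := mball_disj m_haar mOmega Omega_fin nzy; rewrite My0 -/M.
    have := mball_ge0 m Omega (- s) z; move/eqP: hz; set b := mball _ _ _ => nb b0 b1.
    by exfalso; apply: nb; apply/eqP; rewrite eq_le b0 andbT; move: b1; set q' := M; lra.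
  have [ei|ie] := leqP e i.
    by move: IH => /(_ z); rewrite (_ : e - i = e - i.+1)%N //; move: ei; clear; lia.
  have iE : (e - i = (e - i.+1).+1)%N by move: ie; clear; lia.
  move: IH => /(_ z); rewrite iE; set r := (e - i.+1)%N => IH hz.
  have hzr : mball Omega (s1 + r.+1%:Z) z != 0.
    by rewrite S1 -[1]/(1%N%:Z); exact: charged_le.
  have [Dr|nD] := boolP (D r); first by apply: down => //; exact: IH.
  rewrite -unbranched_child //; last by move/asboolPn: nD.
  by rewrite -S1 IH // wgtS (negPf nD) muln1.
have full z : mball Omega s1 z != 0 -> mball Omega s1 z = mu s1.
  by move=> hz; have := lev 0%N (leq0n _) z; rewrite addr0 /wgt big_ord0 mulr1; apply.
exists [set z | mball Omega s1 z != 0]; last first.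
  apply: (aeq_full m_haar) => // z; have [->|/full ->] := eqVneq (mball Omega s1 z) 0; by [left|right].
have chE q z : mball Omega s1 z != 0 -> mball Omega (s1 + q%:Z) z != 0 by exact: charged_le.
split.
- exact: charged_ball.
- by exists s1 => z u hu; rewrite /= mball_inv.
- exists (- s) => x y /(chE e) hx /(chE e) hy; rewrite -eE in hx hy.
  apply/negPn/negP => nb; have := mball_disj m_haar mOmega Omega_fin nb.
  have hx1 := lev e (leqnn e) x; have hy1 := lev e (leqnn e) y.
  rewrite eE in hx hy *; rewrite hx1 // hy1 // -Mw -/M.
  by move: M0; set q := M; lra.
move=> k x y hx hy kxy z u hz hu.
have [ks|sk] := ltP k s1.
  exists (z + u); last by rewrite subrr pball0.
  by rewrite /= mball_inv //; apply: pball_le hu; move: ks; clear; lia.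
have [q kE] : exists q : nat, k = s1 + q%:Z by exists (absz (k - s1)%R); move: sk; clear; lia.
subst k; have bq : branching (s1 + q%:Z) by exists x, y; split => //; exact: chE.
have qe : (q < e)%N.
  rewrite ltnNge; apply/negP => eq; apply: (top (s1 + q%:Z)) => //.
  by move: eE eq; clear; lia.
have hzq : mball Omega (s1 + q%:Z) (z + u) = mu s1 * (wgt p D q)%:R.
  apply: down; first exact/asboolP.
  have -> : mball Omega (s1 + q.+1%:Z) (z + u) = mball Omega (s1 + q.+1%:Z) z.
    by rewrite mball_inv // S1.
  by apply: lev => //; exact: chE.
have [|t tz ht] := @charged_child s1 q (z + u).
  by rewrite hzq mulf_neq0 ?gt_eqF // ltr0n wgt_gt0.
by exists t => //; rewrite pball_sym.
Qed.

End SpectralHomogeneous.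

(** * Digit sets *)

Section Digits.
Variables (p : nat) (p_pr : prime p).
Local Notation Qp := (padic p_pr).
Local Notation ppow := (@ppow p p_pr).
Implicit Types (x y z w t : Qp) (k l s b : int) (n i j : nat) (J : int -> bool).

(** The sums of multiples [j * ppow (k + 1)] with [j < p], over the levels [k] in
    [J] with [b <= k < b + n]: numbers with prescribed positions of the digits. *)
Fixpoint digits b J n : seq Qp :=
  if n is n'.+1 then
    if J (b + n'%:Z) then
      [seq x + j%:R * ppow (b + n%:Z) | x <- digits b J n', j <- iota 0 p]
    else digits b J n'
  else [:: 0].

Lemma digits_pball b J n x : x \in digits b J n -> pball (b + n%:Z) x.
Proof.
elim: n x => [|n IH] x /=; first by rewrite inE => /eqP ->; exact: pball0.
have le y : y \in digits b J n -> pball (b + n.+1%:Z) y.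
  by move=> /IH; apply: pball_le; lia.
case: ifP => _; last exact: le.
by move=> /allpairsP [[y j] /= [/le hy _ ->]]; apply: pballD => //; exact: pball_natM.
Qed.

Lemma sub_digits b J n i x : (n <= i)%N -> x \in digits b J n -> x \in digits b J i.
Proof.
move=> /subnK <-; elim: (i - n)%N => [|r IH] // /IH h; rewrite addSn /=; case: ifP => // _.
apply/allpairsP; exists (x, 0%N) => /=; rewrite h mem_iota prime_gt0 //.
by rewrite mul0r addr0.
Qed.

(** The level is the highest one at which the digits differ. *)
Lemma digits_level b J n x y : x \in digits b J n -> y \in digits b J n -> x != y ->
  exists2 k, J k & psphere k (x - y).
Proof.
elim: n x y => [|n IH] x y /=; first by rewrite !inE => /eqP -> /eqP ->; rewrite eqxx.
case: ifP => Jn; last exact: IH.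
move=> /allpairsP [[x' i] /= [hx hi ->]] /allpairsP [[y' j] /= [hy hj ->]].
rewrite !mem_iota /= add0n in hi hj.
have [<- xy|ij _] := eqVneq i j.
  have [|k Jk hk] := IH _ _ hx hy; first by apply: contraNneq xy => ->.
  by exists k => //; rewrite opprD addrACA subrr addr0.
exists (b + n%:Z) => //.
rewrite (_ : _ - _ = (i%:R * ppow (b + n.+1%:Z) - j%:R * ppow (b + n.+1%:Z)) + (x' - y')); last by ring.
rewrite psphereDr; last by apply: pballB; [exact: digits_pball hx|exact: digits_pball hy].
have -> : b + n.+1%:Z = b + n%:Z + 1%N%:Z by lia.
rewrite /psphere pballB ?pball_natM //=; apply: contra ij => h; apply/eqP.
by apply: (pball_rep_uniq _ _ h); rewrite expn1.
Qed.

Definition digit_set b J : set Qp := [set x | exists n, x \in digits b J n].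

Lemma digit_set_level b J x y : digit_set b J x -> digit_set b J y -> x != y ->
  exists2 k, J k & psphere k (x - y).
Proof.
move=> [n hx] [i hy]; apply: (@digits_level _ _ (n + i)); apply: sub_digits.
- exact: leq_addr.
- exact: hx.
- exact: leq_addl.
- exact: hy.
Qed.

End Digits.

(** * Homogeneous sets are tiles *)

Section HomogeneousTile.
Variables (p : nat) (p_pr : prime p).
Local Notation Qp := (padic p_pr).
Local Notation ppow := (@ppow p p_pr).
Local Notation digits := (@digits p p_pr).
Local Notation digit_set := (@digit_set p p_pr).
Implicit Types (x y z w t : Qp) (k l s b : int) (n i j : nat) (H : set Qp).

Definition branches H k : bool := `[< exists x y, [/\ H x, H y & psphere k (x - y)] >].

Lemma homogeneous_compact H : homogeneous H -> compact H.
Proof.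
move=> [[x0 Hx0] [s Hs] [e He] _]; apply: (subclosed_compact _ (@compact_bset p p_pr e x0)).
  rewrite -openC; apply: (@open_ball_inv _ _ s) => z w hw; rewrite /setC /=.
  by rewrite Hs.
by move=> x Hx; exact: He.
Qed.

(** Induction on the radius of a ball that contains [x] and a point of [H]. At a
    branching level, all the children of the ball around this point meet [H], among
    them the one of [x]; at another level, subtracting a digit moves [x] to the
    child of the point of [H]. *)
Lemma digits_translate H s n x : homogeneous H -> ball_inv s H ->
  (exists2 y, H y & pball (s + n%:Z) (x - y)) ->
  exists2 t, t \in digits s (fun k => ~~ branches H k) n & H (x - t).
Proof.
move=> [_ _ _ hom] Hs; elim: n x => [|n IH] x [y Hy xy].
  by exists 0; rewrite ?inE // subr0 (ball_invE Hs (y := y)) // -[s]addr0.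
have sE : s + n.+1%:Z = s + n%:Z + 1 by lia.
rewrite sE in xy; rewrite /=; case: ifP => [nb|/negbFE /asboolP [x1 [x2 [h1 h2 h12]]]].
  have [j jn hj] := @pball_rep p p_pr (s + n%:Z) 1 _ xy.
  have [|t ht Ht] := IH (x - j%:R * ppow (s + n%:Z + 1)).
    by exists y => //; rewrite addrAC.
  exists (t + j%:R * ppow (s + n%:Z + 1)).
    apply/allpairsP; exists (t, j) => /=; rewrite mem_iota ht sE.
    by rewrite expn1 in jn; rewrite jn.
  by rewrite opprD addrCA addrC.
apply: IH; have [t Ht ht] := hom _ _ _ h1 h2 h12 y (x - y) Hy xy.
by exists t => //; move: ht; rewrite subrKC.
Qed.

(** The differences of points of the digit set have levels at which [H] does not
    branch, whereas the differences of points of [H] have branching levels. *)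
Lemma homogeneous_tiling H : homogeneous H -> exists s, forall x, exists t,
  [/\ digit_set s (fun k => ~~ branches H k) t, H (x - t) &
    forall t', digit_set s (fun k => ~~ branches H k) t' -> H (x - t') -> t' = t].
Proof.
move=> homH; have [[y0 Hy0] [s Hs] _ _] := homH; exists s => x.
have [n hn] := pball_ex (x - y0).
have [|t ht Ht] := @digits_translate H s (n + `|s|) x homH Hs.
  by exists y0 => //; apply: hn; lia.
exists t; split => //; first by exists (n + `|s|)%N.
move=> t' ht' Ht'; apply: contrapT => /eqP ne.
have [|k /negP nb tk] := digit_set_level ht' _ ne; first by exists (n + `|s|)%N.
apply: nb; apply/asboolP; exists (x - t), (x - t'); split => //.
by rewrite (_ : _ - _ = t' - t) //; ring.
Qed.

End HomogeneousTile.

Section HomogeneousTileMeasure.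
Variables (R : realType) (p : nat) (p_pr : prime p).
Local Notation Qp := (padic p_pr).
Variables (m : {measure set Qp -> \bar R}) (m_haar : is_haar m).
Local Notation digits := (@digits p p_pr).
Local Notation digit_set := (@digit_set p p_pr).
Implicit Types (x y z w t : Qp) (k l s b : int) (n i j : nat) (H : set Qp).

Lemma homogeneous_measurable H : homogeneous H -> measurable H.
Proof. by move=> [_ [s Hs] _ _]; exact: measurable_ball_inv Hs. Qed.

(** Outside a countable union of translates of the null sets in which [A] and [H]
    differ, the translates of [A] and [H] contain the same points. *)
Lemma homogeneous_tile A H : measurable A -> homogeneous H -> aeq m A H ->
  translational_tile m A.
Proof.
move=> mA homH [AH HA]; have mH := homogeneous_measurable homH.
have [s hs] := homogeneous_tiling homH; pose J k := ~~ branches H k.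
pose T := digit_set s J; exists T.
pose E := (A `\` H) `|` (H `\` A).
have mE : measurable E by apply: measurableU; exact: measurableD.
have E0 : m E = 0%E.
  by apply/negligibleP => //; apply: negligibleU; apply/negligibleP => //; exact: measurableD.
apply: (@negligibleS _ _ _ _ (\bigcup_n \bigcup_i [set x | E (x - nth 0 (digits s J n) i)])); last first.
  apply: negligible_bigcup => n; apply: negligible_bigcup => i.
  apply/negligibleP; first exact: measurable_shift.
  exact: (etrans (measure_shift m_haar _ mE) E0).
move=> x /=; apply: contra_notP => nE.
have AE t : T t -> A (x - t) <-> H (x - t).
  move=> [n tn]; have nEt : ~ E (x - t).
    by move=> Et; apply: nE; exists n => //; exists (index t (digits s J n)); rewrite //= nth_index.
  split => h; apply: contrapT => nh; apply: nEt; [by left|by right].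
have [t [Tt Ht Hu]] := hs x.
rewrite (esumID [set t]) //.
rewrite (_ : T `&` [set t] = [set t]); last first.
  by apply/seteqP; split => [y []|y ->].
rewrite esum_set1 ?lee_fin // esum1 ?adde0 => [|t' [Tt' /= ne]].
  by rewrite indicE mem_set //; apply/(AE _ Tt).
rewrite indicE memNset // => /(AE _ Tt') h; apply: ne; exact: Hu.
Qed.

Lemma homogeneous_almost_compact_open A H : homogeneous H -> aeq m A H ->
  almost_compact_open m A.
Proof.
move=> homH [AH HA]; exists H; split => //; first exact: homogeneous_compact.
by have [_ [s Hs] _ _] := homH; exact: open_ball_inv Hs.
Qed.

End HomogeneousTileMeasure.

(** * Density of the locally constant functions *)

Section StepFunctions.
Variable R : realType.

(** The sum counts the positive integers up to [y]. *)
Lemma count_floor n (y : R) : 0 <= y <= n%:R ->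
  y - 1 <= \sum_(j < n) (nat_of_bool (j.+1%:R <= y)%R)%:R <= y.
Proof.
elim: n => [|n IH]; first by rewrite big_ord0; lra.
move=> /andP [y0 yn]; rewrite big_ord_recr /=; have [ny|yn'] := leP y n%:R.
  have -> : (n.+1%:R <= y) = false by apply/negbTE; rewrite -ltNge -natr1; lra.
  by rewrite addr0; apply: IH; rewrite y0.
rewrite (eq_bigr (fun=> 1)) => [|j _]; last first.
  by have -> : (j.+1%:R <= y); first by apply: le_trans (ltW yn'); rewrite ler_nat.
rewrite sumr_const card_ord; move: yn; rewrite -natr1 => yn.
have [ny|ny] := leP (n%:R + 1) y; first by rewrite ny /=; lra.
by rewrite /= ?mulr0n addr0; lra.
Qed.

End StepFunctions.

Section Approximation.
Variables (R : realType) (p : nat) (p_pr : prime p).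
Local Notation Qp := (padic p_pr).
Variables (m : {measure set Qp -> \bar R}) (D : set Qp).
Hypothesis mD : measurable D.
Hypothesis Dfin : (m D < +oo)%E.
Local Notation C := (R[i]).
Local Notation Re := (@complex.Re R).
Local Notation Im := (@complex.Im R).
Local Notation RtoC := (real_complex R).
Local Notation cabs := (@ComplexField.Normc.normc R).
Local Notation nrm2 := (nrm2 m D).
Implicit Types (f g phi : Qp -> C) (k : int).

Definition approximable g : Prop := forall eps : R, 0 < eps -> exists k phi,
  [/\ ball_inv k phi, bmf phi & nrm2 (fun x => g x - phi x) < eps].

Lemma cabsB_sqr (a b c : C) :
  cabs (a - c) ^+ 2 <= 2 * cabs (a - b) ^+ 2 + 2 * cabs (b - c) ^+ 2.
Proof.
rewrite !cabs_sqr; case: a b c => [a1 a2] [b1 b2] [c1 c2] /=.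
have := sqr_ge0 ((a1 - b1) - (b1 - c1)); have := sqr_ge0 ((a2 - b2) - (b2 - c2)).
nra.
Qed.

Lemma nrm2B f g phi : bmf f -> bmf g -> bmf phi ->
  nrm2 (fun x => f x - phi x) <=
  2 * nrm2 (fun x => f x - g x) + 2 * nrm2 (fun x => g x - phi x).
Proof.
move=> hf hg hp; have b1 := bmfD hf (bmfN hp).
have b2 := bmfD hf (bmfN hg); have b3 := bmfD hg (bmfN hp).
have i2 := integrable_cabs2 mD Dfin b2; have i3 := integrable_cabs2 mD Dfin b3.
rewrite -!RintegralZl // -RintegralD //; last 2 first.
- exact: integrableZl i2.
- exact: integrableZl i3.
apply: le_Rintegral => //; first exact: integrable_cabs2.
- exact: (integrableD mD (integrableZl mD 2 i2) (integrableZl mD 2 i3)).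
- by move=> x _; exact: cabsB_sqr.
Qed.

Lemma nrm2_le f c : bmf f -> (forall x, cabs (f x) <= c) -> nrm2 f <= c ^+ 2 * fine (m D).
Proof.
move=> hf fc; rewrite -Rintegral_cst //; apply: le_Rintegral => //.
- exact: integrable_cabs2.
- by apply: (bounded_integrable mD Dfin (K := `|c ^+ 2|)) => //; exact: measurable_cst.
by move=> x _; rewrite ler_sqr ?nnegrE ?cabs_ge0 // (le_trans _ (fc x)) // cabs_ge0.
Qed.

Lemma approximable_locally_constant k phi : ball_inv k phi -> bmf phi -> approximable phi.
Proof.
move=> hk hp eps e0; exists k, phi; split => //.
by rewrite /nrm2 (@eq_Rintegral _ _ _ _ _ (fun=> 0)) ?Rintegral_cst ?mul0r // => x _;
  rewrite subrr cabs0 expr0n.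
Qed.

Lemma approximable_unif g : bmf g ->
  (forall d : R, 0 < d -> exists g', [/\ approximable g', bmf g' & forall x, cabs (g x - g' x) <= d]) ->
  approximable g.
Proof.
move=> hg h eps e0; have M0 : 0 <= fine (m D) by exact: fine_ge0.
have M1 : 0 < 4 * (fine (m D) + 1) by lra.
pose d := Num.min 1 (eps / (4 * (fine (m D) + 1))).
have d0 : 0 < d by rewrite lt_min ltr01 divr_gt0.
have [g' [ag hg' gg']] := h _ d0; have e4 : 0 < eps / 4 by rewrite divr_gt0.
have [k [phi [hk hp ap]]] := ag _ e4; exists k, phi; split => //.
apply: le_lt_trans (nrm2B hg hg' hp) _.
have := nrm2_le (bmfD hg (bmfN hg')) gg' => b.
have d2 : d ^+ 2 * fine (m D) <= eps / 4.
  apply: le_trans (_ : d * (fine (m D) + 1) <= _).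
    by rewrite expr2 -mulrA ler_wpM2l ?(ltW d0) //;
      apply: le_trans (_ : 1 * fine (m D) <= _); rewrite ?ler_wpM2r ?ge_min ?lexx //; lra.
  have : d <= eps / (4 * (fine (m D) + 1)) by rewrite ge_min lexx orbT.
  by rewrite ler_pdivlMr //; lra.
by move: b ap d2; set u := nrm2 _; set v := nrm2 _; lra.
Qed.

Lemma approximableD f g : bmf f -> bmf g -> approximable f -> approximable g ->
  approximable (fun x => f x + g x).
Proof.
move=> hf hg af ag eps e0; have e4 : 0 < eps / 4 by rewrite divr_gt0.
have [k [phi [hk hp ap]]] := af _ e4; have [l [psi [hl hps aps]]] := ag _ e4.
exists (Num.min k l), (fun x => phi x + psi x); split.
- move=> x w hw; rewrite hk ?hl //; apply: pball_le hw; rewrite ge_min lexx ?orbT //.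
- exact: bmfD.
have b2 := bmfD hf hg; have b1 := bmfD hp hg; have b3 := bmfD hp hps.
apply: le_lt_trans (nrm2B b2 b1 b3) _.
rewrite (_ : (fun x => f x + g x - (phi x + g x)) = (fun x => f x - phi x)); last first.
  by apply/funext => x; ring.
rewrite (_ : (fun x => phi x + g x - (phi x + psi x)) = (fun x => g x - psi x)); last first.
  by apply/funext => x; ring.
by move: ap aps; set u := nrm2 _; set v := nrm2 _; lra.
Qed.

Lemma approximableZ c f : bmf f -> approximable f -> approximable (fun x => c * f x).
Proof.
move=> hf af eps e0; pose a := cabs c ^+ 2 + 1.
have c0 : 0 <= cabs c ^+ 2 by exact: sqr_ge0.
have a0 : 0 < a by rewrite /a; lra.
have [k [phi [hk hp ap]]] := af (eps / a) (divr_gt0 e0 a0).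
exists k, (fun x => c * phi x); split.
- by move=> x w hw; rewrite hk.
- exact: bmfZ.
have -> : nrm2 (fun x => c * f x - c * phi x) = cabs c ^+ 2 * nrm2 (fun x => f x - phi x).
  rewrite /nrm2 -RintegralZl //; last exact: (integrable_cabs2 mD Dfin (bmfD hf (bmfN hp))).
  by apply: eq_Rintegral => x _; rewrite -mulrBr cabsM exprMn.
have n0 := nrm2_ge0 m D (fun x => f x - phi x).
move: ap; rewrite ltr_pdivlMr //; apply: le_lt_trans.
by rewrite mulrC ler_wpM2l // /a; lra.
Qed.

Lemma approximable_sum n (F : nat -> Qp -> C) : (forall j, bmf (F j)) ->
  (forall j, approximable (F j)) -> approximable (fun x => \sum_(j < n) F j x).
Proof.
move=> bF aF; elim: n => [|n IH].
  rewrite (_ : (fun x => _) = fun=> 0); last by apply/funext => x; rewrite big_ord0.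
  by apply: (@approximable_locally_constant 0) => //; exact: bmf_cst.
rewrite (_ : (fun x => _) = fun x => \sum_(j < n) F j x + F n x); last first.
  by apply/funext => x; rewrite big_ord_recr.
apply: approximableD => //.
rewrite (_ : (fun x => _) = fun x => \sum_(j <- iota 0 n) F j x); first exact: bmf_sum.
by apply/funext => x; rewrite -(big_mkord xpredT (fun j => F j x)) /index_iota subn0.
Qed.

Lemma approximable_cind A : measurable A -> approximable (cind R A).
Proof.
move=> mA eps e0; have [k [B [Bi hB]]] := ball_approx mD Dfin mA e0.
have mB := measurable_ball_inv Bi; exists k, (cind R B); split.
- by move=> x w hw; apply: cindE; rewrite Bi.
- exact: bmf_cind.
have mS := measurable_symdiff mA mB.
rewrite /nrm2 (@eq_Rintegral _ _ _ _ _ (\1_(symdiff A B))) => [|x _]; last first.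
  rewrite indicE; have [Ax|nA] := pselect (A x); have [Bx|nB] := pselect (B x).
  - by rewrite !cindT // subrr cabs0 expr0n memNset // => -[[]|[]].
  - by rewrite cindT // cindF // subr0 ComplexField.Normc.normc1 expr1n mem_set //; left.
  - by rewrite cindF // cindT // sub0r cabsN ComplexField.Normc.normc1 expr1n mem_set //; right.
  - by rewrite !cindF // subrr cabs0 expr0n memNset // => -[[]|[]].
rewrite /Rintegral integral_indic // -lte_fin fineK 1?setIC //.
rewrite ge0_fin_numE //; apply: le_lt_trans Dfin; apply: le_measure; rewrite ?inE //.
exact: measurableI.
Qed.

(** Step functions with steps of height [d] approximate [h] uniformly. *)
Lemma approximable_real (h : Qp -> R) K : measurable_fun setT h ->
  (forall x, `|h x| <= K) -> approximable (fun x => RtoC (h x)).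
Proof.
move=> mh hK; have bR (g : Qp -> R) L : measurable_fun setT g -> (forall x, `|g x| <= L) ->
    bmf (fun x => RtoC (g x)).
  move=> mg gL; split => //; first exact: measurable_cst.
  by exists L => x; rewrite /= expr0n addr0 sqrtr_sqr.
have K0 : 0 <= K := le_trans (normr_ge0 _) (hK 0).
apply: approximable_unif => [|d d0]; first exact: bR mh hK.
pose N := (Num.truncn (2 * K / d)).+1.
pose A (j : nat) := [set x | j.+1%:R <= (h x + K) / d].
have mA j : measurable (A j).
  have -> : A j = h @^-1` `[j.+1%:R * d - K, +oo[.
    apply/seteqP; split => x; rewrite /A /= in_itv /= andbT ler_pdivlMr //; lra.
  by rewrite -[X in measurable X]setTI; exact: mh.
pose g' x : C := RtoC (- K) + RtoC d * \sum_(j < N) cind R (A j) x.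
have bA j : bmf (cind R (A j)) by exact: bmf_cind.
have bS : bmf (fun x => \sum_(j < N) cind R (A j) x).
  rewrite (_ : (fun x => _) = fun x => \sum_(j <- iota 0 N) cind R (A j) x); first exact: bmf_sum.
  by apply/funext => x; rewrite -(big_mkord xpredT (fun j => cind R (A j) x)) /index_iota subn0.
exists g'; split.
- apply: approximableD; [exact: bmf_cst|exact: bmfZ| |].
    by apply: (@approximable_locally_constant 0) => //; exact: bmf_cst.
  apply: approximableZ => //; apply: (@approximable_sum N (fun j => cind R (A j))) => // j.
  exact: approximable_cind.
- by apply: bmfD; [exact: bmf_cst|exact: bmfZ].
move=> x; pose y := (h x + K) / d.
have hy : h x = - K + d * y by rewrite /y; field; rewrite gt_eqF.
have /andP [hx1 hx2] : - K <= h x <= K by rewrite -ler_norml.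
have y0N : 0 <= y <= N%:R.
  rewrite divr_ge0 ?(ltW d0) //=; last by lra.
  apply: ltW; apply: le_lt_trans (truncnS_gt _); rewrite ler_pM2r ?invr_gt0 //; lra.
have := count_floor y0N; set s := \sum_(_ < _) _ => /andP [s1 s2].
have -> : RtoC (h x) - g' x = RtoC (d * (y - s)).
  rewrite /g'.
  have -> : \sum_(j < N) cind R (A j) x = RtoC s.
    rewrite /s rmorph_sum; apply: eq_bigr => j _; rewrite /cind indicE; congr RtoC.
    have [hj|nj] := boolP (j.+1%:R <= y); first by rewrite mem_set.
    by rewrite memNset // /A /=; exact/negP.
  rewrite -rmorphM -rmorphD -rmorphB; congr RtoC; rewrite hy; ring.
rewrite /= expr0n addr0 sqrtr_sqr ger0_norm ?mulr_ge0 ?(ltW d0) //; last by lra.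
by rewrite -[leRHS]mulr1 ler_pM2l //; lra.
Qed.

Lemma approximable_bmf f : bmf f -> approximable f.
Proof.
move=> [mR mI [K hK]]; have iR := approximable_real mR (K := K).
have hR x : `|Re (f x)| <= K := le_trans (Re_le_cabs _) (hK x).
have hI x : `|Im (f x)| <= K := le_trans (Im_le_cabs _) (hK x).
have bR (g : Qp -> R) L : measurable_fun setT g -> (forall x, `|g x| <= L) ->
    bmf (fun x => RtoC (g x)).
  move=> mg gL; split => //; first exact: measurable_cst.
  by exists L => x; rewrite /= expr0n addr0 sqrtr_sqr.
rewrite (_ : f = fun x => RtoC (Re (f x)) + 'i%C * RtoC (Im (f x))); last first.
  by apply/funext => x; case: (f x) => a b; apply/eqP; rewrite eq_complex /=; apply/andP; split; apply/eqP; ring.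
apply: approximableD; [exact: bR mR hR|apply: bmfZ; exact: bR mI hI|exact: approximable_real mR hR|].
by apply: approximableZ; [exact: bR mI hI|exact: approximable_real mI hI].
Qed.

Lemma measurable_cabs2_on f : measurable_fun D (Re \o f) -> measurable_fun D (Im \o f) ->
  measurable_fun D (fun x => cabs (f x) ^+ 2).
Proof.
move=> mR mI; rewrite (_ : (fun _ => _) = (fun x => Re (f x) ^+ 2 + Im (f x) ^+ 2)).
  by apply: measurable_funD; apply: measurable_funX.
by apply/funext => x; rewrite cabs_sqr.
Qed.

Lemma measurable_cabs2B f g : measurable_fun D (Re \o f) -> measurable_fun D (Im \o f) ->
  bmf g -> measurable_fun D (fun x => cabs (f x - g x) ^+ 2).
Proof.
move=> mR mI [mRg mIg _]; apply: measurable_cabs2_on.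
  rewrite (_ : _ \o _ = (fun x => Re (f x) - Re (g x))).
    by apply: measurable_funB => //; exact: measurable_funTS.
  by apply/funext => x /=; case: (f x) (g x) => a b [].
rewrite (_ : _ \o _ = (fun x => Im (f x) - Im (g x))).
  by apply: measurable_funB => //; exact: measurable_funTS.
by apply/funext => x /=; case: (f x) (g x) => a b [].
Qed.

(** Truncation at a large value of [cabs (f x) ^+ 2], which changes [f] on a set of
    small measure; the integral of [cabs (f x) ^+ 2] is absolutely continuous. *)
Lemma L2_truncate f (eps : R) : L2_fun m D f -> 0 < eps ->
  exists2 g, bmf g & (L2_sqdist m D f g < eps%:E)%E.
Proof.
move=> [mR mI fin] e0; pose g0 (x : Qp) : R := cabs (f x) ^+ 2; pose G x : R := g0 x * \1_D x.
have mG2 := measurable_cabs2_on mR mI.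
have GD x : D x -> G x = g0 x by move=> Dx; rewrite /G indicE mem_set // mulr1.
have GE : EFin \o G = (fun x => (cabs (f x) ^+ 2)%:E) \_ D.
  apply/funext => x; rewrite /patch /= /G indicE; case: ifP => _ /=; first by rewrite mulr1.
  by rewrite mulr0.
have iG : m.-integrable setT (EFin \o G).
  rewrite GE; apply/(@integrable_mkcond _ _ _ m D _ mD); apply/integrableP; split.
    exact/measurable_EFinP.
  by rewrite (eq_integral (fun x => (cabs (f x) ^+ 2)%:E)) // => x _; rewrite /= ger0_norm // sqr_ge0.
have mG : measurable_fun setT G by apply/measurable_EFinP; exact: measurable_int iG.
have [d [d0 hd]] := integral_normr_continuous iG e0.
pose F (n : nat) := [set x | G x <= n%:R].
have mF n : measurable (F n).
  have -> : F n = G @^-1` `]-oo, n%:R] by apply/seteqP; split => x; rewrite /F /= in_itv.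
  by rewrite -[X in measurable X]setTI; exact: mG.
have UF : \bigcup_n F n = setT.
  apply/seteqP; split => // x _; exists (Num.truncn (G x)).+1 => //.
  exact/ltW/truncnS_gt.
have [|n hn] := @measure_union_tail _ _ _ m D F d mD Dfin mF _ d0.
  by move=> a b ab; apply/subsetPset => x; rewrite /F /= => /le_trans; apply; rewrite ler_nat.
set A := D `&` _ in hn; have mA : measurable A.
  by apply: measurableI => //; rewrite UF; exact: measurableD.
have := hd _ mA hn; set B := D `&` F n; have mB : measurable B by exact: measurableI.
move=> hA; exists (fun x => cind R B x * f x).
  have rM (r : C -> R) : r 0 = 0 -> measurable_fun D (fun x => r (f x)) ->
      measurable_fun setT (fun x => r (cind R B x * f x)).
    move=> r0 mr; apply/measurable_EFinP.
    have -> : EFin \o (fun x => r (cind R B x * f x)) = (fun x => (r (f x))%:E) \_ B.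
      apply/funext => x; rewrite /patch /=; have [Bx|nB] := pselect (B x).
        by rewrite cindT // mul1r mem_set.
      by rewrite cindF // mul0r memNset // r0.
    apply/(measurable_restrictT _ mB); apply: (measurable_funS mD); first exact: subIsetl.
    exact/measurable_EFinP.
  split; [exact: rM|exact: rM|].
  exists (n%:R + 1) => x; have [[Dx Fx]|nB] := pselect (B x); last first.
    by rewrite cindF // mul0r cabs0 addr_ge0.
  rewrite cindT // mul1r -ler_sqr ?nnegrE ?cabs_ge0 ?addr_ge0 //.
  move: Fx; rewrite /F /= GD // => /le_trans; apply.
  have n0 : 0 <= n%:R :> R by []; by move: n0; set q := n%:R; nra.
rewrite /L2_sqdist (eq_integral ((EFin \o (fun x => `|G x|)) \_ A)); last first.
  move=> x; rewrite inE => Dx; rewrite /patch /= GD //.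
  have [Bx|nB] := pselect (B x).
    by rewrite cindT // mul1r subrr cabs0 expr0n memNset // => -[_ [_]]; case: Bx.
  rewrite cindF // mul0r subr0 mem_set; last first.
    by split => //; rewrite UF; split => // Fx; apply: nB.
  by rewrite ger0_norm // sqr_ge0.
rewrite -integral_mkcondr (_ : D `&` A = A); last by rewrite setIA setIid.
move: hA; rewrite /Rintegral -lte_fin fineK // ge0_fin_numE; last exact: integral_ge0.
have /integrableP [_] : m.-integrable A (EFin \o G) by apply: integrableS iG.
by apply: le_lt_trans; rewrite le_eqVlt; apply/orP; left; apply/eqP/eq_integral.
Qed.

Theorem locally_constant_dense f (eps : R) : L2_fun m D f -> 0 < eps -> exists k phi,
  [/\ ball_inv k phi, bmf phi & (L2_sqdist m D f phi < eps%:E)%E].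
Proof.
move=> hf e0; have e4 : 0 < eps / 4 by rewrite divr_gt0.
have [g bg hg] := L2_truncate hf e4; have [k [phi [hk hp ap]]] := approximable_bmf bg e4.
exists k, phi; split => //.
have [mR mI _] := hf; have bgp := bmfD bg (bmfN hp).
have mB u := @measurable_cabs2B f u mR mI.
have mfg := mB _ bg.
have mgp : measurable_fun D (fun x => cabs (g x - phi x) ^+ 2).
  exact/measurable_funTS/measurable_cabs2.
have sq0 (c : C) : (0 <= (cabs c ^+ 2)%:E)%E by rewrite lee_fin sqr_ge0.
have e2 (u : Qp -> R) : measurable_fun D u -> measurable_fun D (fun x => (2%:E * (u x)%:E)%E).
  by move=> mu; apply: measurable_funeM; exact/measurable_EFinP.
have le : (L2_sqdist m D f phi <= 2%:E * L2_sqdist m D f g + 2%:E * L2_sqdist m D g phi)%E.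
  rewrite /L2_sqdist -!ge0_integralZl //; [|exact/measurable_EFinP|exact/measurable_EFinP].
  rewrite -ge0_integralD //; [|by move=> x _; exact: mule_ge0|exact: e2|by move=> x _; exact: mule_ge0|exact: e2].
  apply: ge0_le_integral => //.
  - by apply/measurable_EFinP; exact: mB.
  - exact: (emeasurable_funD (e2 _ mfg) (e2 _ mgp)).
  - by move=> x _; rewrite -!EFinM -EFinD lee_fin; exact: cabsB_sqr.
have hgp : (L2_sqdist m D g phi < (eps / 4)%:E)%E by rewrite L2_sqdistE // lte_fin.
apply: le_lt_trans le _.
have -> : eps%:E = (2%:E * (eps / 4)%:E + 2%:E * (eps / 4)%:E)%E.
  by rewrite -!EFinM -EFinD; congr EFin; field.
by apply: lteD; rewrite lte_pmul2l ?lte_fin // ltr0n.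
Qed.

End Approximation.

(** * Homogeneous sets are spectral *)

Section HomogeneousSpectral.
Variables (R : realType) (p : nat) (p_pr : prime p).
Local Notation Qp := (padic p_pr).
Variables (m : {measure set Qp -> \bar R}) (m_haar : is_haar m).
Local Notation ppow := (@ppow p p_pr).
Local Notation bset := (@bset p p_pr).
Local Notation mball := (mball m).
Local Notation mu := (mu m).
Local Notation C := (R[i]).
Local Notation RtoC := (real_complex R).
Local Notation cabs := (@ComplexField.Normc.normc R).
Local Notation ch := (@ch p p_pr R).
Implicit Types (x y z w t : Qp) (k l s e : int) (n i : nat) (A B : set Qp).

Lemma Cintegral_aeq A B (f : Qp -> C) : measurable A -> measurable B ->
  (m A < +oo)%E -> (m B < +oo)%E -> aeq m A B -> bmf f ->
  Cintegral m A f = Cintegral m B f.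
Proof.
move=> mA mB Afin Bfin [AB BA] bf.
have h (g : Qp -> R) : m.-integrable A (EFin \o g) -> m.-integrable B (EFin \o g) ->
    \int[m]_(x in A) g x = \int[m]_(x in B) g x.
  move=> iA iB; rewrite /Rintegral.
  rewrite (negligible_integral (measurableD mA mB) mA iA AB).
  by rewrite (negligible_integral (measurableD mB mA) mB iB BA) !setDD setIC.
rewrite /Cintegral; congr Complex; apply: h.
- exact: (integrable_Re mA Afin bf).
- exact: (integrable_Re mB Bfin bf).
- exact: (integrable_Im mA Afin bf).
- exact: (integrable_Im mB Bfin bf).
Qed.

Variables (H : set Qp) (s e : int) (y0 : Qp).
Hypothesis Hy0 : H y0.
Hypothesis Hs : ball_inv s H.
Hypothesis He : forall x y, H x -> H y -> pball e (x - y).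
Hypothesis Hhom : forall k x y, H x -> H y -> psphere k (x - y) ->
  forall z w, H z -> pball (k + 1) w -> exists2 t, H t & pball k (z + w - t).

Let mH : measurable H. Proof. exact: measurable_ball_inv Hs. Qed.

Let HE : H `&` bset e y0 = H.
Proof. by apply/seteqP; split => x; [case|move=> Hx; split => //; exact: He]. Qed.

Let Hfin : (m H < +oo)%E.
Proof.
rewrite -HE; apply: le_lt_trans (bset_fin m_haar e y0); apply: le_measure; rewrite ?inE //.
- by rewrite HE.
- exact: measurable_bset.
Qed.

Lemma meets_le k n z : (meets H k z <= meets H (k + n%:Z) z)%N.
Proof.
rewrite /meets; case: asboolP => // -[t Ht tz]; rewrite asboolT //.
by exists t => //; apply: pball_le tz; lia.
Qed.

Lemma branches_meets k : branches H k -> ball_inv (k + 1) (meets H k).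
Proof.
move=> /asboolP [x1 [x2 [h1 h2 h12]]] z w hw.
have imp z' w' : pball (k + 1) w' -> (exists2 t, H t & pball k (t - z')) ->
    exists2 t, H t & pball k (t - (z' + w')).
  move=> hw' [t Ht tz]; have [t' Ht' ht'] := Hhom h1 h2 h12 Ht hw'.
  exists t' => //; have -> : t' - (z' + w') = - (t + w' - t') + (t - z') by ring.
  by apply: pballD; rewrite ?pballN.
rewrite /meets; congr (nat_of_bool (asbool _)); apply/propext; split => h; last exact: imp.
by rewrite -[z](addrK w); apply: imp; rewrite ?pballN.
Qed.

Lemma bsum_meets k z :
  bsum k 1 (meets H k) z = ((if branches H k then p else 1) * meets H (k + 1) z)%N.
Proof.
pose u := ppow (k + 1%N%:Z).
have up j : (meets H k (z + j%:R * u)%R <= meets H (k + 1)%R z)%N.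
  apply: leq_trans (meets_le k 1 _) _; rewrite (@meets_inv p p_pr H (k + 1%N%:Z)) //.
  by rewrite pball_natM.
have [t|no] := pselect (exists2 t, H t & pball (k + 1) (t - z)); last first.
  have M0 : meets H (k + 1) z = 0%N by rewrite /meets asboolF.
  by rewrite M0 muln0 /bsum big1 // => j _; have := up j; rewrite M0 leqn0 => /eqP.
have M1 : meets H (k + 1) z = 1%N by rewrite /meets asboolT.
case: t => t Ht tz; have [j jp hj] := @pball_rep p p_pr k 1 _ tz.
have mj : meets H k (z + j%:R * u) = 1%N.
  by rewrite /meets asboolT //; exists t => //; rewrite opprD addrA.
rewrite M1 muln1; case: ifP => br.
  rewrite (bsum_const (c := 1%N)) ?expn1 ?natn // => w hw.
  have bi := branches_meets br.
  by rewrite bi // -(bi z (j%:R * u)) // pball_natM.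
rewrite /bsum (bigD1 (Ordinal jp)) //= mj big1 // => i ij.
apply/eqP; rewrite /meets; case: asboolP => // -[t' Ht' ht'].
exfalso; move/negP: br; apply; apply/asboolP; exists t, t'; split => //.
have zt' : pball (k + 1) (t' - z).
  have -> : t' - z = (t' - (z + i%:R * u)) + i%:R * u by ring.
  by apply: pballD; [apply: pball_le ht'; lia|exact: pball_natM].
rewrite /psphere; apply/andP; split.
  by apply: pball_trans tz _; rewrite pball_sym.
apply: contra ij => tt'; apply/eqP/val_inj => /=; apply/esym.
apply: (@pball_rep_uniq p p_pr k 1) => //.
have -> : j%:R * u - i%:R * u = - (t - z - j%:R * u) + ((t - t') + (t' - (z + i%:R * u))) by ring.
by apply: pballD; [rewrite pballN|exact: pballD].
Qed.

(** Going up one level multiplies the number by [p] or leaves it unchanged,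
    depending only on the level. *)
Lemma cnt_meets k n : exists c, forall z, cnt H k n z = (c * meets H (k + n%:Z) z)%N.
Proof.
elim: n => [|n [c IH]]; first by exists 1%N => z; rewrite addr0 mul1n cnt0.
exists (c * (if branches H (k + n%:Z) then p else 1))%N => z.
rewrite -addn1 cntD (eq_bsum _ _ _ IH).
rewrite (bsum_mull _ _ (g := fun=> c)) //.
by rewrite bsum_meets -mulnA (_ : k + (n + 1)%N%:Z = k + n%:Z + 1) //; lia.
Qed.

(** The measure of [H] is the same in all the children of a ball of level [k + 1],
    and the values of the character on these children are proportional to the
    [p]-th roots of unity. *)
Lemma Cintegral_branches k x : branches H k -> psphere (- (k + 1)) x ->
  Cintegral m H (fun y => ch (x * y)) = 0.
Proof.
move=> br /andP [x1 x2]; have kE : - (k + 1) + 1 = - k by lia.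
rewrite kE in x1; pose l := Num.min s k.
have ls : l <= s by rewrite ge_min lexx.
have lk : l <= k by rewrite ge_min lexx orbT.
have [n0 kl] : exists n0 : nat, k = l + n0%:Z.
  by exists (absz (k - l)%R); move: lk; clear; lia.
pose n2 := absz (e - (k + 1))%R; pose n := (n0 + 1 + n2)%N.
have eE : e <= l + n%:Z by rewrite /n /n2; move: kl; lia.
have HE' : H = H `&` bset (l + n%:Z) y0.
  by rewrite -HE -setIA (_ : bset e y0 `&` bset _ y0 = bset e y0) //; apply/setIidPl/sub_bset.
have chi : ball_inv k (fun y => ch (x * y)) := ch_inv R x1.
rewrite {1}HE' Cintegral_balls //; [|exact: bmf_ch|by apply: ball_inv_le chi; rewrite ge_min lexx orbT].
rewrite /n bsum_comp /bsum big1 // => j _; set z := _ + _.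
rewrite -/(bsum l (n0 + 1) (fun x1 : Qp => RtoC (mball H l x1) * ch (x * x1)) z).
have mE y : mball H l y = mu l * (meets H l y)%:R.
  have Hl : ball_inv l H := ball_inv_le ls Hs.
  rewrite -[H in LHS]setTI mball_ball_inv // mballT //.
  rewrite /meets; have -> : (exists2 t, H t & pball l (t - y)) = H y.
    apply/propext; split => [[t Ht ty]|Hy]; first by rewrite -(ball_invE Hl ty).
    by exists y => //; rewrite subrr pball0.
  by case: asboolP => _; rewrite ?mulr1 ?mulr0.
have [c hc] := cnt_meets l n0; rewrite -kl in hc.
pose g y : C := RtoC (mu l) * (c * meets H k y)%:R.
rewrite bsum_comp (eq_bsum _ _ _ (g := fun y => g y * ch (x * y))) => [|y]; last first.
  rewrite /g -hc /cnt (bsum_nat_eq C) -[RHS]mulrA [X in RtoC _ * X]mulrC.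
  rewrite -(bsum_mull _ _ (g := fun y => ch (x * y))); last by rewrite -kl.
  rewrite -bsum_scal; apply: eq_bsum => y'.
  by rewrite mE rmorphM rmorph_nat; ring.
have gi : ball_inv (k + 1) g by move=> y w hw; rewrite /g branches_meets.
rewrite -kl bsum_mull //.
rewrite /bsum (eq_bigr (fun j : 'I__ => ch (x * z) * ch (j%:R * (x * ppow (k + 1%N%:Z))))) => [|i _].
  rewrite -mulr_sumr sum_ch ?pballM; last by apply: pball_le x1; lia.
  by rewrite (_ : 0 - _ = - (k + 1)) ?(negPf x2) ?mulr0 //; lia.
by rewrite -chD; congr ch; ring.
Qed.

Local Notation J := (fun k => branches H (- (k + 1))).
Local Notation L := (@digits p p_pr (- e) J).

Lemma size_digits_gt0 n : (0 < size (L n))%N.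
Proof.
have : 0 \in L n by apply: (sub_digits (n := 0)) => //; rewrite inE.
by case: (L n).
Qed.

(** The Dirichlet kernel of the digit set is a product over the digits. Its factors
    are [p] as long as the dual level is above the one of [z]; the factor at the
    level of [z], where there is a digit by hypothesis, is the sum of all the
    [p]-th roots of unity. *)
Lemma digits_kernel n z : pball e z -> (forall k, psphere k z -> branches H k) ->
  \sum_(x <- L n) ch (x * z) = if pball (e - n%:Z) z then (size (L n))%:R else 0.
Proof.
move=> ez hz; elim: n => [|n IH] /=; first by rewrite big_seq1 mul0r ch0 subr0 ez.
have kE : - (- e + n%:Z + 1) = e - n.+1%:Z by lia.
rewrite kE; case: ifP => br; last first.
  rewrite IH; congr (if _ then _ else _); apply/idP/idP => [h|]; last by apply: pball_le; lia.
  apply: contraFT br => nh; apply: hz; rewrite /psphere nh andbT.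
  by apply: pball_le h; lia.
rewrite big_allpairs_dep size_allpairs size_iota.
rewrite (eq_bigr (fun x => ch (x * z) * \sum_(j < p ^ 1) ch (j%:R * (z * ppow (- e + n.+1%:Z))))) => [|x _].
  rewrite -mulr_suml IH; case: ifP => zn; last first.
    rewrite mul0r; case: ifP => // zn1; move/negP: zn; case.
    by apply: pball_le zn1; lia.
  rewrite sum_ch ?pballM; last by apply: pball_le zn; lia.
  rewrite (_ : 0 - _ = e - n.+1%:Z); last by lia.
  by case: ifP => _; rewrite ?mulr0 // -natrM expn1.
rewrite mulr_sumr expn1 -(big_mkord xpredT (fun j => ch (x * z) * ch (j%:R * (z * ppow (- e + n.+1%:Z))))).
rewrite /index_iota subn0; apply: eq_bigr => j _.
by rewrite -chD; congr ch; ring.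
Qed.

(** Fourier inversion: on differences of points of [H] the Dirichlet kernel of the
    digit set is a multiple of the indicator of a small ball. *)
Lemma locally_constant_trigonometric k (phi : Qp -> C) : ball_inv k phi -> exists n c,
  forall x, H x -> phi x = \sum_(t <- L n) c t * ch (t * x).
Proof.
move=> hk; pose l0 := Num.min s k; pose n := absz (e - l0)%R; pose l := e - n%:Z.
have ln : l + n%:Z = e by rewrite /l; lia.
have l0s : l0 <= s by rewrite ge_min lexx.
have l0k : l0 <= k by rewrite ge_min lexx orbT.
have ll0 : l <= l0 by rewrite /l /n; move: (l0); lia.
have Hl : ball_inv l H := ball_inv_le (le_trans ll0 l0s) Hs.
have pl : ball_inv l phi := ball_inv_le (le_trans ll0 l0k) hk.
pose N : C := (size (L n))%:R; have N0 : N != 0.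
  by rewrite pnatr_eq0 -lt0n size_digits_gt0.
pose c t := N^-1 * bsum l n (fun y => cind R H y * phi y * ch (- (t * y))) y0.
exists n, c => x Hx; pose F t y := cind R H y * phi y * (ch (- (t * y)) * ch (t * x)).
rewrite (eq_bigr (fun t => N^-1 * bsum l n (F t) y0)) => [|t _]; last first.
  rewrite /c -mulrA; congr (_ * _); rewrite mulrC -bsum_scal; apply: eq_bsum => y.
  by rewrite /F; ring.
rewrite -mulr_sumr -bsum_sum.
rewrite (eq_bsum _ _ _ (g := fun y => N * phi x * cind R (bset l y) x)) => [|y]; last first.
  rewrite /F -mulr_sumr; have [Hy|nHy] := pselect (H y); last first.
    rewrite cindF // mul0r mul0r cindF ?mulr0 // => yx; apply: nHy.
    by rewrite (ball_invE Hl (y := x)) // pball_sym.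
  rewrite cindT // mul1r (eq_bigr (fun t => ch (t * (x - y)))) => [|t _]; last first.
    by rewrite -chD; congr ch; ring.
  rewrite digits_kernel; [|exact: He|by move=> k' hk'; apply/asboolP; exists x, y].
  rewrite -/l -/N; have [xy|nxy] := boolP (pball l (x - y)); last first.
    by rewrite mulr0 cindF ?mulr0 //; exact/negP.
  by rewrite cindT // mulr1 mulrC (ball_invE pl xy).
rewrite bsum_scal /bsum -cind_bsum ln cindT ?mulr1; last exact: He.
by rewrite mulrA mulVf // mul1r.
Qed.

(** The spectrum consists of the numbers with digits at the levels dual to the
    branching levels of [H]. Orthogonality is [Cintegral_branches], because the
    differences of these numbers have levels dual to branching levels;
    completeness follows from [locally_constant_trigonometric] and the density of
    the locally constant functions. *)
Theorem homogeneous_spectral_levels Omega : measurable Omega -> (0 < m Omega)%E ->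
  (m Omega < +oo)%E -> aeq m Omega H -> spectral_set m Omega.
Proof.
move=> mO O0 Ofin OH; exists (digit_set (- e) J); split.
- by move=> x _; apply: bmf_L2 => //; exact: bmf_ch.
- move=> x _; rewrite (_ : L2_dot _ _ _ _ = RtoC (fine (m Omega))).
    by rewrite -(rmorph0 RtoC) (inj_eq (@complexI _)) gt_eqF // fine_gt0 // O0.
  rewrite -[RHS]mul1r -Cintegral_cst //.
  by apply: eq_Cintegral => y _; rewrite ch_unit.
- move=> x y Lx Ly xy; have [k br kxy] := digit_set_level Lx Ly xy.
  have -> : L2_dot m Omega (padic_char R x) (padic_char R y) =
      Cintegral m Omega (fun z => ch ((x - y) * z)).
    by apply: eq_Cintegral => z _; rewrite mulrBl chD chN.
  rewrite (Cintegral_aeq mO mH Ofin Hfin OH); last exact: bmf_ch.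
  by apply: (Cintegral_branches br); rewrite (_ : - _ = k) //; lia.
move=> f eps Lf eps0; have [k [phi [hk bp fp]]] := locally_constant_dense mO Ofin Lf eps0.
have [n [c hc]] := locally_constant_trigonometric hk; exists (L n), c.
split => [x xn|]; first by exists n.
apply: le_lt_trans fp; rewrite le_eqVlt; apply/orP; left; apply/eqP.
have [mR mI _] := Lf; have mOH := measurableD mO mH.
have mE (g : Qp -> C) : bmf g -> measurable_fun Omega (fun x => (cabs (f x - g x) ^+ 2)%:E).
  by move=> bg; apply/measurable_EFinP; exact: measurable_cabs2B.
have sq0 (g : Qp -> C) x : Omega x -> (0 <= (cabs (f x - g x) ^+ 2)%:E)%E.
  by move=> _; rewrite lee_fin sqr_ge0.
have bg : bmf (fun x => \sum_(i <- L n) c i * padic_char R i x).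
  by apply: bmf_sum => t; apply: bmfZ; exact: bmf_ch.
rewrite /L2_sqdist (ge0_negligible_integral mOH mO (mE _ bg) (sq0 _) OH.1).
rewrite (ge0_negligible_integral mOH mO (mE _ bp) (sq0 _) OH.1) setDD.
by apply: eq_integral => x; rewrite inE => -[_ Hx]; rewrite (hc x Hx).
Qed.

End HomogeneousSpectral.

Lemma homogeneous_spectral (R : realType) (p : nat) (p_pr : prime p)
    (m : {measure set (padic p_pr) -> \bar R}) (m_haar : is_haar m)
    (Omega H : set (padic p_pr)) : measurable Omega -> (0 < m Omega)%E ->
  (m Omega < +oo)%E -> homogeneous H -> aeq m Omega H -> spectral_set m Omega.
Proof.
move=> mO O0 Ofin [[y0 Hy0] [s Hs] [e He] hom].
exact: (homogeneous_spectral_levels m_haar Hy0 Hs He hom).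
Qed.

(** * The equivalence *)

Local Open Scope ereal_scope.

Theorem theorem1p1 (R : realType) (p : nat) (p_pr : prime p)
    (m : {measure set (padic p_pr) -> \bar R}) (m_haar : is_haar m)
    (Omega : set (padic p_pr)) (mOmega : measurable Omega)
    (Omega_gt0 : 0 < m Omega) (Omega_fin : m Omega < +oo) :
  (spectral_set m Omega <-> translational_tile m Omega) /\
  (spectral_set m Omega -> almost_compact_open m Omega).
Proof.
have spec_hom : spectral_set m Omega -> exists2 H, homogeneous H & aeq m Omega H.
  by move=> [Lambda bas]; exact: (spectral_homogeneous m_haar mOmega Omega_gt0 Omega_fin bas).
split; first split.
- by move=> /spec_hom [H hH OH]; exact: (homogeneous_tile m_haar mOmega hH OH).
- move=> [T tile]; have [H hH OH] := tile_homogeneous m_haar mOmega Omega_gt0 Omega_fin tile.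
  exact: (homogeneous_spectral m_haar mOmega Omega_gt0 Omega_fin hH OH).
- by move=> /spec_hom [H hH OH]; exact: (homogeneous_almost_compact_open hH OH).
Qed.
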